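(* Let $K\subseteq D\subseteq\mathbb{R}^n$ be a compact and strongly invariant set of the system $\dot x=f(t,x)$. Fix $\alpha\in[1,n)$ and write $\alpha=k+s$ with $k$ an integer and $s\in[0,1)$. Let $\Theta:K\to\mathbb{R}^{n\times n}$ be a $C^1$ scaling matrix with $\det(\Theta(z))\neq 0$ for all $z\in K$, and let $\bar J$ be the associated generalized Jacobian. Assume that there exist a matrix measure $\mu:\mathbb{R}^{n\times n}\to\mathbb{R}$ induced by an $L_p$ norm with $p\ge 1$ and a time $\tau>0$ such that $$\gamma_{\bar J}(\tau):=\max_{x_0\in K}\int_0^{\tau}\mu\big(\bar J^{[\alpha]}(\sigma,x(\sigma,x_0))\big)\,d\sigma<0 .$$ Then $\dim_H K<\alpha$.
   Context: **System.** $f$ is $C^1$, $x(t,x_0)$ denotes the solution at time $t$ of $\dot x=f(t,x)$ with $x(0)=x_0$, and $D\subseteq\mathbb{R}^n$ is an invariant set: $x_0\in D$ implies $x(t,x_0)\in D$ for all $t\ge 0$. $J_f(t,x):=\frac{\partial}{\partial x}f(t,x)$. A set $K\subseteq D$ is strongly invariant if $K=x(t,K)$ for all $t\ge 0$, where $x(t,K)=\{x(t,x_0):x_0\in K\}$. **Generalized Jacobian.** Let $\Theta_f(t,z)$ be the matrix obtained from $\Theta(z)=(\theta_{ij}(z))$ by replacing each entry $\theta_{ij}(z)$ by $\left(\frac{\partial\theta_{ij}(z)}{\partial z}\right)^T f(t,z)$. Then $\bar J(t,z):=\Theta_f(t,z)\Theta(z)^{-1}+\Theta(z)J_f(t,z)\Theta(z)^{-1}$.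 **Compounds.** For a matrix $A$, $A^{(k)}$ (the $k$ multiplicative compound) is the matrix of all $k\times k$ minors of $A$ in lexicographic order. For $A\in\mathbb{R}^{n\times n}$, $A^{[k]}:=\frac{d}{d\varepsilon}(I+\varepsilon A)^{(k)}|_{\varepsilon=0}$. For a non-integer $\alpha=k+s\in(1,n)$, $k\in\{1,\dots,n-1\}$, $s\in(0,1)$, the $\alpha$ multiplicative compound of a non-singular $B$ is $B^{(\alpha)}:=(B^{(k)})^{1-s}\otimes(B^{(k+1)})^s$, where $\otimes$ is the Kronecker product and real powers are principal powers (defined via the Jordan form, with $a^\beta=|a|^\beta e^{j\beta\theta(a)}$, $\theta(a)\in(-\pi,\pi]$ for scalars). The $\alpha$ additive compound is $A^{[\alpha]}:=\frac{d}{d\varepsilon}(I+\varepsilon A)^{(\alpha)}|_{\varepsilon=0}$. For integer $\alpha=k$ (i.e. $s=0$), $A^{[\alpha]}$ is the standard $A^{[k]}$. **Matrix measure.** For a vector norm with induced matrix norm $\|\cdot\|$, $\mu(A):=\lim_{\varepsilon\downarrow0}\frac{\|I+\varepsilon A\|-1}{\varepsilon}$ (applied to square matrices of any size, using the $L_p$ norm of the corresponding dimension). $\dim_H K$ is the Hausdorff dimension of $K$. *)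

(* Defs.v *)
From HB Require Import structures.
From mathcomp Require Import all_boot all_order all_algebra.
From mathcomp Require Import all_classical all_reals all_analysis.
From mathcomp Require Import complex mxtens.

Set Implicit Arguments.
Unset Strict Implicit.
Unset Printing Implicit Defensive.

Import Order.TTheory GRing.Theory Num.Theory.
Import numFieldNormedType.Exports.

Local Open Scope classical_set_scope.
Local Open Scope ring_scope.
Local Open Scope complex_scope.

Definition lexk_seq (n k : nat) : seq (k.-tuple 'I_n) :=
  sort (fun s t => ((s : k.-tuplelexi 'I_n) <= (t : k.-tuplelexi 'I_n))%O)
    (enum [set t : k.-tuple 'I_n | sorted ltn [seq val i | i <- t]]%SET).

Lemma size_lexk_seq n k : size (lexk_seq n k) == 'C(n, k).
Proof. by rewrite size_sort -cardE card_ltn_sorted_tuples. Qed.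

Definition lexk (n k : nat) : 'C(n, k).-tuple (k.-tuple 'I_n) :=
  Tuple (size_lexk_seq n k).

Definition mcompound (R : comNzRingType) (n k : nat) (A : 'M[R]_n) :
    'M[R]_('C(n, k)) :=
  \matrix_(i, j) \det (mxsub (tnth (tnth (lexk n k) i))
                             (tnth (tnth (lexk n k) j)) A).

Definition acompound (R : realType) (n k : nat) (A : 'M[R]_n) :
    'M[R]_('C(n, k)) :=
  \matrix_(i, j) derive1 (fun e : R => mcompound k (1%:M + e *: A) i j) 0.

(* The argument of z in ]-pi, pi] (for z != 0). *)
Definition carg (R : realType) (z : R[i]) : R :=
  let: a +i* b := z in
  let t := acos (a / Num.sqrt (a ^+ 2 + b ^+ 2)) in
  if 0 <= b then t else - t.

Definition cpow (R : realType) (z : R[i]) (beta : R) : R[i] :=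
  let: a +i* b := z in
  let rho := Num.sqrt (a ^+ 2 + b ^+ 2) `^ beta in
  (rho * cos (beta * carg z)) +i* (rho * sin (beta * carg z)).

Definition gbinom (R : realType) (beta : R) (l : nat) : R :=
  (\prod_(q < l) (beta - q%:R)) / l`!%:R.

Definition jordan_block (R : realType) (m : nat) (lam : R[i]) : 'M[R[i]]_m :=
  \matrix_(i, j) (lam *+ (i == j) + (i.+1 == j :> nat)%:R).

(* The entry on the l-th superdiagonal is h^(l)(lam) / l! for h(z) = z^beta. *)
Definition jordan_block_pow (R : realType) (m : nat) (lam : R[i]) (beta : R) :
    'M[R[i]]_m :=
  \matrix_(i, j) if (i <= j)%N then
    (gbinom beta (j - i))%:C * cpow lam (beta - (j - i)%:R) else 0.

(* B = P J P^-1 and C = P J^beta P^-1, with J = diag(J_1, ..., J_m) in Jordan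
   form. The size of J is \sum_i d i, which is only provably equal to N, so P
   is formally rectangular and Q stands for P^-1. *)
Definition is_mxpow (R : realType) (N : nat) (B : 'M[R[i]]_N) (beta : R)
    (C : 'M[R[i]]_N) : Prop :=
  exists (m : nat) (d : 'I_m -> nat) (lam : 'I_m -> R[i])
    (P : 'M[R[i]]_(N, \sum_i d i)) (Q : 'M[R[i]]_(\sum_i d i, N)),
  [/\ P *m Q = 1%:M, Q *m P = 1%:M,
      B = P *m (\mxdiag_(i < m) jordan_block (d i) (lam i)) *m Q &
      C = P *m (\mxdiag_(i < m) jordan_block_pow (d i) (lam i) beta) *m Q].

Definition mxpow (R : realType) (N : nat) (B : 'M[R[i]]_N) (beta : R) :
    'M[R[i]]_N :=
  xget 0 [set C | is_mxpow B beta C].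

Definition alpha_mcompound (R : realType) (n k : nat) (s : R) (B : 'M[R]_n) :
    'M[R[i]]_('C(n, k) * 'C(n, k.+1)) :=
  tensmx (mxpow (map_mx (real_complex R) (mcompound k B)) (1 - s))
         (mxpow (map_mx (real_complex R) (mcompound k.+1 B)) s).

Definition alpha_dim (n k : nat) (is_int : bool) : nat :=
  if is_int then 'C(n, k) else ('C(n, k) * 'C(n, k.+1))%N.

(* Here alpha = k + s. Principal powers of a real matrix are complex in general,
   but for e close to 0 those of the compounds of 1 + e A are real: taking real
   parts loses nothing in the derivative at 0. *)
Definition alpha_acompound (R : realType) (n k : nat) (s : R) (A : 'M[R]_n) :
    'M[R]_(alpha_dim n k (s == 0)) :=
  if s == 0 as b return 'M[R]_(alpha_dim n k b) then acompound k A
  else \matrix_(i, j) derive1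
    (fun e : R => complex.Re (alpha_mcompound k s (1%:M + e *: A) i j)) 0.

Definition lp_norm (R : realType) (I : finType) (p : \bar R) (u : I -> R) : R :=
  match p with
  | r%:E => (\sum_i `|u i| `^ r) `^ r^-1
  | +oo%E => \big[Num.max/0]_i `|u i|
  | -oo%E => 0
  end.

Definition lp_mxnorm (R : realType) (N : nat) (p : \bar R) (A : 'M[R]_N) : R :=
  sup [set lp_norm p (fun i => (A *m v) i 0) / lp_norm p (fun i => v i 0)
      | v in [set v : 'cV[R]_N | v != 0]].

Definition lp_measure (R : realType) (N : nat) (p : \bar R) (A : 'M[R]_N) : R :=
  lim ((lp_mxnorm p (1%:M + e *: A) - 1) / e @[e --> (0 : R)^'+]).

Definition diam (R : realType) (n : nat) (A : set 'rV[R]_n) : \bar R :=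
  ereal_sup [set (lp_norm 2%:E (fun i => (x - y) 0 i))%:E | x in A & y in A].

(* x `^ 0 = 1 for all x, but the empty set must contribute 0 even for d = 0. *)
Definition diam_pow (R : realType) (n : nat) (d : R) (A : set 'rV[R]_n) :
    \bar R :=
  if A == set0 then 0%E else (diam A `^ d)%E.

Definition hausdorff_premeasure (R : realType) (n : nat) (d delta : R)
    (A : set 'rV[R]_n) : \bar R :=
  ereal_inf [set (\sum_(0 <= i <oo) diam_pow d (U i))%E
            | U in [set U : nat -> set 'rV[R]_n |
                A `<=` \bigcup_i U i /\ forall i, (diam (U i) <= delta%:E)%E]].

Definition hausdorff_measure (R : realType) (n : nat) (d : R)
    (A : set 'rV[R]_n) : \bar R :=
  ereal_sup [set hausdorff_premeasure d delta A
            | delta in [set delta : R | 0 < delta]].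

Definition hausdorff_dim (R : realType) (n : nat) (A : set 'rV[R]_n) : \bar R :=
  ereal_inf [set d%:E
            | d in [set d : R | 0 <= d /\ hausdorff_measure d A = 0%E]].

(* In finite dimension, continuity of z |-> 'd g z v for every v is continuity
   of the derivative. *)
Definition C1_on (R : realType) (V W : normedModType R) (U : set V)
    (g : V -> W) : Prop :=
  [/\ open U, forall z, U z -> differentiable g z &
      forall v z, U z -> {for z, continuous (fun y => 'd g y v)}].

Definition is_solution (R : realType) (n : nat)
    (f : R -> 'rV[R]_n -> 'rV[R]_n) (x0 : 'rV[R]_n) (y : R -> 'rV[R]_n) : Prop :=
  [/\ y 0 = x0, {within `[0, +oo[, continuous y} &
      forall t : R, 0 < t -> is_derive t 1 y (f t (y t))].

Definition invariant_set (R : realType) (n : nat)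
    (x : R -> 'rV[R]_n -> 'rV[R]_n) (D : set 'rV[R]_n) : Prop :=
  forall t x0, 0 <= t -> D x0 -> D (x t x0).

Definition strongly_invariant (R : realType) (n : nat)
    (x : R -> 'rV[R]_n -> 'rV[R]_n) (K : set 'rV[R]_n) : Prop :=
  forall t, 0 <= t -> K = x t @` K.

(* The library's 'J acts on row vectors; its transpose has entries
   (d f_i / d x_j). *)
Definition state_jacobian (R : realType) (n : nat)
    (f : R -> 'rV[R]_n -> 'rV[R]_n) (t : R) (z : 'rV[R]_n) : 'M[R]_n :=
  (jacobian (f t) z)^T.

Definition scaling_derivative (R : realType) (n : nat)
    (f : R -> 'rV[R]_n -> 'rV[R]_n) (Theta : 'rV[R]_n -> 'M[R]_n)
    (t : R) (z : 'rV[R]_n) : 'M[R]_n :=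
  \matrix_(i, j) \sum_(l < n)
    'D_(delta_mx 0 l) (fun y => Theta y i j) z * f t z 0 l.

Definition generalized_jacobian (R : realType) (n : nat)
    (f : R -> 'rV[R]_n -> 'rV[R]_n) (Theta : 'rV[R]_n -> 'M[R]_n)
    (t : R) (z : 'rV[R]_n) : 'M[R]_n :=
  scaling_derivative f Theta t z *m invmx (Theta z)
  + Theta z *m state_jacobian f t z *m invmx (Theta z).

(* The supremum is a maximum when K is compact and nonempty. *)
Definition contraction_rate (R : realType) (n k : nat) (s : R) (p : \bar R)
    (J : R -> 'rV[R]_n -> 'M[R]_n) (x : R -> 'rV[R]_n -> 'rV[R]_n)
    (K : set 'rV[R]_n) (tau : R) : \bar R :=
  ereal_sup [set (\int[lebesgue_measure]_(t in `[0, tau])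
                    lp_measure p (alpha_acompound k s (J t (x t x0))))%:E
            | x0 in K].

(* Main.v *)
(* Only the time-tau map phi of the flow is iterated. Near a point x of K, and on
   K, it is approximated by a matrix W, a product of many factors I + h J along
   the trajectory of x; conjugation by Theta turns these into I + h Jbar + o(h).
   Since A^[alpha] = (1-s) A^[k] (x) I + s I (x) A^[k+1] has measure at least
   (1-s) mu(A^[k]) + s mu(A^[k+1]), multiplicativity of the compounds bounds
   |M^(k)|^(1-s) |M^(k+1)|^s by exp(int mu(Jbar^[alpha])) < exp(-eta) for
   M = Theta(phi x) W Theta(x)^-1. For an iterate of phi this quantity is as
   small as desired, even without Theta, which is bounded on the compact K.
   As in the theorem of Douady and Oesterle, phi^m then maps the part of K in a
   small ball of radius r into N balls of radius theta r with
   N theta^alpha <= 1/2. As finitely many pairs (N, theta) serve for all of K,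
   this persists with 3/4 for some exponent d < alpha, and iterating the
   coverings gives H^d(K) = 0. *)
Require Import Defs.
From mathcomp Require Import all_boot all_order all_algebra.
From mathcomp Require Import fingroup perm.
From mathcomp Require Import all_classical all_reals all_analysis.
From mathcomp Require Import complex mxtens.
From mathcomp Require Import zify ring lra.
Set Implicit Arguments.
Unset Strict Implicit.
Unset Printing Implicit Defensive.
Import Order.TTheory GRing.Theory Num.Theory.
Import numFieldNormedType.Exports.
Local Open Scope classical_set_scope.
Local Open Scope ring_scope.

(** * Norms and matrix measures *)

(** The flow is only specified on [D], which may have empty interior, so the time-tau map need not
    have a derivative on [K]. Every linear approximation therefore compares two points of [K], and
    its matrix depends on the accuracy [eps] asked for. The bound on its entries must not: the
    accuracy needed for a good covering is determined by that bound. The threshold [kappa] below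
    which the compounds yield a covering depends on [n], [k] and [s] alone. Hence the number of
    iterates can be chosen from [kappa], before anything is known about the size of the entries.
    Since iteration absorbs constants, norms are exchanged freely: pivots replace singular values,
    and balls are those of the largest-entry norm. A second obstacle is that [mxpow] picks an
    unspecified Jordan form, so no formula can be differentiated. Near the identity every power in
    the sense of [is_mxpow] is shown to be the sum of the binomial series, which removes the choice
    and gives the derivative. *)

Lemma exponent_ind (R : realType) (P : \bar R -> Prop) :
  (forall r : R, 1 <= r -> P r%:E) -> P +oo%E ->
  forall p, (1 <= p)%E -> P p.
Proof. by move=> Pr Py [r| |] // p1; apply: Pr; rewrite -lee_fin. Qed.

Section LpNorm.
Variables (R : realType) (I : finType).
Implicit Types (p : \bar R) (u v : I -> R).

Let sum_powR_ge0 (r : R) u : 0 <= \sum_i `|u i| `^ r.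
Proof. by apply: sumr_ge0 => i _; exact: powR_ge0. Qed.

Lemma lp_norm_ge0 p u : 0 <= lp_norm p u.
Proof.
case: p => [r| |] /=; [exact: powR_ge0 | exact: bigmax_ge_id | exact: lexx].
Qed.

Lemma lp_normZ p (c : R) u : (1 <= p)%E ->
  lp_norm p (fun i => c * u i) = `|c| * lp_norm p u.
Proof.
move: p; apply: exponent_ind => [r r1|] /=.
- have r0 : 0 < r by exact: lt_le_trans r1.
  under eq_bigr do rewrite normrM powRM//.
  rewrite -mulr_sumr powRM ?powR_ge0//.
  by rewrite -powRrM divff ?gt_eqF// powRr1.
- under eq_bigr do rewrite normrM.
  apply/le_anti/andP; split.
    apply/bigmax_leP; split => [|i _]; first by rewrite mulr_ge0// bigmax_ge_id.
    by rewrite ler_wpM2l// le_bigmax.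
  have [->|c0] := eqVneq c 0; first by rewrite normr0 mul0r bigmax_ge_id.
  rewrite -ler_pdivlMl ?normr_gt0//; apply/bigmax_leP; split => [|i _].
    by rewrite mulr_ge0 ?invr_ge0// bigmax_ge_id.
  rewrite ler_pdivlMl ?normr_gt0//.
  exact: (le_bigmax _ (fun i => `|c| * `|u i|)).
Qed.

Lemma ler_lp_norm p u v : (1 <= p)%E -> (forall i, `|u i| <= `|v i|) ->
  lp_norm p u <= lp_norm p v.
Proof.
move=> p1 uv; move: p p1; apply: exponent_ind => [r r1|] /=.
- have r0 : 0 <= r by exact: le_trans r1.
  rewrite ge0_ler_powR ?invr_ge0// ?nnegrE//.
  by apply: ler_sum => i _; rewrite ge0_ler_powR// nnegrE.
- exact: le_bigmax2.
Qed.

Lemma eq_lp_norm p u v : u =1 v -> lp_norm p u = lp_norm p v.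
Proof. by move=> uv; congr lp_norm; apply/funext. Qed.

Lemma lp_norm_coord p u i : (1 <= p)%E -> `|u i| <= lp_norm p u.
Proof.
move: p; apply: exponent_ind => [r r1|] /=.
- have r0 : 0 < r by exact: lt_le_trans r1.
  rewrite -[leLHS]powRr1// -(divff (lt0r_neq0 r0)) powRrM.
  rewrite ge0_ler_powR ?invr_ge0 ?(ltW r0)// ?nnegrE ?powR_ge0//.
  by rewrite (bigD1 i)//= lerDl sumr_ge0// => ? _; exact: powR_ge0.
- exact: (le_bigmax _ (fun i => `|u i|)).
Qed.

Let lp_norm_le1 (r : R) u : 1 <= r ->
  lp_norm r%:E u <= 1 <-> \sum_i `|u i| `^ r <= 1.
Proof.
move=> r1 /=; have r0 : 0 < r by exact: lt_le_trans r1.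
split=> h.
  have := ge0_ler_powR (ltW r0) _ _ h.
  rewrite !nnegrE powR_ge0 ler01 => /(_ isT isT).
  by rewrite -powRrM mulVf ?gt_eqF// powRr1// powR1.
have ri : 0 <= r^-1 by rewrite invr_ge0 ltW.
have := ge0_ler_powR ri _ _ h; rewrite !nnegrE ler01 sum_powR_ge0.
by move=> /(_ isT isT); rewrite powR1.
Qed.

(** The unit ball is convex because the power function of exponent [r] is. Minkowski's inequality
    follows by homogeneity. *)
Let lp_norm_convex p u v (t : R) : (1 <= p)%E -> 0 <= t -> t <= 1 ->
  lp_norm p u <= 1 -> lp_norm p v <= 1 ->
  lp_norm p (fun i => t * u i + (1 - t) * v i) <= 1.
Proof.
move=> p1 t0 t1; have t1' : 0 <= 1 - t by rewrite subr_ge0.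
move: p p1; apply: exponent_ind => [r r1|].
- move=> /(lp_norm_le1 _ r1) u1 /(lp_norm_le1 _ r1) v1.
  apply/(lp_norm_le1 _ r1).
  rewrite [leRHS](_ : 1 = t * 1 + (1 - t) * 1); last by ring.
  apply: (@le_trans _ _ (t * (\sum_i `|u i| `^ r)
                          + (1 - t) * (\sum_i `|v i| `^ r))); last first.
    by apply: lerD; apply: ler_wpM2l.
  rewrite !mulr_sumr -big_split; apply: ler_sum => i _ /=.
  have tI : Itv.spec (@Itv.num_sem R) (Itv.Real `[0%Z, 1%Z]) t.
    by rewrite /= /Itv.num_sem /= in_itv/= t0 t1 num_real.
  have := @convex_powR R r r1 (Itv.mk tI) `|u i| `|v i|.
  rewrite !inE/= !in_itv/= !andbT => /(_ (normr_ge0 _) (normr_ge0 _)).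
  rewrite !convRE /=.
  apply: le_trans; apply: ge0_ler_powR; rewrite ?nnegrE.
  + exact: le_trans r1.
  + exact: normr_ge0.
  + by rewrite addr_ge0 ?mulr_ge0// onem_ge0.
  + rewrite (le_trans (ler_normD _ _))// !normrM (ger0_norm t0).
    by rewrite (ger0_norm t1').
- move=> /= /bigmax_leP[_ u1] /bigmax_leP[_ v1].
  apply/bigmax_leP; split => [|i _]; first exact: ler01.
  rewrite (le_trans (ler_normD _ _))// !normrM (ger0_norm t0) (ger0_norm t1').
  rewrite [leRHS](_ : 1 = t * 1 + (1 - t) * 1); last by ring.
  by apply: lerD; apply: ler_wpM2l => //; [exact: u1 | exact: v1].
Qed.

Lemma lp_norm_eq0 p u : (1 <= p)%E -> lp_norm p u = 0 -> forall i, u i = 0.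
Proof.
by move=> p1 u0 i; apply/eqP; rewrite -normr_le0 -u0 lp_norm_coord.
Qed.

Lemma lp_normD p u v : (1 <= p)%E ->
  lp_norm p (fun i => u i + v i) <= lp_norm p u + lp_norm p v.
Proof.
move=> p1; set a := lp_norm p u; set b := lp_norm p v.
have a0 : 0 <= a := lp_norm_ge0 p u; have b0 : 0 <= b := lp_norm_ge0 p v.
have [az|an] := eqVneq a 0.
  rewrite az add0r ler_lp_norm// => i.
  by rewrite (lp_norm_eq0 p1 az) add0r.
have [bz|bn] := eqVneq b 0.
  rewrite bz addr0 ler_lp_norm// => i.
  by rewrite (lp_norm_eq0 p1 bz) addr0.
have ap : 0 < a by rewrite lt0r an.
have bp : 0 < b by rewrite lt0r bn.
have ab : 0 < a + b by rewrite addr_gt0.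
(* Divided by [a + b], the sum is the convex combination of the unit vectors [u / a] and [v / b]
   with weight [a / (a + b)]. *)
have := @lp_norm_convex p (fun i => a^-1 * u i) (fun i => b^-1 * v i) (a / (a + b)) p1.
rewrite !lp_normZ// -/a -/b !ger0_norm ?invr_ge0// !mulVf//.
rewrite divr_ge0 ?(ltW ab)// ler_pdivrMr// mul1r lerDl b0 lexx.
move=> /(_ isT isT isT isT) h.
rewrite -[leRHS]mulr1 -ler_pdivrMl//.
have := @lp_normZ p (a + b)^-1 (fun i => u i + v i) p1.
rewrite ger0_norm ?invr_ge0 ?(ltW ab)// => <-.
apply: le_trans h; rewrite le_eqVlt; apply/orP; left; apply/eqP/eq_lp_norm => i.
by field; rewrite !gt_eqF.
Qed.

Lemma lp_norm0 p : (1 <= p)%E -> lp_norm p (fun _ : I => 0) = 0.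
Proof.
move=> p1; rewrite (@eq_lp_norm p _ (fun=> 0 * 0)) => [|i]; last by rewrite mul0r.
by rewrite lp_normZ// normr0 mul0r.
Qed.

Lemma lp_norm_sum p (J : finType) (F : J -> I -> R) : (1 <= p)%E ->
  lp_norm p (fun i => \sum_j F j i) <= \sum_j lp_norm p (F j).
Proof.
move=> p1; rewrite /index_enum; elim: (Finite.enum _) => [|j l ih].
  rewrite (@eq_lp_norm p _ (fun=> 0)) ?lp_norm0 ?big_nil// => i.
  by rewrite big_nil.
rewrite (@eq_lp_norm p _ (fun i => F j i + \sum_(j <- l) F j i)); last first.
  by move=> i; rewrite big_cons.
by rewrite big_cons (le_trans (lp_normD _ _ p1))// lerD2l.
Qed.

Lemma lp_norm_delta p (j : I) : (1 <= p)%E ->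
  lp_norm p (fun i => (i == j)%:R : R) = 1.
Proof.
move: p; apply: exponent_ind => [r r1|] /=.
- have r0 : 0 < r by exact: lt_le_trans r1.
  rewrite (bigD1 j)//= eqxx normr1 powR1 big1 ?addr0 ?powR1// => i /negPf ->.
  by rewrite normr0 powR0// gt_eqF.
- apply/le_anti/andP; split.
    apply/bigmax_leP; split => [|i _]; first exact: ler01.
    by case: (i == j); rewrite ?normr1 ?normr0.
  by have := le_bigmax 0 (fun i => `|(i == j)%:R : R|) j; rewrite eqxx normr1.
Qed.

Lemma lp_norm_le_sum p u : (1 <= p)%E -> lp_norm p u <= \sum_i `|u i|.
Proof.
move=> p1; apply: (@le_trans _ _ (\sum_j lp_norm p (fun i => u j * (i == j)%:R))).
  rewrite (le_trans _ (lp_norm_sum _ p1))// ler_lp_norm// => i.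
  rewrite (bigD1 i)//= eqxx mulr1 big1 ?addr0// => j ji.
  by rewrite eq_sym (negPf ji) mulr0.
by apply: ler_sum => i _; rewrite lp_normZ// lp_norm_delta// mulr1.
Qed.

End LpNorm.

(** The property that links L_p norms of different dimensions, not shared by arbitrary families of
    norms. The bound on the measure of a Kronecker sum rests on it. *)
Lemma lp_norm_tens (R : realType) (p : \bar R) m n (u : 'I_m -> R) (v : 'I_n -> R) :
  (1 <= p)%E ->
  lp_norm p (fun i => u (mxtens_unindex i).1 * v (mxtens_unindex i).2)
    = lp_norm p u * lp_norm p v.
Proof.
move: p; apply: exponent_ind => [r r1|] /=.
- have r0 : 0 < r by exact: lt_le_trans r1.
  under eq_bigr do rewrite normrM powRM//.
  rewrite -(mulr_sum (fun i => `|u i| `^ r) (fun i => `|v i| `^ r)).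
  by rewrite powRM// sumr_ge0// => i _; exact: powR_ge0.
- apply/le_anti/andP; split.
    apply/bigmax_leP; split => [|i _]; first by rewrite mulr_ge0// bigmax_ge_id.
    rewrite normrM ler_pM//; first exact: (le_bigmax _ (fun i => `|u i|)).
    exact: (le_bigmax _ (fun i => `|v i|)).
  have [v0|v0] := eqVneq (\big[Order.max/0]_i `|v i|) 0.
    by rewrite v0 mulr0 bigmax_ge_id.
  have vp : 0 < \big[Order.max/0]_i `|v i| by rewrite lt0r v0 bigmax_ge_id.
  rewrite -ler_pdivlMr//; apply/bigmax_leP; split => [|i _].
    by rewrite divr_ge0// bigmax_ge_id.
  rewrite ler_pdivlMr//; have [->|u0] := eqVneq `|u i| 0.
    by rewrite mul0r bigmax_ge_id.
  have up : 0 < `|u i| by rewrite lt0r u0/=.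
  rewrite -ler_pdivlMl//; apply/bigmax_leP; split => [|j _].
    by rewrite mulr_ge0 ?invr_ge0// bigmax_ge_id.
  rewrite ler_pdivlMl// -normrM.
  have := le_bigmax 0 (fun i => `|u (mxtens_unindex i).1 * v (mxtens_unindex i).2|)
    (mxtens_index (i, j)).
  by rewrite mxtens_indexK.
Qed.

(** A submultiplicative norm for matrices of any shape, over real and complex numbers alike; it
    replaces the other norms wherever constants do not matter. *)
Definition mnorm (R : numDomainType) m n (A : 'M[R]_(m, n)) : R :=
  \sum_i \sum_j `|A i j|.

Section MNorm.
Variable R : numDomainType.

Lemma mnorm_ge0 m n (A : 'M[R]_(m, n)) : 0 <= mnorm A.
Proof. by apply: sumr_ge0 => i _; apply: sumr_ge0. Qed.

Lemma mnorm_coord m n (A : 'M[R]_(m, n)) i j : `|A i j| <= mnorm A.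
Proof.
rewrite /mnorm (bigD1 i)//= (bigD1 j)//= -addrA lerDl addr_ge0 ?sumr_ge0//.
by move=> k _; apply: sumr_ge0.
Qed.

Lemma mnorm_le_card m n (A : 'M[R]_(m, n)) (c : R) :
  (forall i j, `|A i j| <= c) -> mnorm A <= (m * n)%:R * c.
Proof.
move=> Ac; apply: (@le_trans _ _ (\sum_(i < m) \sum_(j < n) c)).
  by apply: ler_sum => i _; apply: ler_sum => j _.
by rewrite !sumr_const !card_ord -mulrnA mulnC mulr_natl.
Qed.

Lemma mnormD m n (A B : 'M[R]_(m, n)) : mnorm (A + B) <= mnorm A + mnorm B.
Proof.
rewrite -big_split; apply: ler_sum => i _ /=.
by rewrite -big_split; apply: ler_sum => j _ /=; rewrite mxE ler_normD.
Qed.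

Lemma mnormZ m n (c : R) (A : 'M[R]_(m, n)) : mnorm (c *: A) = `|c| * mnorm A.
Proof.
rewrite mulr_sumr; apply: eq_bigr => i _.
by rewrite mulr_sumr; apply: eq_bigr => j _; rewrite mxE normrM.
Qed.

Lemma mnormN m n (A : 'M[R]_(m, n)) : mnorm (- A) = mnorm A.
Proof. by rewrite -scaleN1r mnormZ normrN normr1 mul1r. Qed.

Lemma mnorm_tr m n (A : 'M[R]_(m, n)) : mnorm A^T = mnorm A.
Proof.
rewrite /mnorm exchange_big /=; apply: eq_bigr => i _; apply: eq_bigr => j _.
by rewrite mxE.
Qed.

Lemma mnormM m n q (A : 'M[R]_(m, n)) (B : 'M[R]_(n, q)) :
  mnorm (A *m B) <= mnorm A * mnorm B.
Proof.
rewrite /mnorm mulr_suml; apply: ler_sum => i _.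
apply: (@le_trans _ _ (\sum_j \sum_k `|A i k| * `|B k j|)).
  apply: ler_sum => j _; rewrite mxE (le_trans (ler_norm_sum _ _ _))//.
  by apply: ler_sum => k _; rewrite normrM.
rewrite exchange_big mulr_suml; apply: ler_sum => k _ /=.
rewrite -mulr_sumr ler_wpM2l// (bigD1 k)//= lerDl sumr_ge0// => l _.
exact: sumr_ge0.
Qed.

End MNorm.

Section LpMxnorm.
Variables (R : realType) (p : \bar R).
Hypothesis p1 : (1 <= p)%E.

Local Notation cnorm v := (lp_norm p (fun i => v i 0)).

Let cnorm_gt0 N (v : 'cV[R]_N) : v != 0 -> 0 < cnorm v.
Proof.
move=> v0; rewrite lt0r lp_norm_ge0 andbT; apply: contra v0 => /eqP v0.
apply/eqP/matrixP => i j; rewrite ord1 mxE; exact: (lp_norm_eq0 p1 v0).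
Qed.

Let cnorm0 N : cnorm (0 : 'cV[R]_N) = 0.
Proof.
by rewrite -[RHS](@lp_norm0 R 'I_N p p1); apply: eq_lp_norm => i; rewrite mxE.
Qed.

Lemma lp_norm_mulmx_mnorm m N (A : 'M[R]_(m, N)) (v : 'cV[R]_N) :
  cnorm (A *m v) <= mnorm A * cnorm v.
Proof.
rewrite (le_trans (lp_norm_le_sum _ p1))// mulr_suml; apply: ler_sum => i _.
rewrite mxE (le_trans (ler_norm_sum _ _ _))// mulr_suml; apply: ler_sum => j _.
by rewrite normrM ler_wpM2l// (lp_norm_coord (fun i => v i 0)).
Qed.

Lemma lp_norm_mulmx N (A : 'M[R]_N) (v : 'cV[R]_N) :
  cnorm (A *m v) <= lp_mxnorm p A * cnorm v.
Proof.
have [->|v0] := eqVneq v 0; first by rewrite mulmx0 cnorm0 mulr0.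
rewrite -ler_pdivrMr ?cnorm_gt0//; apply: ub_le_sup; last by exists v.
exists (mnorm A) => _ [u /= u0 <-].
by rewrite ler_pdivrMr ?cnorm_gt0// lp_norm_mulmx_mnorm.
Qed.

Lemma lp_mxnorm_le N (A : 'M[R]_N) (c : R) : 0 <= c ->
  (forall v : 'cV[R]_N, cnorm (A *m v) <= c * cnorm v) -> lp_mxnorm p A <= c.
Proof.
move=> c0 Ac; rewrite /lp_mxnorm.
(* In dimension 0 there is no nonzero vector, and [sup] of the empty set is 0. *)
set S := [set _ | _ in _]; have [->|/set0P S0] := eqVneq S set0.
  by rewrite sup0.
by apply: ge_sup => // _ [u /= u0 <-]; rewrite ler_pdivrMr ?cnorm_gt0// Ac.
Qed.

Lemma lp_mxnorm_ge0 N (A : 'M[R]_N) : 0 <= lp_mxnorm p A.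
Proof.
rewrite /lp_mxnorm; set S := [set _ | _ in _].
have [->|/set0P [_ [v /= v0 _]]] := eqVneq S set0; first by rewrite sup0.
rewrite -(pmulr_lge0 _ (cnorm_gt0 v0)).
by rewrite (le_trans _ (lp_norm_mulmx _ _))// lp_norm_ge0.
Qed.

Lemma lp_mxnorm_mnorm N (A : 'M[R]_N) : lp_mxnorm p A <= mnorm A.
Proof. by apply: lp_mxnorm_le (mnorm_ge0 _) _ => v; exact: lp_norm_mulmx_mnorm. Qed.

Lemma lp_mxnormD N (A B : 'M[R]_N) :
  lp_mxnorm p (A + B) <= lp_mxnorm p A + lp_mxnorm p B.
Proof.
apply: lp_mxnorm_le => [|v]; first by rewrite addr_ge0// lp_mxnorm_ge0.
rewrite mulmxDl mulrDl (le_trans _ (lerD (lp_norm_mulmx _ _) (lp_norm_mulmx _ _)))//.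
rewrite (le_trans _ (lp_normD _ _ p1))// (@eq_lp_norm _ _ p _ (fun i => (A *m v) i 0 + (B *m v) i 0))//.
by move=> i; rewrite mxE.
Qed.

Lemma lp_mxnormM N (A B : 'M[R]_N) :
  lp_mxnorm p (A *m B) <= lp_mxnorm p A * lp_mxnorm p B.
Proof.
apply: lp_mxnorm_le => [|v]; first by rewrite mulr_ge0// lp_mxnorm_ge0.
rewrite -mulmxA -mulrA (le_trans (lp_norm_mulmx _ _))// ler_wpM2l ?lp_mxnorm_ge0//.
exact: lp_norm_mulmx.
Qed.

Lemma lp_mxnormZ_le N (c : R) (A : 'M[R]_N) :
  lp_mxnorm p (c *: A) <= `|c| * lp_mxnorm p A.
Proof.
apply: lp_mxnorm_le => [|v]; first by rewrite mulr_ge0// lp_mxnorm_ge0.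
rewrite -scalemxAl (@eq_lp_norm _ _ p _ (fun i => c * (A *m v) i 0)).
  by rewrite lp_normZ// -mulrA ler_wpM2l// lp_norm_mulmx.
by move=> i; rewrite mxE.
Qed.

Lemma lp_mxnormN N (A : 'M[R]_N) : lp_mxnorm p (- A) = lp_mxnorm p A.
Proof.
have h B : lp_mxnorm p (- B : 'M[R]_N) <= lp_mxnorm p B.
  by rewrite -scaleN1r (le_trans (lp_mxnormZ_le _ _))// normrN normr1 mul1r.
by apply/le_anti; rewrite h -{1}[A]opprK h.
Qed.

Lemma lp_mxnorm_coord N (A : 'M[R]_N) i j : `|A i j| <= lp_mxnorm p A.
Proof.
have := lp_norm_mulmx A (delta_mx j 0).
rewrite (@eq_lp_norm _ _ p (fun i => delta_mx j 0 i 0) (fun i => (i == j)%:R)).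
  rewrite lp_norm_delta// mulr1; apply: le_trans.
  rewrite (le_trans _ (lp_norm_coord _ i p1))//.
  by rewrite -colE mxE.
by move=> k; rewrite mxE eqxx andbT.
Qed.

Lemma lp_mxnorm1 N : (0 < N)%N -> lp_mxnorm p (1%:M : 'M[R]_N) = 1.
Proof.
move=> N0; apply/le_anti/andP; split.
  by apply: lp_mxnorm_le => // v; rewrite mul1mx mul1r.
have := lp_mxnorm_coord (1%:M : 'M[R]_N) (Ordinal N0) (Ordinal N0).
by rewrite mxE eqxx normr1.
Qed.

(** Testing on elementary tensors suffices; the supremum is taken over one factor at a time, whence
    the divisions. *)
Lemma lp_mxnorm_tens m n (A : 'M[R]_m) (B : 'M[R]_n) :
  lp_mxnorm p A * lp_mxnorm p B <= lp_mxnorm p (tensmx A B).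
Proof.
have h (u : 'cV[R]_m) (v : 'cV[R]_n) : cnorm (A *m u) * cnorm (B *m v) <=
    lp_mxnorm p (tensmx A B) * (cnorm u * cnorm v).
  pose w : 'cV[R]_(m * n) :=
    \col_i (u (mxtens_unindex i).1 0 * v (mxtens_unindex i).2 0).
  have := lp_norm_mulmx (tensmx A B) w.
  rewrite (@eq_lp_norm _ _ p (fun i => w i 0)
     (fun i => u (mxtens_unindex i).1 0 * v (mxtens_unindex i).2 0)); last first.
    by move=> i; rewrite mxE.
  rewrite (lp_norm_tens (fun i => u i 0) (fun i => v i 0))//; apply: le_trans.
  rewrite -(lp_norm_tens (fun i => (A *m u) i 0) (fun i => (B *m v) i 0))//.
  apply: ler_lp_norm => // i; rewrite !mxE.
  rewrite (mulr_sum (fun j => A (mxtens_unindex i).1 j * u j 0)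
    (fun j => B (mxtens_unindex i).2 j * v j 0)) le_eqVlt; apply/orP; left.
  by apply/eqP; congr `| _ |; apply: eq_bigr => j _; rewrite !mxE; ring.
have [B0|B0] := eqVneq (lp_mxnorm p B) 0.
  by rewrite B0 mulr0 lp_mxnorm_ge0.
have Bp : 0 < lp_mxnorm p B by rewrite lt0r B0 lp_mxnorm_ge0.
rewrite -ler_pdivlMr//; apply: lp_mxnorm_le => [|u].
  by rewrite divr_ge0// lp_mxnorm_ge0.
rewrite mulrAC ler_pdivlMr// mulrC.
have [Au0|Au0] := eqVneq (cnorm (A *m u)) 0.
  by rewrite Au0 mulr0 mulr_ge0 ?lp_mxnorm_ge0 ?lp_norm_ge0.
have Au : 0 < cnorm (A *m u) by rewrite lt0r Au0 lp_norm_ge0.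
rewrite -ler_pdivlMr//; apply: lp_mxnorm_le => [|v].
  by rewrite divr_ge0 ?mulr_ge0 ?lp_mxnorm_ge0 ?lp_norm_ge0.
by rewrite mulrAC ler_pdivlMr// mulrC -mulrA.
Qed.

End LpMxnorm.

Section LpMeasure.
Variables (R : realType) (p : \bar R).
Hypothesis p1 : (1 <= p)%E.

Let quot N (A : 'M[R]_N) (h : R) := (lp_mxnorm p (1%:M + h *: A) - 1) / h.

(** Convexity of the norm: [1 + h A] lies on the segment from [1] to [1 + h' A]. So the limit that
    defines the measure is an infimum. *)
Let quot_homo N (A : 'M[R]_N) (h h' : R) : (0 < N)%N -> 0 < h -> h <= h' ->
  quot A h <= quot A h'.
Proof.
move=> N0 h0 hh'; have h'0 : 0 < h' := lt_le_trans h0 hh'.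
rewrite /quot ler_pdivrMr// -lerBDr opprK.
pose t := h / h'; have t0 : 0 <= t by rewrite divr_ge0 ?ltW.
have t1 : 0 <= 1 - t by rewrite subr_ge0 /t ler_pdivrMr// mul1r.
have -> : 1%:M + h *: A = (1 - t) *: 1%:M + t *: (1%:M + h' *: A).
  rewrite scalerDr scalerA addrA -scalerDl subrK scale1r /t.
  by rewrite mulrAC -mulrA divff ?gt_eqF// mulr1.
rewrite (le_trans (lp_mxnormD p1 _ _))//.
rewrite (le_trans (lerD (lp_mxnormZ_le p1 _ _) (lp_mxnormZ_le p1 _ _)))//.
rewrite lp_mxnorm1// !ger0_norm// /t le_eqVlt; apply/orP; left; apply/eqP.
by field; rewrite gt_eqF.
Qed.

Let quot_ge N (A : 'M[R]_N) (h : R) : (0 < N)%N -> 0 < h ->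
  - lp_mxnorm p A <= quot A h.
Proof.
move=> N0 h0; rewrite /quot ler_pdivlMr// lerBrDr.
have := lp_mxnormD p1 (1%:M + h *: A) (- (h *: A)).
rewrite addrK lp_mxnorm1// lp_mxnormN//.
have := lp_mxnormZ_le p1 h A; rewrite (gtr0_norm h0).
by move=> *; lra.
Qed.

Lemma lp_measureE N (A : 'M[R]_N) : (0 < N)%N ->
  lp_measure p A = inf [set quot A h | h in [set h | 0 < h]].
Proof.
move=> N0; apply/cvg_lim => //.
have lb : has_inf [set quot A h | h in [set h | 0 < h]].
  split; first by exists (quot A 1), 1 => //=.
  by exists (- lp_mxnorm p A) => _ [h /= h0 <-]; exact: quot_ge.
apply/cvgrPdist_lt => e e0.
have [_ [h0 /= h00 <-] h0e] := inf_adherent e0 lb.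
near=> h.
have hp : 0 < h by near: h; exact: nbhs_right_gt.
rewrite ltr_norml -/(quot A h); apply/andP; split; last first.
  rewrite (@le_lt_trans _ _ 0)// subr_le0; apply: ge_inf; first exact: lb.2.
  by exists h.
have : quot A h < inf [set quot A h | h in [set h | 0 < h]] + e.
  apply: le_lt_trans h0e; apply: quot_homo => //.
  by near: h; exact: nbhs_right_le.
by move=> *; lra.
Unshelve. all: by end_near. Qed.

Lemma lp_measure_lower N (A : 'M[R]_N) (h : R) : (0 < N)%N -> 0 < h ->
  1 + h * lp_measure p A <= lp_mxnorm p (1%:M + h *: A).
Proof.
move=> N0 h0; rewrite -lerBrDl mulrC -ler_pdivlMr// lp_measureE//.
apply: ge_inf; last by exists h.
by exists (- lp_mxnorm p A) => _ [h' /= h0' <-]; exact: quot_ge.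
Qed.

Lemma lp_measure_upper N (A : 'M[R]_N) (e : R) : (0 < N)%N -> 0 < e ->
  exists2 h0 : R, 0 < h0 & forall h, 0 < h -> h <= h0 ->
    lp_mxnorm p (1%:M + h *: A) <= 1 + h * (lp_measure p A + e).
Proof.
move=> N0 e0; have [] := @inf_adherent _ [set quot A h | h in [set h | 0 < h]] _ e0.
  split; first by exists (quot A 1), 1 => //=.
  by exists (- lp_mxnorm p A) => _ [h /= h0 <-]; exact: quot_ge.
move=> _ [h0 /= h00 <-] h0e; exists h0 => // h hp hh0.
rewrite -lerBlDl mulrC -ler_pdivrMr// lp_measureE//.
exact: le_trans (quot_homo _ _ _ hh0) (ltW h0e).
Qed.

(** A first-order comparison is enough, since the quadratic term disappears for small [h]. *)
Lemma lp_measure_le N (A : 'M[R]_N) (c d h0 : R) : (0 < N)%N -> 0 < h0 ->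
  (forall h, 0 < h -> h <= h0 ->
    lp_mxnorm p (1%:M + h *: A) <= 1 + h * c + h ^+ 2 * d) ->
  lp_measure p A <= c.
Proof.
move=> N0 h00 H; apply/ler_addgt0Pr => e e0.
pose h := Num.min h0 (e / (`|d| + 1)).
have d0 : 0 < `|d| + 1 by rewrite ltr_wpDl.
have hp : 0 < h by rewrite lt_min h00 divr_gt0.
have := le_trans (lp_measure_lower A N0 hp) (H h hp _).
rewrite ge_min lexx => /(_ isT).
rewrite expr2 -mulrA -addrA -mulrDr lerD2l ler_pM2l// => /le_trans; apply.
rewrite lerD2l (@le_trans _ _ (h * (`|d| + 1)))//.
  by rewrite ler_wpM2l ?(ltW hp)// (le_trans (ler_norm _))// lerDl.
by rewrite -ler_pdivlMr// ge_min lexx orbT.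
Qed.

Lemma lp_measure_lip N (A B : 'M[R]_N) : (0 < N)%N ->
  lp_measure p A <= lp_measure p B + lp_mxnorm p (A - B).
Proof.
move=> N0; apply/ler_addgt0Pr => e e0.
have [h0 h00 hB] := lp_measure_upper B N0 e0.
apply: (@lp_measure_le _ _ _ 0 h0) => // h hp hh0.
have -> : 1%:M + h *: A = (1%:M + h *: B) + h *: (A - B).
  by rewrite -addrA -scalerDr [B + _]addrC subrK.
rewrite (le_trans (lp_mxnormD p1 _ _))//.
rewrite (le_trans (lerD (hB h hp hh0) (lp_mxnormZ_le p1 _ _)))//.
rewrite (gtr0_norm hp); lra.
Qed.

Lemma lp_measureZ_ge N (c : R) (A : 'M[R]_N) : (0 < N)%N -> 0 < c ->
  c * lp_measure p A <= lp_measure p (c *: A).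
Proof.
move=> N0 c0; rewrite mulrC -ler_pdivlMr//; apply/ler_addgt0Pr => e e0.
have [h0 h00 hB] := lp_measure_upper (c *: A) N0 (mulr_gt0 e0 c0).
apply: (@lp_measure_le _ _ _ 0 (c * h0)) => [//||h hp hh0]; first exact: mulr_gt0.
have hc : h = (h / c) * c by rewrite mulfVK ?gt_eqF.
rewrite {1}hc -scalerA (le_trans (hB _ _ _))// ?divr_gt0 ?ler_pdivrMr 1?mulrC//.
rewrite mulr0 addr0 le_eqVlt; apply/orP; left; apply/eqP; field.
by rewrite gt_eqF.
Qed.

(** The tensor product of [1 + h A] and [1 + h B] is [1 + h C] up to second order, and its norm is
    at least the product of the two norms, hence at least [(1 + h a) (1 + h b)]. *)
Lemma lp_measure_tensD m n (A : 'M[R]_m) (B : 'M[R]_n) :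
  (0 < m)%N -> (0 < n)%N ->
  lp_measure p A + lp_measure p B <=
  lp_measure p (tensmx A 1%:M + tensmx 1%:M B).
Proof.
move=> m0 n0; set C := tensmx A 1%:M + tensmx 1%:M B.
have mn0 : (0 < m * n)%N by rewrite muln_gt0 m0.
pose a := lp_measure p A; pose b := lp_measure p B.
rewrite -/a -/b.
apply/ler_addgt0Pr => e e0.
have [h0 h00 hC] := lp_measure_upper C mn0 e0.
have tE h : tensmx (1%:M + h *: A) (1%:M + h *: B)
    = (1%:M + h *: C) + h ^+ 2 *: tensmx A B.
  apply/matrixP => i j.
  case: (mxtens_indexP i) => i0 i1; case: (mxtens_indexP j) => j0 j1.
  rewrite !mxE !mxtens_indexK /= (can_eq (@mxtens_indexK _ _)) xpair_eqE.
  by case: eqP; case: eqP => _ _ /=; ring.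
set d := lp_mxnorm p (tensmx A B).
have key h : 0 < h -> h <= h0 -> 0 <= 1 + h * a -> 0 <= 1 + h * b ->
    (1 + h * a) * (1 + h * b) <= 1 + h * (lp_measure p C + e) + h ^+ 2 * d.
  move=> hp hh0 ha hb.
  have := lp_mxnorm_tens p1 (1%:M + h *: A) (1%:M + h *: B).
  move=> /(le_trans (ler_pM ha hb (lp_measure_lower A m0 hp)
    (lp_measure_lower B n0 hp))) /le_trans; apply.
  rewrite tE (le_trans (lp_mxnormD p1 _ _))// lerD ?hC//.
  by rewrite (le_trans (lp_mxnormZ_le p1 _ _))// normrX (gtr0_norm hp).
apply/ler_addgt0Pr => e' e'0.
(* The numbers [a] and [b] may be negative: [h M <= 1] keeps [1 + h a] and [1 + h b] nonnegative, so
   that lower bounds can be multiplied, and [h M <= e'] absorbs the second-order terms. *)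
pose M := `|a| + `|b| + `|d| + `|a * b| + 1.
have M0 : 0 < M by rewrite ltr_wpDl// !addr_ge0.
pose h := Num.min h0 (Num.min 1 e' / M).
have hp : 0 < h by rewrite lt_min h00 divr_gt0// lt_min ltr01.
have hM : h * M <= Num.min 1 e' by rewrite -ler_pdivlMr// ge_min lexx orbT.
have hM1 : h * M <= 1 by rewrite (le_trans hM)// ge_min lexx.
have hMe : h * M <= e' by rewrite (le_trans hM)// ge_min lexx orbT.
have small c : `|c| <= M -> 0 <= 1 + h * c.
  move=> cM; have : `|h * c| <= 1.
    by rewrite normrM (gtr0_norm hp) (le_trans _ hM1)// ler_wpM2l// ltW.
  by rewrite ler_norml => /andP[+ _] *; lra.
have aM : `|a| <= M by rewrite /M -!addrA lerDl !addr_ge0.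
have bM : `|b| <= M by rewrite /M [`|a| + _]addrC -!addrA lerDl !addr_ge0.
have hh0 : h <= h0 by rewrite ge_min lexx.
have := key h hp hh0 (small _ aM) (small _ bM).
have -> : (1 + h * a) * (1 + h * b) = 1 + h * (a + b + h * (a * b)) by ring.
move=> k1; have : h * (a + b + h * (a * b)) <= h * (lp_measure p C + e + h * d) by lra.
rewrite ler_pM2l// => k2.
have : h * (d - a * b) <= e'.
  rewrite (le_trans _ hMe)// ler_wpM2l ?(ltW hp)//.
  rewrite (le_trans (ler_norm _))// (le_trans (ler_normB _ _))// /M.
  by have := normr_ge0 a; have := normr_ge0 b => *; lra.
by rewrite mulrBr => *; lra.
Qed.

End LpMeasure.

(** * Minors and compound matrices *)

Section Minors.
Variable R : comNzRingType.

(** Expansion by multilinearity over all choices of one row of [B] for each row of the product,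
    repetitions included. Cauchy-Binet keeps the injective choices and groups them by image. *)
Lemma det_mulmx_sum k n (A : 'M[R]_(k, n)) (B : 'M[R]_(n, k)) :
  \det (A *m B) =
  \sum_(h : {ffun 'I_k -> 'I_n}) (\prod_i A i (h i)) * \det (rowsub h B).
Proof.
under eq_bigr do rewrite mulr_sumr.
rewrite exchange_big /=; apply: eq_bigr => s _.
under [RHS]eq_bigr do rewrite mulrCA -big_split.
rewrite -mulr_sumr; congr (_ * _).
under eq_bigr do rewrite mxE.
rewrite (bigA_distr_bigA (fun i l => A i l * B l (s i))) /=.
by apply: eq_bigr => h _; apply: eq_bigr => i _; rewrite mxE.
Qed.

(** Enumerates the injective functions, each once: an increasing enumeration of the image composed
    with a permutation. *)
Definition lexk_perm n k (x : 'I_('C(n, k)) * 'S_k) : {ffun 'I_k -> 'I_n} :=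
  [ffun a => tnth (tnth (lexk n k) x.1) (x.2 a)].

Lemma sorted_lexk n k (i : 'I_('C(n, k))) :
  sorted ltn [seq val a | a <- tnth (lexk n k) i].
Proof.
have := mem_tnth i (lexk n k); rewrite mem_sort mem_enum.
by rewrite (_ : tnth _ i \in _ = sorted ltn [seq val a | a <- tnth (lexk n k) i])// inE.
Qed.

Lemma uniq_lexk n k (i : 'I_('C(n, k))) : uniq (tnth (lexk n k) i).
Proof.
rewrite -(map_inj_uniq val_inj); apply: sorted_uniq (sorted_lexk i).
- exact: ltn_trans.
- exact: ltnn.
Qed.

Lemma tnth_lexk_inj n k (i : 'I_('C(n, k))) : injective (tnth (tnth (lexk n k) i)).
Proof. by apply/tuple_uniqP; exact: uniq_lexk. Qed.

Lemma lexk_inj n k : injective (tnth (lexk n k)).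
Proof. by apply/tuple_uniqP; rewrite sort_uniq enum_uniq. Qed.

Lemma lexk_surj n k (t : k.-tuple 'I_n) : sorted ltn [seq val a | a <- t] ->
  exists i, tnth (lexk n k) i = t.
Proof.
move=> st; have : t \in lexk n k by rewrite mem_sort mem_enum inE.
by move=> /tnthP[i ->]; exists i.
Qed.

Lemma sorted_lexk_eq n k (i j : 'I_('C(n, k))) :
  tnth (lexk n k) i =i tnth (lexk n k) j -> i = j.
Proof.
move=> ij; apply/lexk_inj/val_inj/(inj_map val_inj).
apply: (irr_sorted_eq ltn_trans ltnn (sorted_lexk i) (sorted_lexk j)) => a.
by apply/mapP/mapP => -[b bi ->]; exists b => //; rewrite ?ij// -ij.
Qed.

Lemma lexk_perm_inj n k : injective (@lexk_perm n k).
Proof.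
move=> [i s] [j t] /ffunP/= e.
have eq a : tnth (tnth (lexk n k) i) (s a) = tnth (tnth (lexk n k) j) (t a).
  by have := e a; rewrite !ffunE.
have ij : i = j.
  apply: sorted_lexk_eq => a; apply/tnthP/tnthP => -[b ->].
    by exists (t ((s^-1)%g b)); rewrite -eq permKV.
  by exists (s ((t^-1)%g b)); rewrite eq permKV.
rewrite -ij in eq *; congr pair; apply/permP => a.
by apply: (@tnth_lexk_inj _ _ i); rewrite eq.
Qed.

Lemma injective_lexk_perm n k (h : {ffun 'I_k -> 'I_n}) :
  injectiveb h = (h \in codom (@lexk_perm n k)).
Proof.
apply/injectiveP/codomP => [hi|[[i s] ->] a b]; last first.
  by rewrite !ffunE => /tnth_lexk_inj/perm_inj.
pose t := [tuple h a | a < k].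
pose t' := sort_tuple (fun a b : 'I_n => (a <= b)%N) t.
have /tuple_permP[s /= ts] : perm_eq t t' by rewrite perm_sym perm_sort.
have [|i it] := @lexk_surj n k t'.
  rewrite ltn_sorted_uniq_leq map_inj_uniq; last exact: val_inj.
  rewrite sort_uniq map_inj_uniq ?enum_uniq//=.
  by rewrite sorted_map; apply: sort_sorted => a b; exact: leq_total.
exists (i, s); apply/ffunP => a; rewrite ffunE /= it.
have -> : h a = tnth t a by rewrite tnth_mktuple.
suff -> : t = [tuple tnth t' (s i) | i < k] by rewrite tnth_mktuple.
exact: val_inj.
Qed.

Lemma det_rowsub_perm k n (B : 'M[R]_(n, k)) (g : 'I_k -> 'I_n) (s : 'S_k) :
  \det (rowsub (fun a => g (s a)) B) = (-1) ^+ s * \det (rowsub g B).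
Proof.
have -> : rowsub (fun a => g (s a)) B = row_perm s (rowsub g B).
  by apply/matrixP => a b; rewrite !mxE.
by rewrite row_permE det_mulmx det_perm.
Qed.

Lemma cauchy_binet k n (A : 'M[R]_(k, n)) (B : 'M[R]_(n, k)) :
  \det (A *m B) = \sum_(i < 'C(n, k))
    \det (colsub (tnth (tnth (lexk n k) i)) A)
    * \det (rowsub (tnth (tnth (lexk n k) i)) B).
Proof.
rewrite det_mulmx_sum (bigID (fun h : {ffun _} => injectiveb h))/=.
rewrite [X in _ + X]big1 ?addr0 => [|h /injectivePn[a [b ab hab]]]; last first.
  rewrite (determinant_alternate ab) ?mulr0// => c.
  by rewrite !mxE hab.
rewrite (eq_bigl (fun h => h \in [set lexk_perm x | x : 'I_('C(n, k)) * 'S_k]%SET)).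
  rewrite big_imset/=; last by move=> x y _ _; exact: lexk_perm_inj.
  rewrite (eq_bigl xpredT) => [|x]; last by rewrite inE.
  rewrite -(pair_bigA _ (fun i s => (\prod_a A a (@lexk_perm n k (i, s) a)) *
    \det (rowsub (@lexk_perm n k (i, s)) B)))/=.
  apply: eq_bigr => i _; rewrite mulr_suml; apply: eq_bigr => s _.
  rewrite (_ : \det (rowsub _ B) = (-1) ^+ s * \det (rowsub (tnth (tnth (lexk n k) i)) B)).
    rewrite mulrA [_ * (-1) ^+ s]mulrC; congr (_ * _ * _).
    by apply: eq_bigr => a _; rewrite !mxE ffunE.
  rewrite -det_rowsub_perm; congr (\det _); apply/matrixP => a b.
  by rewrite !mxE ffunE.
move=> h; rewrite injective_lexk_perm; apply/codomP/imsetP => -[x].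
  by exists x.
by move=> _ ->; exists x.
Qed.

Lemma mcompoundM n k (A B : 'M[R]_n) :
  mcompound k (A *m B) = mcompound k A *m mcompound k B.
Proof.
apply/matrixP => i j; rewrite !mxE.
set I := tnth _ i; set J := tnth _ j.
have -> : mxsub (tnth I) (tnth J) (A *m B) = rowsub (tnth I) A *m colsub (tnth J) B.
  by apply/matrixP => a b; rewrite !mxE; apply: eq_bigr => c _; rewrite !mxE.
rewrite cauchy_binet; apply: eq_bigr => l _; rewrite !mxE.
by congr (_ * _); congr (\det _); apply/matrixP => a b; rewrite !mxE.
Qed.

Lemma mcompound1 n k : mcompound k (1%:M : 'M[R]_n) = 1%:M.
Proof.
apply/matrixP => i j; rewrite !mxE; have [->|ij] := eqVneq i j.
  rewrite -[RHS](@det1 R k); congr (\det _); apply/matrixP => a b; rewrite !mxE.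
  by rewrite (inj_eq (@tnth_lexk_inj _ _ j)).
(* Distinct increasing tuples of the same length differ as sets, so some row of the minor is
   zero. *)
have [a aj] : exists a, tnth (tnth (lexk n k) i) a \notin tnth (lexk n k) j.
  apply/existsP; apply: contraNT ij; rewrite negb_exists => /forallP ij.
  apply/eqP/sorted_lexk_eq.
  have sub : {subset tnth (lexk n k) i <= tnth (lexk n k) j}.
    by move=> _ /tnthP[a ->]; have := ij a; rewrite negbK.
  by have [] := uniq_min_size (uniq_lexk i) sub; rewrite ?size_tuple.
rewrite (expand_det_row _ a) big1// => b _; rewrite !mxE.
rewrite (_ : (_ == _) = false) ?mul0r//; apply/negP => /eqP e.
by move: aj; rewrite e mem_tnth.
Qed.

End Minors.

(** Pivoting delivers rows and columns in arbitrary order. Such a minor is 0 if an index repeats,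
    and otherwise an entry of the compound up to sign. *)
Lemma det_minor_le (R : realType) n k (W : 'M[R]_n) (f g : 'I_k -> 'I_n) :
  `|\det (mxsub f g W)| <= mnorm (mcompound k W).
Proof.
have [fi|/injectivePn[a [b ab fab]]] := boolP (injectiveb (finfun f)); last first.
  rewrite (determinant_alternate ab) ?normr0 ?mnorm_ge0// => c.
  by move: fab; rewrite !ffunE !mxE => ->.
have [gi|/injectivePn[a [b ab gab]]] := boolP (injectiveb (finfun g)); last first.
  rewrite -det_tr (determinant_alternate ab) ?normr0 ?mnorm_ge0// => c.
  by move: gab; rewrite !ffunE !mxE => ->.
move: fi gi; rewrite !injective_lexk_perm => /codomP[[i s] fE] /codomP[[j t] gE].
have -> : mxsub f g W = row_perm s (col_perm t
    (mxsub (tnth (tnth (lexk n k) i)) (tnth (tnth (lexk n k) j)) W)).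
  apply/matrixP => a b; rewrite !mxE; congr (W _ _).
  - by have := congr1 (fun h : {ffun _} => h a) fE; rewrite !ffunE.
  - by have := congr1 (fun h : {ffun _} => h b) gE; rewrite !ffunE.
rewrite row_permE col_permE !det_mulmx !det_perm !normrM !normrX normrN1.
rewrite !expr1n mul1r mulr1.
by have := mnorm_coord (mcompound k W) i j; rewrite mxE.
Qed.

(** * First-order expansions with quadratic error *)

Section Linearization.
Variable R : realType.

Lemma derive1_of_quadratic_error (F : R -> R) (c l C d : R) : 0 < d -> 0 <= C ->
  (forall e, `|e| <= d -> `|F e - c - e * l| <= C * e ^+ 2) ->
  derive1 F 0 = l.
Proof.
move=> d0 C0 H.
(* The case [e = 0] of the hypothesis forces the value at 0. *)
have F0 : F 0 = c.
  have := H 0; rewrite normr0 (ltW d0) => /(_ isT).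
  by rewrite mul0r subr0 expr0n mulr0 normr_le0 subr_eq0 => /eqP.
rewrite derive1E; apply/cvg_lim => //; apply/cvgrPdist_le => e e0.
near=> h.
have h0 : h != 0 by near: h; exact: nbhs_dnbhs_neq.
rewrite /= addr0 [h%:A]mulr1 F0 [h^-1 *: _]mulrC distrC.
rewrite -[X in _ - X](@mulfK _ h)// -mulrBl normrM normfV ler_pdivrMr ?normr_gt0//.
rewrite [l * h]mulrC (le_trans (H _ _))//.
  near: h; apply: dnbhs0_le; exact: d0.
rewrite -(real_normK (num_real h)) expr2 mulrA ler_wpM2r//.
suff : `|h| <= e / (C + 1).
  rewrite ler_pdivlMr ?ltr_wpDl// => he; apply: le_trans he.
  by rewrite mulrC ler_wpM2l// lerDl.
near: h; apply: dnbhs0_le; rewrite divr_gt0// ltr_wpDl//.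
Unshelve. all: by end_near. Qed.

(** The pairing by which a matrix represents a linear form on matrices. *)
Definition mxpair m n (L E : 'M[R]_(m, n)) : R := \sum_i \sum_j L i j * E i j.

Lemma mxpairDl m n (L M E : 'M[R]_(m, n)) :
  mxpair (L + M) E = mxpair L E + mxpair M E.
Proof.
rewrite -big_split; apply: eq_bigr => i _ /=.
by rewrite -big_split; apply: eq_bigr => j _ /=; rewrite mxE mulrDl.
Qed.

Lemma mxpairZl m n c (L E : 'M[R]_(m, n)) : mxpair (c *: L) E = c * mxpair L E.
Proof.
rewrite mulr_sumr; apply: eq_bigr => i _.
by rewrite mulr_sumr; apply: eq_bigr => j _; rewrite mxE mulrA.
Qed.

Lemma mxpairC m n (L E : 'M[R]_(m, n)) : mxpair L E = mxpair E L.
Proof. by apply: eq_bigr => i _; apply: eq_bigr => j _; rewrite mulrC. Qed.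

Lemma mxpair_le m n (L E : 'M[R]_(m, n)) : `|mxpair L E| <= mnorm L * mnorm E.
Proof.
rewrite (le_trans (ler_norm_sum _ _ _))// mulr_suml; apply: ler_sum => i _.
rewrite (le_trans (ler_norm_sum _ _ _))// mulr_suml; apply: ler_sum => j _.
by rewrite normrM ler_wpM2l// mnorm_coord.
Qed.

Variables m n : nat.
Implicit Types (F G : 'M[R]_(m, n) -> R).

(** An expansion at 0 with a uniform quadratic error. Being closed under sums and products, it
    passes from coordinates to minors without any differentiation. *)
Definition linearized F (c : R) (L : 'M[R]_(m, n)) : Prop :=
  exists2 C : R, 0 <= C & forall E, mnorm E <= 1 ->
    `|F E - c - mxpair L E| <= C * mnorm E ^+ 2.

Lemma linearized_cst c : linearized (fun=> c) c 0.
Proof.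
exists 0 => // E _; rewrite -(scale0r (0 : 'M[R]_(m, n))) mxpairZl mul0r.
by rewrite !subrr normr0 mul0r.
Qed.

Lemma linearized_coord i j : linearized (fun E => E i j) 0 (delta_mx i j).
Proof.
exists 0 => // E _; rewrite /mxpair (bigD1 i)//= (bigD1 j)//= mxE !eqxx mul1r.
rewrite big1 => [|l lj]; last by rewrite mxE (negPf lj) andbF mul0r.
rewrite big1 => [|l lj]; last first.
  by rewrite big1// => k _; rewrite mxE (negPf lj) mul0r.
by rewrite !addr0 subr0 subrr normr0 mul0r.
Qed.

Lemma linearizedD F G c d L M : linearized F c L -> linearized G d M ->
  linearized (fun E => F E + G E) (c + d) (L + M).
Proof.
move=> [A A0 FA] [B B0 GB]; exists (A + B); first exact: addr_ge0.
move=> E E1; rewrite mxpairDl mulrDl.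
rewrite (_ : _ - _ = F E - c - mxpair L E + (G E - d - mxpair M E)); last by ring.
by rewrite (le_trans (ler_normD _ _))// lerD ?FA ?GB.
Qed.

Lemma linearizedM F G c d L M : linearized F c L -> linearized G d M ->
  linearized (fun E => F E * G E) (c * d) (d *: L + c *: M).
Proof.
move=> [A A0 FA] [B B0 GB].
have N0 := mnorm_ge0 L; have M0 := mnorm_ge0 M.
exists (A * (`|d| + mnorm M + B) + mnorm L * (mnorm M + B) + `|c| * B).
  by rewrite !(addr_ge0, mulr_ge0).
move=> E E1; have E0 := mnorm_ge0 E.
have ee : mnorm E ^+ 2 <= mnorm E by rewrite expr2 ler_piMr.
rewrite mxpairDl !mxpairZl.
set r := F E - c - mxpair L E; set r' := G E - d - mxpair M E.
have FE : F E = c + mxpair L E + r by rewrite /r; ring.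
have GE : G E = d + mxpair M E + r' by rewrite /r'; ring.
have lM := mxpair_le M E; have lL := mxpair_le L E.
have rA : `|r| <= A * mnorm E ^+ 2 by exact: FA.
have rB : `|r'| <= B * mnorm E ^+ 2 by exact: GB.
rewrite (_ : _ - _ = r * G E + mxpair L E * (mxpair M E + r') + c * r'); last first.
  by rewrite FE GE; ring.
have rB1 : `|mxpair M E + r'| <= (mnorm M + B) * mnorm E.
  rewrite (le_trans (ler_normD _ _))// mulrDl lerD// (le_trans rB)//.
  by rewrite ler_wpM2l.
have GB1 : `|G E| <= `|d| + mnorm M + B.
  rewrite GE -addrA (le_trans (ler_normD _ _))// -addrA lerD2l (le_trans rB1)//.
  by rewrite ler_piMr// addr_ge0.
rewrite [leRHS]mulrDl (le_trans (ler_normD _ _))// lerD//; last first.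
  by rewrite normrM -mulrA ler_wpM2l.
rewrite [leRHS]mulrDl (le_trans (ler_normD _ _))// lerD//.
  by rewrite normrM mulrAC ler_pM.
rewrite normrM (le_trans (ler_pM _ _ lL rB1))//.
by rewrite expr2 mulrACA.
Qed.

Lemma linearized_sum (I : Type) (r : seq I) (F : I -> 'M[R]_(m, n) -> R) c :
  (forall i, exists L, linearized (F i) (c i) L) ->
  exists L, linearized (fun E => \sum_(i <- r) F i E) (\sum_(i <- r) c i) L.
Proof.
move=> H; elim: r => [|i r [L ih]].
  by exists 0; rewrite big_nil; under eq_fun do rewrite big_nil; exact: linearized_cst.
have [M HM] := H i; exists (M + L); rewrite big_cons.
by under eq_fun do rewrite big_cons; exact: linearizedD.
Qed.

Lemma linearized_prod (I : Type) (r : seq I) (F : I -> 'M[R]_(m, n) -> R) c :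
  (forall i, exists L, linearized (F i) (c i) L) ->
  exists L, linearized (fun E => \prod_(i <- r) F i E) (\prod_(i <- r) c i) L.
Proof.
move=> H; elim: r => [|i r [L ih]].
  by exists 0; rewrite big_nil; under eq_fun do rewrite big_nil; exact: linearized_cst.
have [M HM] := H i; exists ((\prod_(i <- r) c i) *: M + c i *: L); rewrite big_cons.
by under eq_fun do rewrite big_cons; exact: linearizedM.
Qed.

Lemma derive1_linearized F c L (A : 'M[R]_(m, n)) : linearized F c L ->
  derive1 (fun e : R => F (e *: A)) 0 = mxpair L A.
Proof.
move=> [C C0 FC]; have A1 : 0 < mnorm A + 1 by rewrite ltr_wpDl// mnorm_ge0.
apply: (@derive1_of_quadratic_error _ c _ (C * mnorm A ^+ 2) (mnorm A + 1)^-1).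
- by rewrite invr_gt0.
- by rewrite mulr_ge0// exprn_ge0// mnorm_ge0.
move=> e e1; have := FC (e *: A).
rewrite mnormZ mxpairC mxpairZl mxpairC.
have -> : C * mnorm A ^+ 2 * e ^+ 2 = C * (`|e| * mnorm A) ^+ 2.
  by rewrite exprMn real_normK ?num_real//; ring.
apply.
rewrite (le_trans (ler_wpM2r (mnorm_ge0 _) e1))// ler_pdivrMl// mulr1 lerDl.
exact: ler01.
Qed.

End Linearization.

Lemma linearized_mcompound (R : realType) n k (i j : 'I_('C(n, k))) :
  exists L, linearized (fun E : 'M[R]_n => mcompound k (1%:M + E) i j)
    (i == j)%:R L.
Proof.
have -> : (i == j)%:R = mcompound k (1%:M : 'M[R]_n) i j.
  by rewrite mcompound1 mxE.
rewrite [mcompound k (1%:M : 'M[R]_n) i j]mxE.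
have -> : (fun E : 'M[R]_n => mcompound k (1%:M + E) i j) = (fun E => \det
    (mxsub (tnth (tnth (lexk n k) i)) (tnth (tnth (lexk n k) j)) (1%:M + E))).
  by apply/funext => E; rewrite mxE.
apply: linearized_sum => s.
have [|L HL] := @linearized_prod R n n 'I_k (index_enum _)
  (fun a E => mxsub (tnth (tnth (lexk n k) i)) (tnth (tnth (lexk n k) j))
    (1%:M + E) a (s a))
  (fun a => mxsub (tnth (tnth (lexk n k) i)) (tnth (tnth (lexk n k) j))
    (1%:M : 'M[R]_n) a (s a)).
  move=> a; exists (0 + delta_mx (tnth (tnth (lexk n k) i) a)
                     (tnth (tnth (lexk n k) j) (s a))).
  rewrite mxE -[X in linearized _ X _]addr0.
  rewrite (_ : (fun E => _) = fun E : 'M[R]_n =>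
      (1%:M : 'M[R]_n) (tnth (tnth (lexk n k) i) a) (tnth (tnth (lexk n k) j) (s a))
      + E (tnth (tnth (lexk n k) i) a) (tnth (tnth (lexk n k) j) (s a))); last first.
    by apply/funext => E; rewrite mxE [LHS]mxE.
  apply: linearizedD; [exact: linearized_cst | exact: linearized_coord].
by eexists; apply: linearizedM HL; exact: linearized_cst.
Qed.

Section AdditiveCompound.
Variables (R : realType) (n k : nat).

Let mcompound_entry_expansion : exists (L : 'I_('C(n, k)) -> 'I_('C(n, k)) -> 'M[R]_n),
  forall i j, linearized (fun E : 'M[R]_n => mcompound k (1%:M + E) i j)
    (i == j)%:R (L i j).
Proof.
exists (fun i j => projT1 (cid (linearized_mcompound R i j))) => i j.
exact: projT2 (cid (linearized_mcompound R i j)).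
Qed.

(** Each entry of the additive compound is a linear form in [A]; linearity and boundedness of
    [acompound] follow at once. *)
Let acompoundE : exists (L : 'I_('C(n, k)) -> 'I_('C(n, k)) -> 'M[R]_n),
  forall A, acompound k A = \matrix_(i, j) mxpair A (L i j).
Proof.
have [L HL] := mcompound_entry_expansion; exists L => A; apply/matrixP => i j; rewrite !mxE.
by rewrite (derive1_linearized A (HL i j)) mxpairC.
Qed.

Lemma acompoundD (A B : 'M[R]_n) :
  acompound k (A + B) = acompound k A + acompound k B.
Proof. by have [L H] := acompoundE; apply/matrixP => i j; rewrite !H !mxE mxpairDl. Qed.

Lemma acompoundZ c (A : 'M[R]_n) : acompound k (c *: A) = c *: acompound k A.
Proof. by have [L H] := acompoundE; apply/matrixP => i j; rewrite !H !mxE mxpairZl. Qed.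

Lemma acompoundB (A B : 'M[R]_n) :
  acompound k (A - B) = acompound k A - acompound k B.
Proof. by rewrite -scaleN1r acompoundD acompoundZ scaleN1r. Qed.

Lemma acompound_bounded : exists2 C : R, 0 <= C &
  forall A : 'M[R]_n, mnorm (acompound k A) <= C * mnorm A.
Proof.
have [L H] := acompoundE; exists (\sum_i \sum_j mnorm (L i j)).
  by rewrite sumr_ge0// => i _; rewrite sumr_ge0// => j _; exact: mnorm_ge0.
move=> A; rewrite H mulr_suml; apply: ler_sum => i _.
rewrite mulr_suml; apply: ler_sum => j _.
by rewrite mxE mulrC mxpair_le.
Qed.

Lemma mcompound_linearization : exists2 C : R, 0 <= C &
  forall E : 'M[R]_n, mnorm E <= 1 ->
  mnorm (mcompound k (1%:M + E) - 1%:M - acompound k E) <= C * mnorm E ^+ 2.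
Proof.
have [L HL] := mcompound_entry_expansion.
pose C i j := s2val (cid2 (HL i j)).
have C0 i j : 0 <= C i j := s2valP (cid2 (HL i j)).
have HC i j := s2valP' (cid2 (HL i j)).
exists (\sum_i \sum_j C i j).
  by rewrite sumr_ge0// => i _; rewrite sumr_ge0.
move=> E E1; rewrite mulr_suml; apply: ler_sum => i _.
rewrite mulr_suml; apply: ler_sum => j _.
have -> : (mcompound k (1%:M + E) - 1%:M - acompound k E) i j
    = mcompound k (1%:M + E) i j - (i == j)%:R - mxpair (L i j) E.
  rewrite -(derive1_linearized E (HL i j)).
  by rewrite [LHS]mxE [X in X + _]mxE [(- acompound k E) i j]mxE [acompound k E i j]mxE [(- 1%:M) i j]mxE [1%:M i j]mxE.
exact: HC.
Qed.

End AdditiveCompound.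

(** * Jordan form and principal powers *)

Section JordanForm.
Local Open Scope complex_scope.
Variable R : realType.
Local Notation C := R[i].
Implicit Types (n : nat) (l : C).

Lemma mul_jordan_block_row m n l (U : 'M[C]_(m, n)) (i : 'I_m) (j : 'I_n) :
  (jordan_block m l *m U) i j =
  l * U i j + (if insub i.+1 is Some i' then U i' j else 0).
Proof.
rewrite mxE; under eq_bigr do rewrite mxE mulrDl.
rewrite big_split /=; congr (_ + _).
  rewrite (bigD1 i)//= eqxx mulr1n big1 ?addr0// => k /negPf ki.
  by rewrite eq_sym ki mulr0n mul0r.
case: insubP => [i' _ i'E|im].
  rewrite (bigD1 i')//= i'E eqxx mul1r big1 ?addr0// => k /negPf ki.
  by rewrite -i'E eq_sym (inj_eq val_inj) ki mul0r.
by rewrite big1// => k _; case: eqP => [ik|]; rewrite ?mul0r//; move: im; rewrite ik ltn_ord.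
Qed.

Lemma mul_jordan_block_col m n l (U : 'M[C]_(n, m)) (i : 'I_n) (j : 'I_m) :
  (U *m jordan_block m l) i j =
  l * U i j + (if j == 0%N :> nat then 0 else
               if insub j.-1 is Some j' then U i j' else 0).
Proof.
rewrite mxE; under eq_bigr do rewrite mxE mulrDr.
rewrite big_split /=; congr (_ + _).
  rewrite (bigD1 j)//= eqxx mulr1n mulrC big1 ?addr0// => k /negPf kj.
  by rewrite kj mulr0n mulr0.
case: eqP => [j0|/eqP j0].
  by rewrite big1// => k _; rewrite j0 mulr0.
case: insubP => [j' _ j'E|jm].
  rewrite (bigD1 j')//= j'E prednK ?lt0n// eqxx mulr1 big1 ?addr0// => k /negPf kj.
  by rewrite -[in X in X%:R](prednK (n := j)) ?lt0n// eqSS -j'E (inj_eq val_inj) kj mulr0.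
by move: jm; rewrite (leq_ltn_trans (leq_pred _) (ltn_ord j)).
Qed.

(* The rows of U span a Jordan chain of maximal length for the eigenvalue l; the
   columns of V are a dual chain, so the left kernel of V is an invariant
   complement. *)
Lemma jordan_split n (A : 'M[C]_n.+1) :
  exists (a b : nat) (l : C) (B : 'M[C]_b) (P : 'M[C]_(n.+1, a + b))
    (Q : 'M[C]_(a + b, n.+1)),
  [/\ (b < n.+1)%N, P *m Q = 1%:M, Q *m P = 1%:M &
      A = P *m block_mx (jordan_block a l) 0 0 B *m Q].
Proof.
pose p := mxminpoly A.
have p0 : p != 0 by rewrite monic_neq0// mxminpoly_monic.
have /closed_rootP[l pl] : size p != 1%N.
  by rewrite size_mxminpoly eqSS -lt0n mxminpoly_nonconstant.
have [m [q]] := multiplicity_XsubC p l; rewrite p0 /= => ql pE.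
case: m pE => [|m] pE; first by move: pl ql; rewrite pE expr0 mulr1 => ->.
pose X : {poly C} := 'X - l%:P.
pose T := horner_mx A; pose N := T X.
have TA : T 'X = A by exact: horner_mx_X.
have NE : N = A - l%:M by rewrite /N /T /X rmorphB /= horner_mx_X horner_mx_C.
have TM x y : T (x * y) = T x *m T y by rewrite /T rmorphM.
have Tp : T (q * X ^+ m.+1) = 0 by rewrite -pE; exact: mx_root_minpoly.
(* Otherwise the minimal polynomial [q * X ^+ m.+1] would divide [q * q * X ^+ m], making [l] a root
   of [q]. The nonzero entry found here selects the chains. *)
have /matrix0Pn[r [c rc]] : T (q * q * X ^+ m) != 0.
  apply: contra ql => /eqP/mxminpoly_min; rewrite -/p pE exprS mulrA.
  rewrite dvdp_mul2r ?expf_neq0 ?polyXsubC_eq0// dvdp_mul2l; last first.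
    by apply: contraNneq p0 => q0; rewrite pE q0 mul0r.
  by rewrite dvdp_XsubCl.
pose U := \matrix_(i < m.+1) row r (T (q * X ^+ i)).
pose V := (\matrix_(j < m.+1) row c (T (q * X ^+ (m - j)))^T)^T.
have UA : U *m A = jordan_block m.+1 l *m U.
  apply/matrixP => i j; rewrite mul_jordan_block_row.
  have -> : A = l%:M + N by rewrite NE addrC subrK.
  rewrite mulmxDr mul_mx_scalar [LHS]mxE [(l *: U) i j]mxE; congr (_ + _).
  have -> : (U *m N) i j = (T (q * X ^+ i.+1)) r j.
    rewrite exprSr mulrA TM [LHS]mxE [RHS]mxE.
    by apply: eq_bigr => k _; rewrite !mxE.
  case: insubP => [i' _ i'E|]; first by rewrite !mxE i'E.
  rewrite ltnS -leqNgt => mi.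
  have -> : i = m :> nat by apply/anti_leq; rewrite mi -ltnS ltn_ord.
  by rewrite Tp mxE.
have AV : A *m V = V *m jordan_block m.+1 l.
  apply/matrixP => i j; rewrite mul_jordan_block_col.
  have -> : A = l%:M + N by rewrite NE addrC subrK.
  rewrite mulmxDl mul_scalar_mx [LHS]mxE [(l *: V) i j]mxE; congr (_ + _).
  have -> : (N *m V) i j = (T (q * X ^+ (m - j).+1)) i c.
    rewrite exprS mulrCA TM [LHS]mxE [RHS]mxE.
    by apply: eq_bigr => k _; rewrite !mxE.
  case: eqP => [->|/eqP j0]; first by rewrite subn0 Tp mxE.
  case: insubP => [j' _ j'E|]; last first.
    by rewrite (leq_ltn_trans (leq_pred _) (ltn_ord j)).
  rewrite !mxE j'E -subSn ?leq_pred//; last by rewrite -ltnS ltn_ord.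
  by rewrite -[X in T (q * _ ^+ (m.+1 - X))](prednK (n := j)) ?lt0n// subSS.
have UV i j : (U *m V) i j = (T (q * q * X ^+ (i + (m - j)))) r c.
  rewrite exprD mulrACA TM.
  by rewrite [LHS]mxE [RHS]mxE; apply: eq_bigr => k _; rewrite !mxE.
(* The product is upper triangular: below the diagonal the exponent exceeds [m] and the minimal
   polynomial appears, while every diagonal entry is the nonzero entry at [r] and [c]. *)
have UVu : U *m V \in unitmx.
  rewrite unitmxE -det_tr det_trig.
    rewrite unitfE; apply/prodf_neq0 => i _.
    by rewrite mxE UV subnKC// -ltnS ltn_ord.
  apply/is_trig_mxP => i j ij; rewrite mxE UV.
  have -> : (j + (m - i) = m.+1 + (j - i.+1))%N.
    have := ltn_ord j; have := ltn_ord i; lia.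
  by rewrite exprD mulrA -[q * q * _]mulrA !TM -TM Tp mulmx0 mul0mx mxE.
pose W := row_base (kermx V).
have WV : W *m V = 0 by apply/sub_kermxP; rewrite eq_row_base.
have /submxP[B WA] : (W *m A <= W)%MS.
  by rewrite eq_row_base; apply/sub_kermxP; rewrite -mulmxA AV mulmxA WV mul0mx.
pose S := col_mx U W.
have SA : S *m A = block_mx (jordan_block m.+1 l) 0 0 B *m S.
  by rewrite mul_block_col mul_col_mx UA WA !mul0mx addr0 add0r.
have Sfree : row_free S.
  rewrite -kermx_eq0; apply/eqP/row_matrixP => i; rewrite row0.
  set x := row i _; have : x *m S = 0 by rewrite -row_mul mulmx_ker row0.
  rewrite -[x]hsubmxK mul_row_col => xS.
  have x1 : lsubmx x = 0.
    have : lsubmx x *m (U *m V) = 0.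
      by have := congr1 (mulmx^~ V) xS; rewrite /= mulmxDl mul0mx
        -(mulmxA (lsubmx x)) -(mulmxA (rsubmx x)) WV mulmx0 addr0.
    by move=> /(congr1 (mulmx^~ (invmx (U *m V)))); rewrite mulmxK// mul0mx.
  move: xS; rewrite x1 mul0mx add0r => x2.
  have /row_freeP[W' WW'] : row_free W by exact: row_base_free.
  have -> : rsubmx x = 0.
    by have := congr1 (mulmx^~ W') x2; rewrite -mulmxA WW' mulmx1 mul0mx.
  by rewrite row_mx0.
have rV : \rank V = m.+1.
  apply/anti_leq; rewrite rank_leq_col /=.
  by rewrite -{1}(mxrank_unit UVu) mxrankM_maxr.
have sz : (m.+1 + \rank (kermx V) = n.+1)%N.
  by rewrite mxrank_ker rV subnKC// -[X in (X <= _)%N]rV rank_leq_row.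
have Sfull : row_full S by rewrite /row_full (eqP Sfree) sz.
exists m.+1, (\rank (kermx V)), l, B, (pinvmx S), S; split.
- by rewrite -[X in (_ < X)%N]sz addSn ltnS leq_addl.
- exact: mulVpmx.
- exact: mulmxVp.
- by rewrite -mulmxA -SA mulmxA mulVpmx// mul1mx.
Qed.

(** Needed because [mxdiag_recl] splits off the first block only up to a cast between equal
    sizes. *)
Lemma similar_castmx n m m' (e : m = m') (A : 'M[C]_n) P X Q :
  P *m Q = 1%:M -> Q *m P = 1%:M -> A = P *m (X : 'M[C]_(m, m)) *m Q ->
  exists (P' : 'M[C]_(n, m')) (Q' : 'M[C]_(m', n)),
    [/\ P' *m Q' = 1%:M, Q' *m P' = 1%:M & A = P' *m castmx (e, e) X *m Q'].
Proof. by move=> PQ QP ->; case: _ / e; exists P, Q. Qed.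

Lemma jordan_form n (A : 'M[C]_n) :
  exists (m : nat) (d : 'I_m -> nat) (l : 'I_m -> C)
    (P : 'M[C]_(n, \sum_i d i)) (Q : 'M[C]_(\sum_i d i, n)),
  [/\ P *m Q = 1%:M, Q *m P = 1%:M &
      A = P *m (\mxdiag_(i < m) jordan_block (d i) (l i)) *m Q].
Proof.
(* With the blocks given as a list of sizes and eigenvalues, the induction adds a block by a mere
   [::]. *)
suff [s [P [Q PQ]]] : exists (s : seq (nat * C))
    (P : 'M[C]_(n, \sum_(i < size s) (nth (0%N, 0%R) s i).1))
    (Q : 'M[C]_(\sum_(i < size s) (nth (0%N, 0%R) s i).1, n)),
  [/\ P *m Q = 1%:M, Q *m P = 1%:M &
      A = P *m (\mxdiag_(i < size s)
         jordan_block (nth (0%N, 0%R) s i).1 (nth (0%N, 0%R) s i).2) *m Q].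
  by exists (size s), (fun i => (nth (0%N, 0%R) s i).1), (fun i => (nth (0%N, 0%R) s i).2), P, Q.
have [N] := ubnP n; elim: N n A => // N IH [|n] A nN.
  exists [::], 0, 0; split; apply/matrixP => a; have := ltn_ord a => //.
  by rewrite [X in (_ < X)%N]big_ord0.
have [a [b [l [B [P [Q [bn PQ QP AE]]]]]]] := jordan_split A.
have [s [P' [Q' [PQ' QP' BE]]]] := IH b B (leq_trans bn nN).
set D := \mxdiag_i _ in BE.
have AE' : A = (P *m block_mx 1%:M 0 0 P') *m
    block_mx (jordan_block a l) 0 0 D *m (block_mx 1%:M 0 0 Q' *m Q).
  have BE' : block_mx (jordan_block a l) 0 0 B = block_mx 1%:M 0 0 P' *m
      block_mx (jordan_block a l) 0 0 D *m block_mx 1%:M 0 0 Q'.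
    rewrite !mulmx_block !(mul0mx, mulmx0, mul1mx, mulmx1, addr0, add0r).
    by rewrite -BE.
  by rewrite {1}AE BE' !mulmxA.
exists ((a, l) :: s); rewrite mxdiag_recl.
apply: (similar_castmx mxsize_recl _ _ AE').
- rewrite mulmxA -(mulmxA P) mulmx_block.
  rewrite !(mul0mx, mulmx0, mul1mx, mulmx1, addr0, add0r) PQ'.
  by rewrite -scalar_mx_block mulmx1 PQ.
- rewrite mulmxA -(mulmxA _ Q) QP mulmx1 mulmx_block.
  rewrite !(mul0mx, mulmx0, mul1mx, mulmx1, addr0, add0r) QP'.
  by rewrite -scalar_mx_block.
Qed.

End JordanForm.

(** * Differentiation rules in pointwise form, and integration of a power bound *)

Section RealDerivatives.
Variable R : realType.
Implicit Types (f g : R -> R) (t a b : R).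

Lemma is_derive_mulf f g t a b : is_derive t 1 f a -> is_derive t 1 g b ->
  is_derive t 1 (fun s => f s * g s) (a * g t + f t * b).
Proof.
move=> fa gb; have -> : a * g t + f t * b = f t *: b + g t *: a.
  by rewrite addrC [a * _]mulrC.
exact: is_deriveM.
Qed.

Lemma is_derive_addf f g t a b : is_derive t 1 f a -> is_derive t 1 g b ->
  is_derive t 1 (fun s => f s + g s) (a + b).
Proof. by move=> fa gb; exact: (is_deriveD fa gb). Qed.

Lemma is_derive_subf f g t a b : is_derive t 1 f a -> is_derive t 1 g b ->
  is_derive t 1 (fun s => f s - g s) (a - b).
Proof. by move=> fa gb; exact: (is_deriveB fa gb). Qed.

Lemma is_derive_scalef f t a c : is_derive t 1 f a ->
  is_derive t 1 (fun s => c * f s) (c * a).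
Proof. by move=> fa; exact: (is_deriveZ c fa). Qed.

Lemma is_derive_compf f g t a b : is_derive (g t) 1 f a -> is_derive t 1 g b ->
  is_derive t 1 (fun s => f (g s)) (a * b).
Proof. by move=> fa gb; exact: (@is_derive1_comp _ f g t a b). Qed.

Lemma is_derive_sumf n (F : 'I_n -> R -> R) (a : 'I_n -> R) (t : R) :
  (forall i, is_derive t 1 (F i) (a i)) ->
  is_derive t 1 (fun s => \sum_i F i s) (\sum_i a i).
Proof.
move=> H; rewrite (_ : (fun s => _) = \sum_i F i); first exact: is_derive_sum.
by apply/funext => s; rewrite fct_sumE.
Qed.

Lemma is_derive_exprf n t :
  is_derive t 1 (fun s : R => s ^+ n) (n%:R * t ^+ n.-1).
Proof.
have := @is_deriveX R R id n t 1 1 (is_derive_id _ _).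
rewrite [_ *: _]mulr1 (_ : id ^+ n = (fun s : R => s ^+ n))//.
by apply/funext => s; rewrite exprfctE.
Qed.

Lemma is_derive_affine c d t : is_derive t 1 (fun s => c + s * d) d.
Proof.
apply: is_derive_eq (is_derive_addf (is_derive_cst c t 1)
  (is_derive_mulf (is_derive_id t 1) (is_derive_cst d t 1))) _.
by rewrite mul1r mulr0 add0r addr0.
Qed.

(** Integrates a power bound by means of the mean value theorem, applied to
    [c / K.+1%:R * t ^+ K.+1] minus [f] or plus [f]. *)
Lemma derivable_bound f (df : R -> R) (c : R) K :
  f 0 = 0 -> (forall t, 0 <= t <= 1 -> is_derive t 1 f (df t)) ->
  (forall t, 0 <= t <= 1 -> `|df t| <= c * t ^+ K) ->
  forall t, 0 <= t <= 1 -> `|f t| <= c / K.+1%:R * t ^+ K.+1.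
Proof.
move=> f0 fd dfc.
have main (g dg : R -> R) : g 0 = 0 ->
    (forall t, 0 <= t <= 1 -> is_derive t 1 g (dg t)) ->
    (forall t, 0 <= t <= 1 -> `|dg t| <= c * t ^+ K) ->
    forall t, 0 <= t <= 1 -> g t <= c / K.+1%:R * t ^+ K.+1.
  move=> g0 gd dgc t /andP[t0 t1].
  have hd (s : R) : 0 <= s <= 1 -> is_derive s 1 (fun s : R => c / K.+1%:R * s ^+ K.+1 - g s)
      (c * s ^+ K - dg s).
    move=> s01; apply: is_derive_subf (gd s s01).
    apply: is_derive_eq; first exact: is_derive_scalef (is_derive_exprf _ _).
    by rewrite /= mulrA divfK// pnatr_eq0.
  have [||s] := @MVT_segment R (fun s : R => c / K.+1%:R * s ^+ K.+1 - g s)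
      (fun s => c * s ^+ K - dg s) 0 t t0.
  - move=> s; rewrite in_itv/= => /andP[s0 st]; apply: hd.
    by rewrite (ltW s0)/= (le_trans (ltW st)).
  - apply: derivable_within_continuous => s; rewrite in_itv/= => /andP[s0 st].
    have s01 : 0 <= s <= 1 by apply/andP; split; [exact: s0|exact: le_trans st t1].
    by have [] := hd s s01.
  rewrite in_itv/= => /andP[s0 st].
  rewrite g0 expr0n mulr0 !subr0 => h.
  rewrite -subr_ge0 h mulr_ge0// subr_ge0.
  by rewrite (le_trans (ler_norm _))// dgc// s0/= (le_trans st).
move=> t t01; rewrite ler_norml lerNl; apply/andP; split; last exact: main.
apply: (main (fun s => - f s) (fun s => - df s)) => //.
- by rewrite f0 oppr0.
- by move=> s s01; have fs := fd s s01; exact: is_deriveN.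
- by move=> s s01; rewrite normrN dfc.
Qed.

End RealDerivatives.

Section GeneralizedBinomial.
Variable R : realType.
Implicit Types (b g : R).

Lemma gbinomS g l : l.+1%:R * gbinom g l.+1 = g * gbinom (g - 1) l.
Proof.
rewrite /gbinom big_ord_recl/= subr0 factS natrM.
rewrite (eq_bigr (fun q : 'I_l => g - 1 - q%:R)) => [|q _]; last first.
  by rewrite /bump/= add1n -natr1; ring.
have l0 : l.+1%:R != 0 :> R by rewrite pnatr_eq0.
by rewrite invfM [_^-1 * _]mulrC !mulrA [LHS]mulrC !mulrA mulVf// mul1r.
Qed.

Lemma gbinom0 g : gbinom g 0 = 1.
Proof. by rewrite /gbinom big_ord0 fact0 divr1. Qed.

Lemma gbinom1 g : gbinom g 1 = g.
Proof. by rewrite /gbinom big_ord_recl big_ord0 subr0 mulr1 divr1. Qed.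

(** Turns the coefficients met on the [d]-th superdiagonal of powers of a Jordan block into those of
    the binomial series of exponent [g - d]. *)
Lemma gbinom_add g d l :
  gbinom g (d + l) * ('C(d + l, d))%:R = gbinom g d * gbinom (g - d%:R) l.
Proof.
rewrite /gbinom big_split_ord/=.
rewrite (eq_bigr (fun q : 'I_l => g - d%:R - q%:R) (F1 := fun i : 'I_l => _ - (d + i)%:R)); last first.
  by move=> q _; rewrite natrD opprD addrA.
have := bin_fact (leq_addr l d); rewrite addKn => h.
rewrite -h !natrM; field.
by rewrite !pnatr_eq0 -!lt0n !fact_gt0 bin_gt0 leq_addr.
Qed.

Lemma gbinom_le1 b l : 0 <= b <= 1 -> `|gbinom b l| <= 1.
Proof.
move=> /andP[b0 b1]; rewrite /gbinom normrM normfV [`|l`!%:R|]ger0_norm//.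
rewrite ler_pdivrMr ?ltr0n ?fact_gt0// mul1r normr_prod.
rewrite fact_prod natr_prod big_add1 /= big_mkord.
apply: ler_prod => q _; rewrite normr_ge0/= ler_norml.
by have := ler0n R q; rewrite -[q.+1%:R]natr1 => h; apply/andP; split; lra.
Qed.

(** The coefficient of [z ^ K] in [(1 - z) ^ (- g)]. It comes from integrating the remainder [K]
    times: each integration lowers the exponent by one and raises the bound on its modulus by
    one. *)
Definition gbinom_majorant g K : R := (\prod_(q < K) (g + q%:R)) / K`!%:R.

Lemma gbinom_majorantS g K :
  gbinom_majorant g K.+1 = g / K.+1%:R * gbinom_majorant (g + 1) K.
Proof.
rewrite /gbinom_majorant big_ord_recl/= addr0 factS natrM.
rewrite (eq_bigr (fun q : 'I_K => g + 1 + q%:R)) => [|q _]; last first.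
  by rewrite /bump/= add1n -natr1; ring.
by rewrite invfM mulrACA mulrA.
Qed.

Lemma gbinom_majorant_ge0 g K : 0 <= g -> 0 <= gbinom_majorant g K.
Proof. by move=> g0; rewrite divr_ge0// prodr_ge0// => q _; rewrite addr_ge0. Qed.

Lemma gbinom_majorant_le g K : 0 <= g -> gbinom_majorant g K <= (g + 1) ^+ K.
Proof.
move=> g0; rewrite ler_pdivrMr ?ltr0n ?fact_gt0//.
rewrite fact_prod natr_prod big_add1 /= big_mkord.
rewrite -[X in _ ^+ X]card_ord -prodr_const -big_split/=.
apply: ler_prod => q _; rewrite addr_ge0//= -natr1.
have := mulr_ge0 g0 (ler0n R q); lra.
Qed.

End GeneralizedBinomial.

(** * The binomial series of a principal power near 1 *)

Section BinomialSeries.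
Local Open Scope complex_scope.
Variable R : realType.
Variables (a b dl : R).
Implicit Types (t g c : R).
Hypotheses (adl : `|a| <= dl) (bdl : `|b| <= dl) (dl4 : dl <= 1 / 4).

Let a4 : `|a| <= 1 / 4 := le_trans adl dl4.
Let b4 : `|b| <= 1 / 4 := le_trans bdl dl4.
Let dl0 : 0 <= dl := le_trans (normr_ge0 a) adl.

(* The curve 1 + t (a + i b) in polar coordinates. *)
Let x (t : R) := 1 + t * a.
Let y (t : R) := t * b.
Let L (t : R) := ln (x t ^+ 2 + y t ^+ 2) / 2.
Let A (t : R) := atan (y t / x t).
Let u (g t : R) := expR (g * L t) * cos (g * A t).
Let v (g t : R) := expR (g * L t) * sin (g * A t).

Let small c t : `|c| <= 1 / 4 -> 0 <= t <= 1 -> - (1 / 4) <= t * c <= 1 / 4.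
Proof.
move=> c4 /andP[t0 t1]; rewrite -ler_norml normrM (ger0_norm t0).
by rewrite -[leRHS]mul1r ler_pM.
Qed.

Let x_bnd t : 0 <= t <= 1 -> 3 / 4 <= x t <= 5 / 4.
Proof. by move=> /(small a4)/andP[? ?]; rewrite /x; apply/andP; split; lra. Qed.

Let x_gt0 t : 0 <= t <= 1 -> 0 < x t.
Proof. by move=> /x_bnd/andP[? _]; lra. Qed.

Let r2_gt0 t : 0 <= t <= 1 -> 0 < x t ^+ 2 + y t ^+ 2.
Proof. by move=> /x_gt0 x0; rewrite ltr_pwDl ?exprn_gt0// sqr_ge0. Qed.

(** A crude estimate suffices: the squared modulus lies between 9/16 and 26/16, and [expR 2] is at
    least 3. *)
Let L_le1 t : 0 <= t <= 1 -> `|L t| <= 1.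
Proof.
move=> t01; have r0 := r2_gt0 t01; have /andP[x1 x2] := x_bnd t01.
have /andP[y1 y2] := small b4 t01.
rewrite /L normrM [`|2^-1|]ger0_norm// ler_pdivrMr// mul1r ler_norml.
apply/andP; split.
  rewrite -ler_expR lnK ?posrE//.
  have e2 : expR (- 2) * expR 2 = 1 :> R by rewrite -expRD addNr expR0.
  have e3 : 1 + 2 <= expR 2 :> R by exact: expR_ge1Dx.
  have e4 : 0 < expR (- 2) :> R by exact: expR_gt0.
  have e5 : 9 / 16 <= x t ^+ 2 by rewrite expr2; nra.
  have e6 := sqr_ge0 (y t).
  have : expR (- 2) <= 1 / 2 :> R by nra.
  by move=> *; lra.
rewrite -ler_expR lnK ?posrE//.
have : 1 + 2 <= expR 2 :> R by exact: expR_ge1Dx.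
by rewrite /y; move=> *; nra.
Qed.

Let sqrt_r2 t : 0 <= t <= 1 -> expR (L t) = Num.sqrt (x t ^+ 2 + y t ^+ 2).
Proof.
move=> t01; have r0 := r2_gt0 t01.
by rewrite -powR12_sqrt ?(ltW r0)// /powR gt_eqF// mulrC.
Qed.

(** The real part stays positive on the curve, so the arctangent of [y / x] is the argument. *)
Let polar t : 0 <= t <= 1 ->
  expR (L t) * cos (A t) = x t /\ expR (L t) * sin (A t) = y t.
Proof.
move=> t01; have x0 := x_gt0 t01; have r0 := r2_gt0 t01.
have c0 : cos (A t) != 0.
  by rewrite cos_atan invr_eq0 gt_eqF// sqrtr_gt0 ltr_pwDl// sqr_ge0.
have ex : expR (L t) * cos (A t) = x t.
  rewrite sqrt_r2// cos_atan.
  have -> : 1 + (y t / x t) ^+ 2 = (x t ^+ 2 + y t ^+ 2) / x t ^+ 2.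
    by field; rewrite gt_eqF.
  rewrite sqrtrM ?(ltW r0)// sqrtrV ?sqr_ge0// sqrtr_sqr (gtr0_norm x0).
  by rewrite invfM invrK mulrA divff ?mul1r// gt_eqF// sqrtr_gt0.
split=> //; have := atanK (y t / x t); rewrite -/(A t) /tan => h.
have -> : y t = (sin (A t) / cos (A t)) * x t by rewrite h divfK// gt_eqF.
by rewrite -ex; field.
Qed.

Let uv_rec g t : 0 <= t <= 1 ->
  u g t = x t * u (g - 1) t - y t * v (g - 1) t /\
  v g t = y t * u (g - 1) t + x t * v (g - 1) t.
Proof.
move=> /polar[<- <-]; rewrite /u /v.
have -> : g * L t = L t + (g - 1) * L t by ring.
have -> : g * A t = A t + (g - 1) * A t by ring.
by rewrite expRD cosD sinD; split; ring.
Qed.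

Let is_derive_L t : 0 <= t <= 1 ->
  is_derive t 1 L ((a * x t + b * y t) / (x t ^+ 2 + y t ^+ 2)).
Proof.
move=> t01; have r0 := r2_gt0 t01.
have dx : is_derive t 1 x a by exact: is_derive_affine.
have dy : is_derive t 1 y b.
  by have := is_derive_affine 0 b t; under eq_fun do rewrite add0r.
rewrite (_ : L = fun s : R => 2^-1 * ln (x s * x s + y s * y s)); last first.
  by apply/funext => s; rewrite mulrC.
apply: is_derive_eq.
  apply: is_derive_scalef; apply: is_derive_compf.
    by apply: is_derive1_ln; rewrite -!expr2.
rewrite /GRing.scale /=; field.
by rewrite gt_eqF.
Qed.

Let is_derive_A t : 0 <= t <= 1 ->
  is_derive t 1 A ((b * x t - a * y t) / (x t ^+ 2 + y t ^+ 2)).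
Proof.
move=> t01; have r0 := r2_gt0 t01; have x0 := x_gt0 t01.
have dx : is_derive t 1 x a by exact: is_derive_affine.
have dy : is_derive t 1 y b.
  by have := is_derive_affine 0 b t; under eq_fun do rewrite add0r.
apply: is_derive_eq.
  apply: is_derive_compf; apply: is_derive_mulf.
  by apply: is_deriveV; rewrite ?gt_eqF.
rewrite /GRing.scale /=; field.
by rewrite !gt_eqF.
Qed.

(** In real coordinates: the derivative of [z ^ g] along the curve is [g (a + i b) z ^ (g - 1)]. *)
Let is_derive_uv g t : 0 <= t <= 1 ->
  is_derive t 1 (u g) (g * (a * u (g - 1) t - b * v (g - 1) t)) /\
  is_derive t 1 (v g) (g * (a * v (g - 1) t + b * u (g - 1) t)).
Proof.
move=> t01; have r0 := r2_gt0 t01.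
have dL := is_derive_L t01; have dA := is_derive_A t01.
have [uE vE] := uv_rec g t01.
pose P := (a * x t + b * y t) / (x t ^+ 2 + y t ^+ 2).
pose Q := (b * x t - a * y t) / (x t ^+ 2 + y t ^+ 2).
have dE : is_derive t 1 (fun s => expR (g * L s)) (expR (g * L t) * (g * P)).
  by apply: is_derive_compf; apply: is_derive_scalef.
have dC : is_derive t 1 (fun s => cos (g * A s)) (- sin (g * A t) * (g * Q)).
  by apply: is_derive_compf; apply: is_derive_scalef.
have dS : is_derive t 1 (fun s => sin (g * A s)) (cos (g * A t) * (g * Q)).
  by apply: is_derive_compf; apply: is_derive_scalef.
split.
  apply: is_derive_eq (is_derive_mulf dE dC) _.
  rewrite (_ : _ + _ = g * (P * u g t - Q * v g t)); last by rewrite /u /v; ring.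
  by rewrite uE vE /P /Q; field; rewrite gt_eqF.
apply: is_derive_eq (is_derive_mulf dE dS) _.
rewrite (_ : _ + _ = g * (P * v g t + Q * u g t)); last by rewrite /u /v; ring.
by rewrite uE vE /P /Q; field; rewrite gt_eqF.
Qed.

Let w : R[i] := (a +i* b)%C.
Let Su g K t := \sum_(l < K) gbinom g l * complex.Re (w ^+ l) * t ^+ l.
Let Sv g K t := \sum_(l < K) gbinom g l * complex.Im (w ^+ l) * t ^+ l.

Let is_derive_S (z : nat -> R) g K t :
  is_derive t 1 (fun s => \sum_(l < K.+1) gbinom g l * z l * s ^+ l)
    (g * \sum_(l < K) gbinom (g - 1) l * z l.+1 * t ^+ l).
Proof.
apply: is_derive_eq.
  by apply: is_derive_sumf => l; apply: is_derive_scalef; exact: is_derive_exprf.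
rewrite big_ord_recl/= mul0r mulr0 add0r mulr_sumr; apply: eq_bigr => l _.
rewrite /bump/= add1n add0n.
rewrite [LHS](_ : _ = (l.+1%:R * gbinom g l.+1) * (z l.+1 * t ^+ l)); last by ring.
by rewrite gbinomS; ring.
Qed.

Let u0 g : u g 0 = 1 /\ v g 0 = 0.
Proof.
rewrite /u /v /L /A /x /y !mul0r atan0 mulr0 addr0 expr1n expr0n addr0 ln1.
by rewrite mul0r mulr0 expR0 cos0 sin0 mulr1 mulr0.
Qed.

(** At each integration [2 * dl] bounds the multiplication by [a + i b], and [expR 1] pays for
    passing from [expR G] to [expR (G + 1)]. *)
Let kappa : R := 2 * dl * expR 1.

(** Induction on the order, for all exponents at once: the remainder of order [K.+1] for [g] has
    derivative [g (a + i b)] times the remainder of order [K] for [g - 1]. *)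
Let remainder K g G : `|g| <= G -> forall t, 0 <= t <= 1 ->
  `|u g t - Su g K t| <= expR G * kappa ^+ K * gbinom_majorant G K * t ^+ K /\
  `|v g t - Sv g K t| <= expR G * kappa ^+ K * gbinom_majorant G K * t ^+ K.
Proof.
elim: K g G => [|K IH] g G gG t t01; have G0 : 0 <= G := le_trans (normr_ge0 _) gG.
  rewrite /Su /Sv !big_ord0 !subr0 !expr0 /gbinom_majorant big_ord0 fact0 divr1 !mulr1.
  have gL : expR (g * L t) <= expR G.
    rewrite ler_expR (le_trans (ler_norm _))// normrM -[leRHS]mulr1 ler_pM//.
    exact: L_le1.
  rewrite /u /v !normrM ![`|expR _|]ger0_norm ?expR_ge0//; split; rewrite -[leRHS]mulr1.
    by rewrite ler_pM// ?expR_ge0// ler_norml cos_geN1 cos_le1.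
  by rewrite ler_pM// ?expR_ge0// ler_norml sin_geN1 sin_le1.
have gG1 : `|g - 1| <= G + 1.
  by rewrite (le_trans (ler_normB _ _))// normr1 lerD2r.
have {}IH := IH _ _ gG1.
set B := expR (G + 1) * kappa ^+ K * gbinom_majorant (G + 1) K in IH.
have B0 : 0 <= B.
  apply: mulr_ge0; last by rewrite gbinom_majorant_ge0// addr_ge0.
  by rewrite mulr_ge0 ?expR_ge0// exprn_ge0// !mulr_ge0 ?expR_ge0.
have CE : expR G * kappa ^+ K.+1 * gbinom_majorant G K.+1 = (G * (2 * dl * B)) / K.+1%:R.
  by rewrite gbinom_majorantS /B expRD exprS /kappa; ring.
have step (p q c d s : R) : 0 <= s <= 1 -> `|c| <= dl -> `|d| <= dl ->
    `|p| <= B * s ^+ K -> `|q| <= B * s ^+ K ->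
    `|g * (c * p + d * q)| <= G * (2 * dl * B) * s ^+ K.
  move=> s01 c4 d4 pB qB; rewrite normrM -mulrA ler_pM//.
  rewrite (le_trans (ler_normD _ _))// !normrM.
  have := ler_pM (normr_ge0 _) (normr_ge0 _) c4 pB.
  have := ler_pM (normr_ge0 _) (normr_ge0 _) d4 qB.
  by move=> *; lra.
have sum0 (z : nat -> R) : \sum_(l < K.+1) gbinom g l * z l * 0 ^+ l = z 0%N.
  rewrite big_ord_recl/= gbinom0 mul1r mulr1 big1 ?addr0// => l _.
  by rewrite expr0n mulr0.
rewrite CE; split.
  apply: (@derivable_bound R (fun s => u g s - Su g K.+1 s)
    (fun s => g * (a * (u (g - 1) s - Su (g - 1) K s)
               + (- b) * (v (g - 1) s - Sv (g - 1) K s)))) => //.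
  - by rewrite /Su (sum0 (fun l => complex.Re (w ^+ l))) (u0 g).1 expr0 subrr.
  - move=> s s01; have [du _] := is_derive_uv g s01.
    apply: is_derive_eq (is_derive_subf du (is_derive_S (fun l => complex.Re (w ^+ l)) g K s)) _.
    rewrite -mulrBr; congr (g * _); rewrite /Su /Sv !mulrBr.
    rewrite (eq_bigr (fun l : 'I_K => a * (gbinom (g - 1) l * complex.Re (w ^+ l) * s ^+ l)
      - b * (gbinom (g - 1) l * complex.Im (w ^+ l) * s ^+ l))); last first.
      by move=> l _; rewrite exprS; case: (w ^+ l) => p q /=; ring.
    by rewrite sumrB -!mulr_sumr; ring.
  - by move=> s s01; have [h1 h2] := IH s s01; apply: step => //; rewrite normrN.
apply: (@derivable_bound R (fun s => v g s - Sv g K.+1 s)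
  (fun s => g * (a * (v (g - 1) s - Sv (g - 1) K s)
             + b * (u (g - 1) s - Su (g - 1) K s)))) => //.
- by rewrite /Sv (sum0 (fun l => complex.Im (w ^+ l))) (u0 g).2 expr0 subrr.
- move=> s s01; have [_ dv] := is_derive_uv g s01.
  apply: is_derive_eq (is_derive_subf dv (is_derive_S (fun l => complex.Im (w ^+ l)) g K s)) _.
  rewrite -mulrBr; congr (g * _); rewrite /Su /Sv !mulrBr.
  rewrite (eq_bigr (fun l : 'I_K => a * (gbinom (g - 1) l * complex.Im (w ^+ l) * s ^+ l)
    + b * (gbinom (g - 1) l * complex.Re (w ^+ l) * s ^+ l))); last first.
    by move=> l _; rewrite exprS; case: (w ^+ l) => p q /=; ring.
  by rewrite big_split -!mulr_sumr /=; ring.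
- by move=> s s01; have [h1 h2] := IH s s01; apply: step.
Qed.

(** As [1 + w] has positive real part, the arc cosine used by [carg], with its sign, agrees with the
    arctangent. *)
Let cpowE g : cpow (1 + w) g = (u g 1 +i* v g 1)%C.
Proof.
have t01 : 0 <= (1 : R) <= 1 by rewrite ler01 lexx.
have x0 := x_gt0 t01; have r0 := r2_gt0 t01; have [cE sE] := polar t01.
have -> : 1 + w = (x 1 +i* y 1)%C.
  by rewrite /w /x /y !mul1r; apply/eqP; rewrite eq_complex /= add0r !eqxx.
rewrite /cpow -(sqrt_r2 t01) /carg -(sqrt_r2 t01).
have -> : expR (L 1) `^ g = expR (g * L 1).
  by rewrite /powR gt_eqF ?expR_gt0// expRK.
suff -> : (if 0 <= y 1 then acos (x 1 / expR (L 1)) else - acos (x 1 / expR (L 1))) = A 1.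
  by [].
have -> : x 1 / expR (L 1) = cos (A 1).
  by rewrite -cE mulrAC divff ?mul1r// gt_eqF ?expR_gt0.
have Api : A 1 < pi by apply: lt_trans (atan_ltpi2 _) _; have := pi_gt0 R; lra.
have ANpi : - pi < A 1 by apply: lt_trans (atan_gtNpi2 _); have := pi_gt0 R; lra.
case: (leP 0 (y 1)) => y0.
  rewrite cosK// in_itv/= (ltW Api) andbT -[leLHS](atan0 R).
  by rewrite le_atan// divr_ge0// ltW.
rewrite cosKN ?opprK// (ltW ANpi)/= -[leRHS](atan0 R) le_atan//.
by rewrite mulr_le0_ge0 ?invr_ge0 ?ltW.
Qed.

Lemma binomial_series_remainder K g :
  let B := expR `|g| * (2 * dl * expR 1 * (`|g| + 1)) ^+ K in
  let r := cpow (1 + (a +i* b)%C) g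
           - \sum_(l < K) (gbinom g l)%:C%C * (a +i* b)%C ^+ l in
  `|complex.Re r| <= B /\ `|complex.Im r| <= B.
Proof.
move=> B r; have t01 : 0 <= (1 : R) <= 1 by rewrite ler01 lexx.
have [h1 h2] := remainder K (lexx `|g|) t01.
have le_B : expR `|g| * kappa ^+ K * gbinom_majorant `|g| K * 1 ^+ K <= B.
  rewrite expr1n mulr1 /B -/kappa [X in _ <= _ * X]exprMn -[leLHS]mulrA.
  apply: ler_wpM2l; first exact: expR_ge0.
  apply: ler_wpM2l.
    by rewrite exprn_ge0// !mulr_ge0 ?expR_ge0.
  exact: gbinom_majorant_le.
have rE : r = ((u g 1 - Su g K 1) +i* (v g 1 - Sv g K 1))%C.
  rewrite /r cpowE.
  have -> : \sum_(l < K) (gbinom g l)%:C%C * (a +i* b)%C ^+ l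
      = (Su g K 1 +i* Sv g K 1)%C.
    rewrite /Su /Sv; elim: K {h1 h2 le_B B r} => [|K IH]; first by rewrite !big_ord0.
    rewrite !big_ord_recr/= IH /w; case: (_ ^+ K) => p q.
    by apply/eqP; rewrite eq_complex /= !expr1n !mulr1 !mul0r subr0 addr0 !eqxx.
  by [].
by rewrite rE /=; split; apply: le_trans le_B.
Qed.

End BinomialSeries.

(** * Principal powers of matrices near the identity *)

Section MatrixPower.
Local Open Scope complex_scope.
Variable R : realType.
Local Notation C := R[i].
Local Notation Re := complex.Re.
Local Notation Im := complex.Im.

(** Convergence to 0 with an explicit rate is stable under linear combinations and spares limits of
    complex sequences; the rate 1/2 is what the smallness of [dl] below provides. *)
Definition geometric_null (z : nat -> C) : Prop :=
  exists B : R, forall K, `|z K| <= (B / 2 ^+ K)%:C%C.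

Lemma geometric_null0 : geometric_null (fun=> 0).
Proof. by exists 0 => K; rewrite mul0r normr0. Qed.

Lemma geometric_nullD y z : geometric_null y -> geometric_null z ->
  geometric_null (fun K => y K + z K).
Proof.
move=> [A yA] [B zB]; exists (A + B) => K.
by rewrite mulrDl rmorphD (le_trans (ler_normD _ _))// lerD.
Qed.

Lemma geometric_nullZ (c : C) z : geometric_null z ->
  geometric_null (fun K => c * z K).
Proof.
move=> [B zB]; exists (Num.sqrt (Re c ^+ 2 + Im c ^+ 2) * B) => K.
rewrite normrM -mulrA [_%:C%C]rmorphM normc_def; apply: ler_wpM2l => //.
by rewrite lecR sqrtr_ge0.
Qed.

Lemma geometric_null_sum (I : Type) (r : seq I) (z : I -> nat -> C) :
  (forall i, geometric_null (z i)) ->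
  geometric_null (fun K => \sum_(i <- r) z i K).
Proof.
move=> H; elim: r => [|i r IH].
  by under eq_fun do rewrite big_nil; exact: geometric_null0.
under eq_fun do rewrite big_cons; exact: geometric_nullD.
Qed.

Lemma geometric_null_le (x b : R) z : geometric_null z ->
  (forall K, (1 < K)%N -> x%:C%C <= `|z K| + b%:C%C) -> x <= b.
Proof.
move=> [B zB] xb; apply/ler_addgt0Pr => e e0.
have B0 : 0 <= B.
  have := le_trans (normr_ge0 _) (zB 0%N).
  by rewrite expr0 divr1 lecR.
pose K := (Num.bound (B / e)).+2.
have := le_trans (xb K isT) (lerD (zB K) (lexx _)).
rewrite -rmorphD lecR => /le_trans; apply; rewrite addrC lerD2l.
rewrite ler_pdivrMr ?exprn_gt0// mulrC -ler_pdivrMr//.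
apply: (@le_trans _ _ K%:R); last by rewrite -natrX ler_nat ltnW// ltn_expl.
have := archi_boundP (divr_ge0 B0 (ltW e0)) => /ltW/le_trans; apply.
by rewrite ler_nat /K -addn2 leq_addr.
Qed.

(** The position alone decides between the two cases, uniformly in the blocks; a difference of
    block-diagonal matrices is thus studied inside a single block. *)
Lemma mxdiag_entry m (d : 'I_m -> nat) (s t : 'I_(\sum_i d i)) :
  (forall X : forall i, 'M[C]_(d i), (\mxdiag_i X i) s t = 0) \/
  exists a (i j : 'I_(d a)),
    forall X : forall i, 'M[C]_(d i), (\mxdiag_i X i) s t = X a i j.
Proof.
have : forall X : forall i, 'M[C]_(d i), (\mxdiag_i X i) s t =
    (if tagnat.sig1 s == tagnat.sig1 t then conform_mx 0 (X (tagnat.sig1 s)) else 0)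
      (tagnat.sig2 s) (tagnat.sig2 t) by move=> X; rewrite !mxE.
rewrite /tagnat.sig1 /tagnat.sig2.
case: (tagnat.sig s) (tagnat.sig t) => [a i] [b j] /= H.
case: (eqVneq a b) j H => [<-|ab] j H; last by left => X; rewrite H mxE.
by right; exists a, i, j => X; rewrite H conform_mx_id.
Qed.

Lemma mxdiagM m (d : 'I_m -> nat) (X Y : forall i, 'M[C]_(d i)) :
  \mxdiag_i X i *m \mxdiag_i Y i = \mxdiag_i (X i *m Y i).
Proof.
rewrite /(mxdiag Y) mul_mxdiag_mxblock; apply/eq_mxblock => i j.
by case: eqVneq => [<-|]; rewrite ?conform_mx_id ?mulmx0.
Qed.

Lemma jordan_blockB1 m (l : C) :
  jordan_block m l - 1%:M = jordan_block m (l - 1).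
Proof.
apply/matrixP => i j; rewrite !mxE mulrnBl.
by rewrite [in RHS]addrAC -[1 *+ _]/(_%:R).
Qed.

Lemma jordan_block_expr m (w : C) l (i j : 'I_m) :
  (jordan_block m w ^+ l) i j =
  if (i <= j)%N then ('C(l, j - i))%:R * w ^+ (l - (j - i)) else 0.
Proof.
elim: l i j => [|l IH] i j.
  rewrite expr0 mxE; case: (ltngtP i j) => ij.
  - by rewrite bin0n subn_eq0 leqNgt ij mul0r -val_eqE /= ltn_eqF.
  - by rewrite -val_eqE /= gtn_eqF.
  - by rewrite ij subnn bin0 mul1r expr0 (val_inj ij) eqxx.
rewrite exprS -[_ * _]/(_ *m _) mul_jordan_block_row IH.
have {}IH (i' : 'I_m) : i' = i.+1 :> nat -> (jordan_block m w ^+ l) i' j =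
    if (i < j)%N then ('C(l, j - i.+1))%:R * w ^+ (l - (j - i.+1)) else 0.
  by move=> i'E; rewrite IH i'E.
have -> : (if insub i.+1 is Some i' then (jordan_block m w ^+ l) i' j else 0) =
    if (i < j)%N then ('C(l, j - i.+1))%:R * w ^+ (l - (j - i.+1)) else 0.
  case: insubP => [i' _ /IH//|im]; case: ifP => // ij.
  by move: im; rewrite (leq_ltn_trans ij).
case: (ltngtP i j) => ij; last first.
- by rewrite ij subnn !bin0 !subn0 addr0 mulrCA mul1r exprS mul1r.
- by rewrite mulr0 addr0.
have [dE] : exists d, (j - i = d.+1)%N by exists (j - i.+1)%N; lia.
move=> dij; have -> : (j - i.+1 = dE)%N by lia.
rewrite dij subSS binS natrD mulrDl; congr (_ + _).
have [ld|dl] := ltnP l dE.+1; first by rewrite bin_small// !mul0r mulr0.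
by rewrite mulrCA -exprS; congr (_ * _ ^+ _); lia.
Qed.

(** By [gbinom_add], the difference on the [d]-th superdiagonal is again a remainder of a binomial
    series, of exponent [g - d] and with [d] fewer terms. *)
Lemma jordan_block_pow_series m (w : C) (g : R) (i j : 'I_m) K :
  (jordan_block_pow m (1 + w) g - \sum_(l < K) (gbinom g l)%:C%C *: jordan_block m w ^+ l) i j =
  if (i <= j)%N then (gbinom g (j - i))%:C%C *
    (cpow (1 + w) (g - (j - i)%:R)
     - \sum_(l < K - (j - i)) (gbinom (g - (j - i)%:R) l)%:C%C * w ^+ l)
  else 0.
Proof.
rewrite mxE [jordan_block_pow _ _ _ i j]mxE [(- _ : 'M[C]_m) i j]mxE summxE.
have -> : \sum_(l < K) ((gbinom g l)%:C%C *: jordan_block m w ^+ l) i j =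
    \sum_(l < K) if (i <= j)%N then
      (gbinom g l)%:C%C * (('C(l, j - i))%:R * w ^+ (l - (j - i))) else 0.
  apply: eq_bigr => l _; rewrite mxE jordan_block_expr.
  by case: ifP => _; rewrite ?mulr0.
case: ifP => _; last by rewrite big1 ?subr0.
rewrite mulrBr; congr (_ - _); set d := (j - i)%N; rewrite mulr_sumr.
have [Kd|dK] := leqP K d.
  have -> : (K - d = 0)%N by apply/eqP.
  rewrite big_ord0 big1// => l _.
  by rewrite bin_small ?mul0r ?mulr0// (leq_trans (ltn_ord l)).
have -> : K = (d + (K - d))%N by rewrite subnKC// ltnW.
rewrite addKn big_split_ord /= big1 ?add0r.
  apply: eq_bigr => l _; rewrite addKn !mulrA; congr (_ * _).
  by rewrite -(rmorph_nat (real_complex R)) -!rmorphM -gbinom_add.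
by move=> l _; rewrite bin_small ?mul0r ?mulr0.
Qed.

Lemma normc_le_Re_Im (z : C) : `|z| <= (`|Re z| + `|Im z|)%:C%C.
Proof.
rewrite normc_def lecR -[leRHS]ger0_norm ?addr_ge0// -sqrtr_sqr ler_wsqrtr//.
rewrite sqrrD !real_normK ?num_real// lerD2r lerDl.
by rewrite mulrn_wge0// mulr_ge0.
Qed.

Lemma Re_Im_le_normc (z : C) (b : R) : `|z| <= b%:C%C ->
  `|Re z| <= b /\ `|Im z| <= b.
Proof.
rewrite normc_def lecR => zb; split; apply: le_trans zb; rewrite -sqrtr_sqr ler_wsqrtr//.
- by rewrite lerDl sqr_ge0.
- by rewrite lerDr sqr_ge0.
Qed.

(** The exponents that occur are [g - d] with [d < m <= N], hence of modulus at most that of [g]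
    plus [N]; this dictates how small [dl] must be. *)
Lemma geometric_null_jordan_block m (w : C) (g dl : R) (i j : 'I_m) N :
  (m <= N)%N -> `|w| <= dl%:C%C -> dl <= 1 / 4 ->
  2 * dl * expR 1 * (`|g| + N%:R + 1) <= 1 / 2 ->
  geometric_null (fun K => (jordan_block_pow m (1 + w) g
    - \sum_(l < K) (gbinom g l)%:C%C *: jordan_block m w ^+ l) i j).
Proof.
move=> mN /Re_Im_le_normc[aw bw] dl4 small.
under eq_fun do rewrite jordan_block_pow_series.
case: leqP => [ij|_]; last exact: geometric_null0.
apply: geometric_nullZ; set d := (j - i)%N; set h := g - d%:R.
have dl0 : 0 <= dl := le_trans (normr_ge0 _) aw.
exists (2 * expR `|h| * 2 ^+ d) => K.
have [] := binomial_series_remainder aw bw dl4 (K - d) h.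
rewrite (_ : (Re w +i* Im w)%C = w); last by case: (w).
set r := _ - _ => r1 r2; rewrite (le_trans (normc_le_Re_Im _))// lecR.
set X := (_ ^+ (K - d)) in r1 r2.
apply: le_trans (lerD r1 r2) _; rewrite (_ : _ + _ = 2 * (expR `|h| * X)); last by ring.
rewrite -!mulrA ler_wpM2l// ler_wpM2l ?expR_ge0//.
apply: (@le_trans _ _ ((1 / 2) ^+ (K - d))).
  rewrite lerXn2r ?nnegrE ?mulr_ge0 ?expR_ge0 ?addr_ge0//.
  apply: le_trans small; rewrite ler_wpM2l ?mulr_ge0 ?expR_ge0// lerD2r.
  rewrite /h (le_trans (ler_normB _ _))// lerD2l ger0_norm// ler_nat.
  by rewrite /d (leq_trans (leq_subr _ _))// (leq_trans (ltnW (ltn_ord j))).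
rewrite div1r exprVn ler_pdivlMr ?exprn_gt0// mulrC ler_pdivrMr ?exprn_gt0//.
by rewrite -exprD ler_weXn2l ?ler1n// -leq_subLR.
Qed.

Section PowerSeries.
Variables (N : nat) (g dl : R) (E F : 'M[C]_N).
Hypotheses (EF : is_mxpow (1%:M + E) g F) (Edl : mnorm E <= dl%:C%C).
Hypotheses (dl4 : dl <= 1 / 4).
Hypothesis small : 2 * dl * expR 1 * (`|g| + N%:R + 1) <= 1 / 2.

(** Whatever Jordan form was used to build [F], it is the sum of a series in [E] that no longer
    mentions it. *)
Lemma is_mxpow_series (i j : 'I_N) : geometric_null (fun K =>
  (F - \sum_(l < K) (gbinom g l)%:C%C *: E ^+ l) i j).
Proof.
have [m [d [lam [P [Q [PQ QP BE FE]]]]]] := EF.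
pose w a := lam a - 1.
have EE : E = P *m (\mxdiag_(a < m) jordan_block (d a) (w a)) *m Q.
  have -> : \mxdiag_(a < m) jordan_block (d a) (w a) =
      \mxdiag_(a < m) jordan_block (d a) (lam a) - 1%:M.
    rewrite -(mxdiagZ 1) -mxdiagB; apply/eq_mxdiag => a.
    by rewrite jordan_blockB1.
  by rewrite mulmxBr mulmx1 mulmxBl -BE PQ addrC addKr.
have El l : E ^+ l = P *m (\mxdiag_(a < m) jordan_block (d a) (w a) ^+ l) *m Q.
  elim: l => [|l IH].
    rewrite !expr0; under eq_mxdiag do rewrite expr0.
    by rewrite mxdiagZ mulmx1 PQ.
  rewrite exprS -[_ * _]/(_ *m _) IH {1}EE.
  have -> : \mxdiag_(a < m) jordan_block (d a) (w a) ^+ l.+1 =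
      \mxdiag_(a < m) jordan_block (d a) (w a)
      *m \mxdiag_(a < m) jordan_block (d a) (w a) ^+ l.
    by rewrite mxdiagM; apply/eq_mxdiag => a; rewrite exprS.
  by rewrite !mulmxA -[P *m _ *m Q *m P]mulmxA QP mulmx1.
have dN a : (d a <= N)%N.
  rewrite (leq_trans _ (mulmx1_min QP))//.
  by rewrite (bigD1 a)//= leq_addr.
(* The last row of a Jordan block yields a left eigenvector of [E], nonzero because [Q] is
   invertible; so the eigenvalue is bounded by the norm of [E]. *)
have wdl a : (0 < d a)%N -> `|w a| <= dl%:C%C.
  move=> da; have da1 : ((d a).-1 < d a)%N by rewrite prednK.
  pose r := Ordinal da1; pose q := row r (submxcol Q a).
  have qE : q *m E = w a *: q.
    have QE : Q *m E = \mxdiag_(a < m) jordan_block (d a) (w a) *m Q.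
      by rewrite EE !mulmxA QP mul1mx.
    have : submxcol (Q *m E) a = jordan_block (d a) (w a) *m submxcol Q a.
      by rewrite QE -{1}[Q]submxcolK mul_mxdiag_mxcol mxcolK.
    rewrite -submxcol_mul => h; rewrite /q -row_mul h; apply/matrixP => x y.
    rewrite mxE mul_jordan_block_row !mxE.
    case: insubP => [r' |_]; last by rewrite addr0.
    by rewrite /= prednK// ltnn.
  have q0 : mnorm q != 0.
    apply/eqP => q0; have qz : q = 0.
      apply/matrixP => x y; apply/eqP.
      by rewrite [X in _ == X]mxE -normr_le0 -q0 mnorm_coord.
    have : row r (submxcol (Q *m P) a) = 0.
      by rewrite -submxcol_mul row_mul -/q qz mul0mx.
    rewrite QP => /matrixP/(_ 0 (tagnat.Rank a r)).
    by rewrite !mxE eqxx => /eqP; rewrite oner_eq0.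
  rewrite (le_trans _ Edl)//.
  have qp : 0 < mnorm q by rewrite lt0r q0 mnorm_ge0.
  by rewrite -(ler_pM2r qp) -mnormZ -qE mulrC mnormM.
have diff K : F - \sum_(l < K) (gbinom g l)%:C%C *: E ^+ l =
    P *m (\mxdiag_(a < m) (jordan_block_pow (d a) (1 + w a) g
      - \sum_(l < K) (gbinom g l)%:C%C *: jordan_block (d a) (w a) ^+ l)) *m Q.
  rewrite mxdiagB mulmxBr mulmxBl; congr (_ - _).
    rewrite FE; congr (_ *m _ *m _); apply/eq_mxdiag => a.
    by rewrite /w addrC subrK.
  rewrite mxdiag_sum mulmx_sumr mulmx_suml; apply: eq_bigr => l _.
  rewrite El scalemxAl scalemxAr; congr (_ *m _ *m _).
  rewrite -mul_scalar_mx -mxdiagZ mxdiagM; apply/eq_mxdiag => a.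
  by rewrite mul_scalar_mx.
under eq_fun do rewrite diff mxE.
apply: geometric_null_sum => t; under eq_fun do rewrite mulrC.
apply: geometric_nullZ; under eq_fun do rewrite mxE.
apply: geometric_null_sum => s; apply: geometric_nullZ.
have [H|[a [x [y H]]]] := mxdiag_entry s t.
  by under eq_fun do rewrite H; exact: geometric_null0.
under eq_fun do rewrite H; apply: (geometric_null_jordan_block _ _ (dN a) _ dl4 small).
by apply: wdl; exact: leq_ltn_trans (ltn_ord x).
Qed.

(** What remains is the series from its quadratic term on. For [g] between 0 and 1 its coefficients
    have modulus at most 1, and the geometric sum is at most 2. *)
Lemma is_mxpow_linearization (i j : 'I_N) : 0 <= g <= 1 -> dl <= 1 / 2 ->
  `|(F - 1%:M - g%:C%C *: E) i j| <= (2 * dl ^+ 2)%:C%C.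
Proof.
move=> g01 dl2; set x := _ i j.
have dl0 : 0 <= dl by rewrite -lecR (le_trans (mnorm_ge0 E)).
have xE K : (1 < K)%N -> x = (F - \sum_(l < K) (gbinom g l)%:C%C *: E ^+ l) i j
    + \sum_(l < K.-2) ((gbinom g l.+2)%:C%C *: E ^+ l.+2) i j.
  case: K => [|[|K]] // _; rewrite /x !big_ord_recl /= gbinom0 gbinom1.
  rewrite expr0 scale1r expr1 -summxE; set S := \sum_(l < K) _.
  transitivity ((F - (1%:M + (g%:C%C *: E + S)) + S) i j); last by rewrite mxE.
  by rewrite !opprD !addrA subrK.
have El l : mnorm (E ^+ l.+1) <= (dl ^+ l.+1)%:C%C.
  elim: l => [|l IH]; first by rewrite !expr1.
  rewrite exprS -[_ * _]/(_ *m _) (le_trans (mnormM _ _))// [in leRHS]exprS rmorphM.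
  by rewrite ler_pM// mnorm_ge0.
have geo K : \sum_(l < K) dl ^+ l <= 2.
  elim: K => [|K IH]; first by rewrite big_ord0.
  rewrite big_ord_recl expr0.
  have -> : \sum_(i < K) dl ^+ lift ord0 i = dl * \sum_(i < K) dl ^+ i.
    by rewrite mulr_sumr; apply: eq_bigr => l _; rewrite exprS.
  have s0 : 0 <= \sum_(i < K) dl ^+ i by rewrite sumr_ge0// => l _; rewrite exprn_ge0.
  by nra.
have [b xb] : exists b : R, `|x| = b%:C%C by eexists; exact: normc_def.
rewrite xb lecR; apply: (geometric_null_le (is_mxpow_series i j)) => K K1.
rewrite -xb (xE K K1) (le_trans (ler_normD _ _))// lerD2l.
rewrite (le_trans (ler_norm_sum _ _ _))//.
apply: (@le_trans _ _ (\sum_(l < K.-2) (dl ^+ 2 * dl ^+ l))%:C%C).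
  rewrite rmorph_sum; apply: ler_sum => l _.
  rewrite mxE normrM -exprD add2n -[leRHS]mul1r ler_pM//; last first.
    by rewrite (le_trans (mnorm_coord _ i j)).
  by rewrite normc_def /= expr0n addr0 sqrtr_sqr lecR gbinom_le1.
by rewrite lecR -mulr_sumr mulrC ler_wpM2r// exprn_ge0.
Qed.

End PowerSeries.

Lemma is_mxpow_exists N (B : 'M[C]_N) (g : R) : is_mxpow B g (mxpow B g).
Proof.
apply: (xgetPex 0 (P := [set F | is_mxpow B g F])).
have [m [d [l [P [Q [PQ QP BE]]]]]] := jordan_form B.
exists (P *m (\mxdiag_(i < m) jordan_block_pow (d i) (l i) g) *m Q).
by exists m, d, l, P, Q.
Qed.

Lemma mxpow_linearization N (g : R) : 0 <= g <= 1 -> exists2 dl : R, 0 < dl &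
  forall (E : 'M[R]_N) (i j : 'I_N), mnorm E <= dl ->
  let x := mxpow (map_mx (real_complex R) (1%:M + E)) g i j in
  `|Re x - (i == j)%:R - g * E i j| <= 2 * mnorm E ^+ 2 /\
  `|Im x| <= 2 * mnorm E ^+ 2.
Proof.
move=> g01; have D0 : 0 < 4 * expR 1 * (`|g| + N%:R + 1) :> R.
  by rewrite !mulr_gt0 ?expR_gt0// ltr_wpDl// addr_ge0.
(* At this radius the ratio required by [geometric_null_jordan_block] is exactly 1/2; the radius is
   below 1/4 because [expR 1 >= 1]. *)
exists (4 * expR 1 * (`|g| + N%:R + 1))^-1; first by rewrite invr_gt0.
move=> E i j Edl /=; set r := map_mx _ (1%:M + E).
set x := mxpow r g i j.
have rE : r = 1%:M + map_mx (real_complex R) E by rewrite /r map_mxD map_mx1.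
have nE : mnorm (map_mx (real_complex R) E) = (mnorm E)%:C%C.
  rewrite /mnorm rmorph_sum; apply: eq_bigr => a _.
  rewrite rmorph_sum; apply: eq_bigr => b _; rewrite mxE.
  by rewrite normc_def /= expr0n addr0 sqrtr_sqr.
have e1 : 1 <= expR 1 :> R by rewrite (le_trans _ (expR_ge1Dx _))// lerDl.
have h1 : 2 * mnorm E * expR 1 * (`|g| + N%:R + 1) <= 1 / 2.
  rewrite -(ler_pM2r D0) mulVf ?gt_eqF// in Edl.
  by move: Edl; rewrite !mulrA; lra.
have h2 : mnorm E <= 1 / 4.
  have : mnorm E * 1 <= mnorm E * (expR 1 * (`|g| + N%:R + 1)).
    rewrite ler_wpM2l ?mnorm_ge0// -[leLHS]mulr1 ler_pM//.
    by rewrite lerDr addr_ge0.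
  by move: h1; lra.
have := is_mxpow_exists (1%:M + map_mx (real_complex R) E) g.
rewrite -rE => pE; rewrite rE in pE.
have := @is_mxpow_linearization N g (mnorm E) (map_mx (real_complex R) E) _ pE.
rewrite nE => /(_ (lexx _) h2 h1 i j g01).
have -> : mnorm E <= 1 / 2 by lra.
move=> /(_ isT)/Re_Im_le_normc.
rewrite -rE !mxE -/x.
have -> : ((i == j)%:R : C) = ((i == j)%:R : R)%:C%C by case: (i == j).
rewrite (_ : Re (x - _ - _) = Re x - (i == j)%:R - g * E i j); last first.
  by case: (x) => a b /=; ring.
by rewrite (_ : Im (x - _ - _) = Im x)//; case: (x) => a b /=; ring.
Qed.

End MatrixPower.

(** * Additive compounds of non-integer order *)

Section QuadraticError.
Variable R : realType.
Implicit Types (F G : R -> R) (c l : R).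

Definition quadratic_error F c l : Prop := exists C d : R,
  [/\ 0 <= C, 0 < d & forall e, `|e| <= d -> `|F e - c - e * l| <= C * e ^+ 2].

Lemma quadratic_error_derive1 F c l : quadratic_error F c l -> derive1 F 0 = l.
Proof. by move=> [C [d [C0 d0 H]]]; exact: derive1_of_quadratic_error d0 C0 H. Qed.

Lemma quadratic_errorB F G c c' l l' : quadratic_error F c l ->
  quadratic_error G c' l' -> quadratic_error (fun e => F e - G e) (c - c') (l - l').
Proof.
move=> [A [d [A0 d0 FA]]] [B [d' [B0 d'0 GB]]].
exists (A + B), (Num.min d d'); split; [exact: addr_ge0|by rewrite lt_min d0|].
move=> e; rewrite le_min => /andP[ed ed'].
rewrite (_ : _ - _ - _ = (F e - c - e * l) - (G e - c' - e * l')); last by ring.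
by rewrite mulrDl (le_trans (ler_normB _ _))// lerD ?FA ?GB.
Qed.

Lemma quadratic_errorM F G c c' l l' : quadratic_error F c l ->
  quadratic_error G c' l' ->
  quadratic_error (fun e => F e * G e) (c * c') (c' * l + c * l').
Proof.
move=> [A [d [A0 d0 FA]]] [B [d' [B0 d'0 GB]]].
exists (A * (`|c'| + `|l'| + B) + `|l| * (`|l'| + B) + `|c| * B).
exists (Num.min 1 (Num.min d d')); split.
- by rewrite !(addr_ge0, mulr_ge0).
- by rewrite !lt_min ltr01 d0.
move=> e; rewrite !le_min => /and3P[e1 ed ed'].
have rA := FA e ed; have rB := GB e ed'.
have ee : e ^+ 2 <= `|e| by rewrite -real_normK ?num_real// expr2 ler_piMl.
set r := F e - c - e * l in rA; set r' := G e - c' - e * l' in rB.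
have FE : F e = c + e * l + r by rewrite /r; ring.
have GE : G e = c' + e * l' + r' by rewrite /r'; ring.
rewrite (_ : _ - _ = r * G e + (e * l) * (e * l' + r') + c * r'); last first.
  by rewrite FE GE; ring.
have rB1 : `|e * l' + r'| <= (`|l'| + B) * `|e|.
  rewrite (le_trans (ler_normD _ _))// normrM mulrDl mulrC lerD// (le_trans rB)//.
  by rewrite ler_wpM2l.
have GB1 : `|G e| <= `|c'| + `|l'| + B.
  rewrite GE -addrA (le_trans (ler_normD _ _))// -addrA lerD2l (le_trans rB1)//.
  by rewrite ler_piMr// addr_ge0.
rewrite (le_trans (ler_normD _ _))// [leRHS]mulrDl lerD//; last first.
  by rewrite normrM -mulrA ler_wpM2l.
rewrite (le_trans (ler_normD _ _))// [leRHS]mulrDl lerD//.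
  by rewrite normrM mulrAC ler_pM.
rewrite !normrM -(real_normK (num_real e)) expr2.
rewrite (_ : _ * (`|e| * `|e|) = `|e| * `|l| * ((`|l'| + B) * `|e|)); last by ring.
by rewrite ler_wpM2l// mulr_ge0.
Qed.

End QuadraticError.

Section AlphaCompound.
Variable R : realType.
Local Notation Re := complex.Re.
Local Notation Im := complex.Im.

(** Composition of two expansions, of the compound in [e] and of the power around the identity. The
    imaginary part has no first-order term. *)
Lemma mxpow_mcompound_quadratic n k (A : 'M[R]_n) (g : R) (i j : 'I_('C(n, k))) :
  0 <= g <= 1 ->
  let x e := mxpow (map_mx (real_complex R) (mcompound k (1%:M + e *: A))) g i j in
  quadratic_error (fun e => Re (x e)) (i == j)%:R (g * acompound k A i j) /\
  quadratic_error (fun e => Im (x e)) 0 0.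
Proof.
move=> /andP[g0 g1] x.
have [|dl dl0 H] := @mxpow_linearization R ('C(n, k)) g; first by rewrite g0.
have [C C0 HC] := mcompound_linearization R n k.
pose a := mnorm A; have a0 : 0 <= a := mnorm_ge0 A.
pose b := mnorm (acompound k A); have b0 : 0 <= b := mnorm_ge0 (acompound k A).
pose M := b + C * a ^+ 2.
have M0 : 0 <= M by rewrite addr_ge0// mulr_ge0// exprn_ge0.
pose d := Num.min 1 (Num.min (a + 1)^-1 (dl / (M + 1))).
have d0 : 0 < d.
  by rewrite !lt_min ltr01 invr_gt0 divr_gt0 ?ltr_wpDl.
pose E e := mcompound k (1%:M + e *: A) - 1%:M.
have key e : `|e| <= d -> [/\ mnorm (E e) <= dl,
    mnorm (E e - e *: acompound k A) <= C * a ^+ 2 * e ^+ 2 &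
    mnorm (E e) ^+ 2 <= M ^+ 2 * e ^+ 2].
  rewrite !le_min => /and3P[e1 ea eM].
  have ea1 : mnorm (e *: A) <= 1.
    rewrite mnormZ (le_trans (ler_wpM2r (mnorm_ge0 _) ea))//.
    by rewrite ler_pdivrMl ?ltr_wpDl// mulr1 lerDl.
  have h2 : mnorm (E e - e *: acompound k A) <= C * a ^+ 2 * e ^+ 2.
    have := HC _ ea1; rewrite acompoundZ -/(E e) mnormZ => /le_trans; apply.
    by rewrite exprMn real_normK ?num_real// -mulrA [_ * e ^+ 2]mulrC.
  have h3 : mnorm (E e) <= M * `|e|.
    rewrite -[E e](subrK (e *: acompound k A)) (le_trans (mnormD _ _))//.
    rewrite mnormZ -/b /M mulrDl addrC mulrC lerD// (le_trans h2)//.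
    rewrite ler_wpM2l ?mulr_ge0 ?exprn_ge0// -real_normK ?num_real// expr2.
    by rewrite ler_piMl.
  split=> //.
    rewrite (le_trans h3)// (le_trans (ler_wpM2l M0 eM))//.
    rewrite mulrCA ler_piMr ?(ltW dl0)// ler_pdivrMr ?ltr_wpDl// mul1r lerDl.
    exact: ler01.
  by rewrite -[e ^+ 2]real_normK ?num_real// -exprMn lerXn2r ?nnegrE ?mnorm_ge0 ?mulr_ge0.
have EE e : 1%:M + E e = mcompound k (1%:M + e *: A) by rewrite addrC subrK.
split.
  exists (2 * M ^+ 2 + C * a ^+ 2), d; split=> //.
    by rewrite addr_ge0 ?mulr_ge0 ?exprn_ge0.
  move=> e ed; have [Edl Ea EM] := key e ed.
  have [h1 _] := H (E e) i j Edl; rewrite EE -/(x e) in h1.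
  rewrite (_ : _ - _ = (Re (x e) - (i == j)%:R - g * E e i j)
      + g * (E e - e *: acompound k A) i j); last first.
    by move: (E e) (acompound k A) => X Y; rewrite !mxE; ring.
  rewrite (le_trans (ler_normD _ _))// mulrDl lerD//.
    by rewrite (le_trans h1)// -mulrA ler_wpM2l.
  rewrite normrM (ger0_norm g0) -[leRHS]mul1r; apply: ler_pM => //.
  by apply: le_trans Ea; exact: mnorm_coord.
exists (2 * M ^+ 2), d; split=> //; first by rewrite mulr_ge0 ?exprn_ge0.
move=> e ed; have [Edl _ EM] := key e ed.
have [_ h1] := H (E e) i j Edl; rewrite EE -/(x e) in h1.
by rewrite mulr0 !subr0 (le_trans h1)// -mulrA ler_wpM2l.
Qed.

Definition kronecker_compound n k (s : R) (A : 'M[R]_n) :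
    'M[R]_('C(n, k) * 'C(n, k.+1)) :=
  tensmx ((1 - s) *: acompound k A) 1%:M + tensmx 1%:M (s *: acompound k.+1 A).

(** The matrix size depends on the boolean [s == 0], so that boolean is destructed everywhere at
    once, with a record of its value. *)
Lemma lp_measure_alpha0 n k (p : \bar R) (A : 'M[R]_n) :
  lp_measure p (alpha_acompound k 0 A) = lp_measure p (acompound k A).
Proof. by rewrite /alpha_acompound; have := eqxx (0 : R); case: (_ == _). Qed.

(** The real part of a product is the product of the real parts minus that of the imaginary parts.
    The latter are quadratically small, so the product rule for the real parts gives the
    derivative. *)
Lemma lp_measure_alphaN0 n k (s : R) (p : \bar R) (A : 'M[R]_n) : 0 < s -> s < 1 ->
  lp_measure p (alpha_acompound k s A) = lp_measure p (kronecker_compound k s A).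
Proof.
move=> s0 s1; rewrite /alpha_acompound; have := gt_eqF s0.
case: (_ == _) => h; first by discriminate h.
congr lp_measure; apply/matrixP => i j.
case: (mxtens_indexP i) => i1 i2; case: (mxtens_indexP j) => j1 j2.
rewrite mxE.
have [|x1 y1] := @mxpow_mcompound_quadratic n k A (1 - s) i1 j1.
  by apply/andP; split; lra.
have [|x2 y2] := @mxpow_mcompound_quadratic n k.+1 A s i2 j2.
  by apply/andP; split; lra.
have := quadratic_errorB (quadratic_errorM x1 x2) (quadratic_errorM y1 y2).
move=> /quadratic_error_derive1 D.
transitivity ((i2 == j2)%:R * ((1 - s) * acompound k A i1 j1)
  + (i1 == j1)%:R * (s * acompound k.+1 A i2 j2) - (0 * 0 + 0 * 0)); last first.
  by rewrite [RHS]mxE !tensmxE !mxE; ring.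
rewrite -D; congr (derive1 _ 0); apply/funext => e.
rewrite /alpha_mcompound tensmxE.
by case: (mxpow _ _ i1 j1) => ? ?; case: (mxpow _ _ i2 j2).
Qed.

Lemma lp_measure_alpha_ge n k (s : R) (p : \bar R) (A : 'M[R]_n) :
  (1 <= p)%E -> 0 <= s -> s < 1 -> (k < n)%N ->
  (1 - s) * lp_measure p (acompound k A) + s * lp_measure p (acompound k.+1 A)
  <= lp_measure p (alpha_acompound k s A).
Proof.
move=> p1 s0 s1 kn; have [->|/eqP sn0] := pselect (s = 0).
  by rewrite lp_measure_alpha0 subr0 mul1r mul0r addr0.
have sp : 0 < s by rewrite lt0r sn0.
have C0 : (0 < 'C(n, k))%N by rewrite bin_gt0 ltnW.
have C1 : (0 < 'C(n, k.+1))%N by rewrite bin_gt0.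
rewrite lp_measure_alphaN0//.
apply: le_trans (lp_measure_tensD p1 _ _ C0 C1); apply: lerD.
  by rewrite lp_measureZ_ge// subr_gt0.
exact: lp_measureZ_ge.
Qed.

(** Makes the measure continuous in time along a trajectory, hence integrable. *)
Lemma lp_measure_alpha_lip n k (s : R) (p : \bar R) : (1 <= p)%E ->
  0 <= s -> s < 1 -> (k < n)%N -> exists2 C : R, 0 <= C & forall A B : 'M[R]_n,
    lp_measure p (alpha_acompound k s A) <=
    lp_measure p (alpha_acompound k s B) + C * mnorm (A - B).
Proof.
move=> p1 s0 s1 kn.
have C0 : (0 < 'C(n, k))%N by rewrite bin_gt0 ltnW.
have C1 : (0 < 'C(n, k.+1))%N by rewrite bin_gt0.
have [D D0 HD] := acompound_bounded R n k.
have [D' D'0 HD'] := acompound_bounded R n k.+1.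
have [->|/eqP sn0] := pselect (s = 0).
  exists D => [//|A B].
  rewrite [leLHS]lp_measure_alpha0 [X in _ <= X + _]lp_measure_alpha0.
  rewrite (le_trans (lp_measure_lip p1 _ (acompound k B) C0))// lerD2l.
  by rewrite -acompoundB (le_trans (lp_mxnorm_mnorm p1 _)).
have sp : 0 < s by rewrite lt0r sn0.
pose N1 := mnorm (1%:M : 'M[R]_('C(n, k))).
pose N2 := mnorm (1%:M : 'M[R]_('C(n, k.+1))).
have mnorm_tens a b (X : 'M[R]_a) (Y : 'M[R]_b) :
    mnorm (tensmx X Y) = mnorm X * mnorm Y.
  rewrite /mnorm mulr_sum; apply: eq_bigr => i _.
  rewrite mulr_sum; apply: eq_bigr => j _.
  by rewrite mxE normrM.
exists ((1 - s) * D * N2 + s * D' * N1).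
  have s1' : 0 <= 1 - s by rewrite subr_ge0 ltW.
  by rewrite addr_ge0// !mulr_ge0// mnorm_ge0.
move=> A B; rewrite [leLHS](lp_measure_alphaN0 _ _ _ sp s1).
rewrite [X in _ <= X + _](lp_measure_alphaN0 _ _ _ sp s1).
rewrite (le_trans (lp_measure_lip p1 _ (kronecker_compound k s B) _))//.
  by rewrite muln_gt0 C0.
rewrite lerD2l (le_trans (lp_mxnorm_mnorm p1 _))//.
have -> : kronecker_compound k s A - kronecker_compound k s B =
    kronecker_compound k s (A - B).
  rewrite /kronecker_compound !acompoundB.
  move: (acompound k A) (acompound k B) (acompound k.+1 A) (acompound k.+1 B).
  by move=> X Y X' Y'; apply/matrixP => i j; rewrite !mxE; ring.
rewrite (le_trans (mnormD _ _))// !mnorm_tens !mnormZ.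
rewrite (ger0_norm s0) (@ger0_norm _ (1 - s)) ?subr_ge0 ?(ltW s1)// -/N1 -/N2.
have s1' : 0 <= 1 - s by rewrite subr_ge0 ltW.
rewrite [leRHS](_ : _ = (1 - s) * (D * mnorm (A - B)) * N2
  + N1 * (s * (D' * mnorm (A - B)))); last by ring.
by apply: lerD; [apply: ler_wpM2r; rewrite ?mnorm_ge0//
  |apply: ler_wpM2l; rewrite ?mnorm_ge0//]; rewrite ler_wpM2l.
Qed.

End AlphaCompound.

(** * Covering numbers and Hausdorff dimension *)

Section Pivoting.
Variable R : realType.

Definition fcons k (T : Type) (a : T) (f : 'I_k -> T) (q : 'I_k.+1) : T :=
  if unlift ord0 q is Some q' then f q' else a.

Lemma fcons0 k T (a : T) (f : 'I_k -> T) : fcons a f ord0 = a.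
Proof. by rewrite /fcons unlift_none. Qed.

Lemma fconsS k T (a : T) (f : 'I_k -> T) q : fcons a f (lift ord0 q) = f q.
Proof. by rewrite /fcons liftK. Qed.

(** A pivot times a minor of its Schur complement is a minor of [W]; by induction, products of
    pivots are minors of [W]. *)
Lemma det_schur_complement n k (W : 'M[R]_n) (i0 j0 : 'I_n) (f g : 'I_k -> 'I_n) :
  W i0 j0 != 0 ->
  \det (mxsub (fcons i0 f) (fcons j0 g) W) = W i0 j0 *
  \det (mxsub f g (\matrix_(i, j) (W i j - W i j0 * W i0 j / W i0 j0))).
Proof.
move=> c0; set c := W i0 j0.
pose v : 'M[R]_(k, 1) := \matrix_(i, j) (W (f i) j0 / c).
pose w : 'M[R]_(1, k) := \matrix_(i, j) W i0 (g j).
set S := mxsub f g _.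
have lS (q : 'I_1) : lshift k q = ord0 by apply: val_inj; rewrite /= ord1.
have rS (q : 'I_k) : rshift 1 q = lift ord0 q by apply: val_inj.
have -> : mxsub (fcons i0 f) (fcons j0 g) W =
    block_mx 1%:M 0 v 1%:M *m block_mx c%:M w 0 S :> 'M[R]_(1 + k).
  rewrite mulmx_block !mul1mx !mul0mx !addr0.
  apply/matrixP => i j; case: (split_ordP i) => q ->; case: (split_ordP j) => r ->.
  - by rewrite block_mxEul !mxE !lS !fcons0 !ord1 eqxx mulr1n.
  - by rewrite block_mxEur !mxE lS rS fcons0 fconsS.
  - rewrite block_mxEdl !mxE big_ord1 !mxE lS rS fcons0 fconsS !ord1 eqxx mulr1n.
    by rewrite divfK.
  - rewrite block_mxEdr !mxE big_ord1 !mxE !rS !fconsS.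
    by rewrite mulrAC addrCA subrr addr0.
transitivity (\det (block_mx 1%:M 0 v 1%:M : 'M[R]_(1 + k))
  * \det (block_mx c%:M w 0 S : 'M[R]_(1 + k))); first exact: det_mulmx.
by rewrite (det_lblock 1%:M v 1%:M) (det_ublock c%:M w S) !det1 det_scalar1 !mul1r.
Qed.

(* Gaussian elimination with complete pivoting: the pivots play the role of the
   first singular values up to constants, as the products of pivots are minors
   and each pivot is at most twice the previous one. *)
Lemma complete_pivoting n k (W : 'M[R]_n) : (0 < n)%N ->
  exists (d : 'I_k -> R) (l u : 'I_k -> 'I_n -> R) (E : 'M[R]_n) (e : R),
  [/\ forall q, 0 <= d q, forall q i, `|l q i| <= 1 /\ `|u q i| <= 1,
      forall i j, W i j = \sum_q d q * l q i * u q j + E i j,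
      forall i j, `|E i j| <= e &
  [/\ forall q, e <= 2 ^+ k * d q,
      forall m, (forall i j, `|W i j| <= m) ->
        e <= 2 ^+ k * m /\ forall q, d q <= 2 ^+ k * m,
      exists f g, \prod_q d q <= `|\det (mxsub f g W : 'M[R]_k)| &
      exists f g, (\prod_q d q) * e <= `|\det (mxsub f g W : 'M[R]_k.+1)| ]].
Proof.
move=> n0; elim: k W => [|k IH] W.
all: pose x0 : 'I_n * 'I_n := (Ordinal n0, Ordinal n0).
all: have [[i0 j0] _ /(_ (_, _) isT)/= max] :=
  @arg_maxP _ R _ x0 xpredT (fun x : 'I_n * 'I_n => `|W x.1 x.2|) isT.
  exists (fun=> 0), (fun=> fun=> 0), (fun=> fun=> 0), W, `|W i0 j0|.
  split=> //.
  - by case.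
  - by move=> i j; rewrite big_ord0 add0r.
  split=> //.
  - by case.
  - by move=> m Wm; split; [rewrite expr0 mul1r|case].
  - exists (fun=> i0), (fun=> j0); rewrite big_ord0.
    by rewrite det_mx00 normr1.
  exists (fun=> i0), (fun=> j0).
  by rewrite big_ord0 mul1r det_mx11 mxE.
have {}max i j : `|W i j| <= `|W i0 j0| by exact: max.
have [c0|c0] := eqVneq (W i0 j0) 0.
  have W0 i j : W i j = 0.
    by apply/eqP; rewrite -normr_le0 (le_trans (max i j))// c0 normr0.
  exists (fun=> 0), (fun=> fun=> 0), (fun=> fun=> 0), 0, 0; split=> //.
  - by move=> q i; rewrite normr0.
  - by move=> i j; rewrite mxE W0 big1 ?addr0// => q _; rewrite !mul0r.
  - by move=> i j; rewrite mxE normr0.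
  split=> //.
  - move=> m Wm; have m0 : 0 <= m := le_trans (normr_ge0 _) (Wm i0 j0).
    by split=> [|q]; rewrite mulr_ge0// exprn_ge0.
  - by exists (fun=> i0), (fun=> j0); rewrite big_ord_recl mul0r.
  - by exists (fun=> i0), (fun=> j0); rewrite mulr0.
set c := W i0 j0 in max c0 *; have cp : 0 < `|c| by rewrite normr_gt0.
pose S := \matrix_(i, j) (W i j - W i j0 * W i0 j / c).
(* The pivot being maximal, both terms are at most its modulus. Entries at most double at each
   stage, whence the factors [2 ^+ k]. *)
have S2 i j : `|S i j| <= 2 * `|c|.
  rewrite mxE (le_trans (ler_normB _ _))// mulr2n mulrDl mul1r lerD//.
  by rewrite !normrM normfV ler_pdivrMr// ler_pM.
have [d [l [u [E [e [d0 lu SE Ee [ed em [f [g dfg]] [f' [g' dfg']]]]]]]]] := IH S.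
have [e2 d2] := em _ S2.
(* The new [d] is the modulus of the pivot; dividing one factor by [c] and the other by its modulus
   restores the sign. *)
exists (fcons `|c| d), (fcons (fun i => W i j0 / c) l),
  (fcons (fun j => W i0 j / `|c|) u), E, e; split=> //.
- by move=> q; rewrite /fcons; case: (unlift _ _).
- move=> q i; rewrite /fcons; case: (unlift _ _) => // .
  by rewrite !normrM !normfV !normr_id !ler_pdivrMr// !mul1r.
- move=> i j; rewrite big_ord_recl !fcons0.
  rewrite (eq_bigr (fun q => d q * l q i * u q j)) => [|q _]; last by rewrite !fconsS.
  rewrite -addrA -SE mxE; field.
  by rewrite c0 gt_eqF.
split.
- move=> q; rewrite /fcons; case: (unlift _ _) => [q'|]; last first.
    by rewrite exprSr -mulrA.
  by rewrite (le_trans (ed q'))// exprS -mulrA ler_peMl ?mulr_ge0 ?exprn_ge0// ler1n.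
- move=> m Wm; have cm : `|c| <= m by exact: Wm.
  have Sm i j : `|S i j| <= 2 * m by rewrite (le_trans (S2 i j))// ler_wpM2l.
  have [e2' d2'] := em _ Sm; rewrite exprSr -mulrA; split=> // q.
  rewrite /fcons; case: (unlift _ _) => [q'|]; first by rewrite d2'.
  have m0 : 0 <= m := le_trans (normr_ge0 _) cm.
  rewrite (le_trans cm)// mulrA -exprSr ler_peMl//.
  by rewrite exprn_ege1// ler1n.
- exists (fcons i0 f), (fcons j0 g); rewrite det_schur_complement// normrM.
  rewrite big_ord_recl fcons0 ler_wpM2l//.
  by under eq_bigr do rewrite fconsS.
- exists (fcons i0 f'), (fcons j0 g'); rewrite det_schur_complement// normrM.
  rewrite big_ord_recl fcons0 -mulrA ler_wpM2l//.
  by under eq_bigr do rewrite fconsS.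
Qed.

End Pivoting.

(** * Covering the image of a small ball *)

Section LinearImageCover.
Variable R : realType.

Lemma mx_norm_le m n (A : 'M[R]_(m, n)) (c : R) : 0 <= c ->
  (forall i j, `|A i j| <= c) -> `|A| <= c.
Proof.
move=> c0 Ac; rewrite [leLHS]/Num.norm/= mx_normrE; apply/bigmax_leP.
by split => // -[i j] _.
Qed.

Lemma mx_norm_coord m n (A : 'M[R]_(m, n)) i j : `|A i j| <= `|A|.
Proof.
rewrite [leRHS]/Num.norm/= mx_normrE.
exact: (le_bigmax _ (fun ij : 'I_m * 'I_n => `|A ij.1 ij.2|) (i, j)).
Qed.

Lemma mulmx_rv_norm n (v : 'rV[R]_n) (A : 'M[R]_n) : `|v *m A| <= `|v| * mnorm A.
Proof.
apply: mx_norm_le => [|i0 i]; first by rewrite mulr_ge0// mnorm_ge0.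
rewrite ord1 => {i0}.
rewrite mxE (le_trans (ler_norm_sum _ _ _))// mulr_sumr ler_sum// => j _.
rewrite normrM ler_pM ?mx_norm_coord//.
by rewrite (bigD1 i)//= lerDl sumr_ge0.
Qed.

(** Up to errors of order [rho r] the image is a box with [k] edges, the [q]-th of size about
    [n d q r], which is cut into cells of side [rho r]. Two points of one cell differ by at most
    [rho r] in each of [k] coefficients, by [n rho r] for [E] at each point, and by one
    linearization error at each: this is [k + 2 n + 2]. *)
Lemma linear_image_cover n k (W : 'M[R]_n) (d : 'I_k -> R) (l u : 'I_k -> 'I_n -> R)
    (E : 'M[R]_n) (phi : 'rV[R]_n -> 'rV[R]_n) (K : set 'rV[R]_n) y (r rho : R) :
  (forall q, 0 <= d q) -> (forall q i, `|l q i| <= 1 /\ `|u q i| <= 1) ->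
  (forall i j, W i j = \sum_q d q * l q i * u q j + E i j) ->
  (forall i j, `|E i j| <= rho) -> 0 < rho -> 0 < r ->
  (forall z, K z -> `|z - y| <= r -> `|phi z - phi y - (z - y) *m W^T| <= rho * r) ->
  exists s : seq 'rV[R]_n, [/\ forall c, c \in s -> exists2 z, K z & phi z = c,
    (size s)%:R <= \prod_q (2 * n%:R * d q / rho + 1) &
    forall z, K z -> `|z - y| <= r ->
      exists2 c, c \in s & `|phi z - c| <= (k + 2 * n + 2)%:R * rho * r].
Proof.
move=> d0 lu WE Erho rho0 r0 approx.
pose B (z : 'rV[R]_n) := K z /\ `|z - y| <= r.
pose coef (z : 'rV[R]_n) q := d q * \sum_j u q j * (z - y) 0 j.
have coefB z q : B z -> `|coef z q| <= d q * (n%:R * r).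
  move=> [_ zr]; rewrite normrM (ger0_norm (d0 q)) ler_wpM2l//.
  rewrite (le_trans (ler_norm_sum _ _ _))//.
  rewrite -[n in n%:R]card_ord mulr_natl -sumr_const ler_sum// => j _.
  rewrite normrM -[leRHS]mul1r ler_pM ?(lu q j).2//.
  exact: le_trans (mx_norm_coord _ _ _) zr.
have rr : 0 < rho * r by rewrite mulr_gt0.
pose T q := Num.truncn (2 * n%:R * d q / rho).
(* The coefficient, shifted to start at 0 and measured in units of [rho r]; its integer part is the
   index of the cell. *)
pose pos z q := (coef z q + d q * (n%:R * r)) / (rho * r).
have pos0 z q : B z -> 0 <= pos z q.
  move=> /(coefB _ q); rewrite ler_norml => /andP[h _].
  by rewrite divr_ge0 ?(ltW rr)// -lerBlDr sub0r.
have posT z q : B z -> (Num.truncn (pos z q) < (T q).+1)%N.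
  move=> zB; rewrite ltnS; apply: le_truncn.
  have := coefB z q zB; rewrite ler_norml => /andP[_ h].
  rewrite ler_pdivrMr// (_ : _ * (rho * r) = 2 * (d q * (n%:R * r))); last first.
    by field; rewrite gt_eqF.
  by lra.
pose in_cell (c : {dffun forall q : 'I_k, 'I_(T q).+1}) z := B z /\ forall q, Num.truncn (pos z q) = c q :> nat.
(* Cells are represented by points of [K], so that the new centres are images of points of [K] and
   the covering can be iterated. *)
pose rep (c : {dffun forall q : 'I_k, 'I_(T q).+1}) := xget 0 [set z | in_cell c z].
pose s := [seq phi (rep c) | c <- enum {dffun forall q : 'I_k, 'I_(T q).+1} & `[< exists z, in_cell c z >]].
have repP c z : in_cell c z -> in_cell c (rep c).
  by move=> cz; exact: (@xgetPex _ 0 [set z | in_cell c z] (ex_intro _ z cz)).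
exists s; split.
- move=> c /mapP[c']; rewrite mem_filter => /andP[/asboolP[z /repP[[Kz _] _]] _] ->.
  by exists (rep c').
- rewrite size_map (@le_trans _ _ #|{dffun forall q : 'I_k, 'I_(T q).+1}|%:R)//.
    by rewrite ler_nat cardE size_filter count_size.
  rewrite card_dep_ffun /image_mem.
  have -> : foldr muln 1%N [seq #|'I_(T x).+1| | x <- enum 'I_k] = (\prod_q (T q).+1)%N.
    rewrite -big_enum /=; elim: (enum _) => [|q t IH] /=; first by rewrite big_nil.
    by rewrite big_cons IH card_ord.
  rewrite natr_prod; apply: ler_prod => q _; rewrite ler0n /= -natr1 lerD2r.
  by rewrite truncn_le divr_ge0 ?(ltW rho0)// mulr_ge0.
move=> z Kz zr; have zB : B z by [].
pose c : {dffun forall q : 'I_k, 'I_(T q).+1} := [ffun q => Ordinal (posT z q zB)].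
have zc : in_cell c z by split=> // q; rewrite ffunE.
exists (phi (rep c)).
  apply/mapP; exists c => //; rewrite mem_filter mem_enum andbT.
  by apply/asboolP; exists z.
have [[Kz' z'r] z'c] := repP c z zc.
set z' := rep c in Kz' z'r z'c *.
have coef_close q : `|coef z q - coef z' q| <= rho * r.
  have h1 := truncn_itv (pos0 z q zB).
  have z'B : B z' by [].
  have h2 := truncn_itv (pos0 z' q z'B).
  move: h1 h2; rewrite (z'c q) ffunE /=; move: (Num.truncn _) => t.
  rewrite /pos !ler_pdivlMr// !ltr_pdivrMr// -natr1 mulrDl mul1r.
  by move=> /andP[? ?] /andP[? ?]; rewrite ler_norml; apply/andP; split; lra.
have lin x i : ((x - y) *m W^T) 0 i =
    \sum_q coef x q * l q i + \sum_j (x - y) 0 j * E i j.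
  rewrite mxE; under eq_bigr do rewrite [W^T _ _]mxE WE mulrDr.
  rewrite big_split /=; congr (_ + _).
  under eq_bigr do rewrite mulr_sumr.
  rewrite exchange_big; apply: eq_bigr => q _ /=.
  rewrite /coef mulr_sumr mulr_suml; apply: eq_bigr => j _; ring.
have sumE x i : `|x - y| <= r -> `|\sum_j (x - y) 0 j * E i j| <= n%:R * (rho * r).
  move=> xr; rewrite (le_trans (ler_norm_sum _ _ _))//.
  rewrite -[n in n%:R]card_ord mulr_natl -sumr_const ler_sum// => j _.
  by rewrite normrM mulrC ler_pM// (le_trans (mx_norm_coord _ _ _)).
apply: mx_norm_le => [|i0 i]; first by rewrite -mulrA mulr_ge0// ltW.
rewrite ord1 => {i0}.
have h1 := le_trans (mx_norm_coord _ 0 i) (approx z Kz zr).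
have h2 := le_trans (mx_norm_coord _ 0 i) (approx z' Kz' z'r).
have h3 := sumE z i zr; have h4 := sumE z' i z'r.
have h5 : `|\sum_q coef z q * l q i - \sum_q coef z' q * l q i| <= k%:R * (rho * r).
  rewrite -sumrB (le_trans (ler_norm_sum _ _ _))//.
  rewrite -[k in k%:R]card_ord mulr_natl -sumr_const ler_sum// => q _.
  by rewrite -mulrBl normrM -[leRHS]mulr1 ler_pM// (lu q i).1.
have e1 x : (phi x - phi y - (x - y) *m W^T) 0 i =
    phi x 0 i - phi y 0 i - ((x - y) *m W^T) 0 i by rewrite !mxE.
have -> : (phi z - phi z') 0 i = phi z 0 i - phi z' 0 i by rewrite !mxE.
move: h1 h2; rewrite !e1 !lin.
move: h3 h4 h5; set a := \sum_q _; set b := \sum_q _; set p := \sum_j _.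
set p' := \sum_j _; rewrite -mulrA.
have -> : (k + 2 * n + 2)%:R = k%:R + 2 * n%:R + 2 :> R by rewrite natrD natrD natrM.
by rewrite !ler_norml => /andP[? ?] /andP[? ?] /andP[? ?] /andP[? ?] /andP[? ?];
  apply/andP; split; lra.
Qed.

End LinearImageCover.

(** * Hausdorff dimension from iterated coverings *)

Section Hausdorff.
Variable R : realType.

Lemma compact_finite_balls (V : normedModType R) (K : set V) (dl : V -> R) :
  compact K -> (forall x, K x -> 0 < dl x) ->
  exists2 s : seq V, forall x, x \in s -> K x &
    forall z, K z -> exists2 x, x \in s & `|z - x| < dl x.
Proof.
move=> cK dl0; move: cK; rewrite compact_cover.
move=> /(_ V K (fun x => ball x (dl x)))[].
- by move=> x Kx; apply: ball_open; exact: dl0.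
- by move=> x Kx; exists x => //; apply: ballxx; exact: dl0.
move=> D DK KD; exists (finmap.enum_fset D) => [x xD|z Kz].
  by have := DK x xD; rewrite inE.
have [x xD zx] := KD z Kz; exists x => //.
by move: zx; rewrite -ball_normE /ball_ /= distrC.
Qed.

Lemma seq_pos_lower_bound (T : eqType) (s : seq T) (f : T -> R) :
  (forall x, x \in s -> 0 < f x) ->
  exists2 b : R, 0 < b & forall x, x \in s -> b <= f x.
Proof.
elim: s => [|a s IH] H; first by exists 1.
have [|b b0 bs] := IH; first by move=> x xs; apply: H; rewrite inE xs orbT.
have fa : 0 < f a by apply: H; rewrite inE eqxx.
exists (Num.min (f a) b) => [|x]; first by rewrite lt_min fa.
by rewrite inE ge_min => /orP[/eqP ->|/bs ->]; rewrite ?lexx ?orbT.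
Qed.

(** Centres are required in [K] because balls are subdivided only around points of [K]. *)
Definition ball_cover n (K : set 'rV[R]_n) (d eta S : R) : Prop :=
  exists L : seq ('rV[R]_n * R), [/\
    forall x, x \in L -> [/\ K x.1, 0 < x.2 & x.2 <= eta],
    forall z, K z -> exists2 x, x \in L & `|z - x.1| <= x.2 &
    \sum_(x <- L) x.2 `^ d <= S].

(** Balls refer to the largest-entry norm and diameters to the Euclidean one; the change of norm
    costs at most the factor [n]. *)
Lemma diam_closed_ball n (c : 'rV[R]_n) (r : R) : 0 <= r ->
  (0 <= diam [set z : 'rV[R]_n | (`|z - c| <= r)%R] <= (2 * n%:R * r)%:E)%E.
Proof.
move=> r0; apply/andP; split.
  apply: ereal_sup_ubound; exists c; first by rewrite /= subrr normr0.
  exists c; first by rewrite /= subrr normr0.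
  rewrite (_ : lp_norm _ _ = 0)//.
  rewrite -[RHS](@lp_norm0 R 'I_n 2%:E); last by rewrite lee_fin ler1n.
  by apply: eq_lp_norm => i; rewrite subrr mxE.
apply: ge_ereal_sup => _ [x xr [y yr <-]]; rewrite lee_fin.
have one2 : (1 <= 2%:E :> \bar R)%E by rewrite lee_fin ler1n.
apply: (le_trans (lp_norm_le_sum _ one2)).
rewrite mulrAC mulrC -[n in n%:R]card_ord mulr_natl -sumr_const ler_sum// => i _.
rewrite (le_trans (mx_norm_coord _ 0 i))//.
have -> : x - y = (x - c) - (y - c) by rewrite opprB addrA subrK.
by rewrite (le_trans (ler_normB _ _))// mulr2n mulrDl mul1r lerD.
Qed.

Lemma hausdorff_premeasure_ball_cover n (K : set 'rV[R]_n) (d eta S delta : R) :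
  0 <= d -> ball_cover K d eta S -> 2 * n%:R * eta <= delta -> 0 <= delta ->
  (hausdorff_premeasure d delta K <= ((2 * n%:R) `^ d * S)%:E)%E.
Proof.
move=> d0 [L [LK Lcov LS]] small delta0.
pose B (x : 'rV[R]_n * R) := [set z : 'rV[R]_n | `|z - x.1| <= x.2].
(* The finite list is continued by empty sets, to which [diam_pow] gives the value 0 for every
   exponent. *)
pose U i := if (i < size L)%N then B (nth (0, 0) L i) else set0.
have nL i : (i < size L)%N -> [/\ K (nth (0, 0) L i).1, 0 < (nth (0, 0) L i).2
    & (nth (0, 0) L i).2 <= eta] by move=> iL; apply: LK; rewrite mem_nth.
apply: (@le_trans _ _ (\sum_(0 <= i <oo) diam_pow d (U i))%E).
  apply: ereal_inf_lbound; exists U => //; split.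
    move=> z /Lcov[x xL zx]; exists (index x L) => //.
    by rewrite /U index_mem xL nth_index.
  move=> i; rewrite /U; case: ifP => [iL|_].
    have [_ r0 re] := nL i iL; have /andP[_ h] := diam_closed_ball (nth (0, 0) L i).1 (ltW r0).
    rewrite (le_trans h)// lee_fin (le_trans _ small)// ler_wpM2l// mulr_ge0.
  by apply: ge_ereal_sup => _ [x []].
have term i : (i < size L)%N -> (diam_pow d (U i) <=
    ((2 * n%:R) `^ d * (nth (0, 0) L i).2 `^ d)%:E)%E.
  move=> iL; rewrite /U iL /diam_pow; have [_ r0 _] := nL i iL.
  have /andP[h1 h2] := diam_closed_ball (nth (0, 0) L i).1 (ltW r0).
  rewrite ifF; last first.
    apply/negP => /eqP/seteqP[/(_ (nth (0, 0) L i).1)+ _]; apply.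
    by rewrite /B /= subrr normr0 ltW.
  rewrite -powRM ?mulr_ge0 ?(ltW r0)// -poweR_EFin.
  apply: (gt0_ler_poweR d0 _ _ h2); rewrite in_itv/= leey andbT; first exact: h1.
  by rewrite lee_fin mulr_ge0 ?mulr_ge0 // ltW.
have d0U i : (0 <= diam_pow d (U i))%E.
  by rewrite /diam_pow; case: ifP => // _; exact: poweR_ge0.
rewrite (nneseries_split _ (size L))//= eseries0 ?adde0; last first.
  move=> i iL _; rewrite /U ltnNge (leq_trans _ iL)// /diam_pow eqxx//.
rewrite add0n.
apply: (@le_trans _ _ (\sum_(0 <= i < size L)
   ((2 * n%:R) `^ d * (nth (0%R, 0%R) L i).2 `^ d)%:E)%E).
  rewrite !big_mkord; apply: lee_sum => i _; exact: term.
rewrite sumEFin lee_fin -mulr_sumr ler_wpM2l ?powR_ge0//.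
by rewrite -(big_nth (0, 0) xpredT (fun x => x.2 `^ d)).
Qed.


Lemma cvg_expr_mull (q a e : R) : `|q| < 1 -> 0 < e ->
  exists m0, forall m, (m0 <= m)%N -> `|q ^+ m * a| <= e.
Proof.
move=> q1 e0.
have h : (fun m => q ^+ m * a) @ \oo --> (0 : R).
  by rewrite -(mul0r a); apply: cvgMr_tmp; exact: cvg_expr.
have /cvgr0Pnorm_le/(_ e e0)[m0 _ H] := h.
by exists m0 => m m0m; apply: H.
Qed.

(** Each ball is replaced by its own covering of the image of its part of [K], with its own ratio
    [th]. As [K] is contained in its image, the new balls cover [K] again. *)
Lemma ball_cover_image n (K : set 'rV[R]_n) (phi : 'rV[R]_n -> 'rV[R]_n)
    (d Th dl : R) :
  K `<=` phi @` K ->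
  (forall y r, K y -> 0 < r -> r < dl -> exists (th : R) (s : seq 'rV[R]_n),
     [/\ 0 < th <= Th, (size s)%:R * th `^ d <= 3 / 4, forall c, c \in s -> K c &
         forall z, K z -> `|z - y| <= r ->
           exists2 c, c \in s & `|phi z - c| <= th * r]) ->
  forall eta S, eta < dl -> ball_cover K d eta S ->
    ball_cover K d (Th * eta) (3 / 4 * S).
Proof.
move=> Kphi H eta S etadl [L [LK Lcov LS]].
suff [L' [L'K L'cov L'S]] : exists L' : seq ('rV[R]_n * R), [/\
    forall x, x \in L' -> [/\ K x.1, 0 < x.2 & x.2 <= Th * eta],
    forall z w, K z -> w \in L -> `|z - w.1| <= w.2 ->
       exists2 x, x \in L' & `|phi z - x.1| <= x.2 &
    \sum_(x <- L') x.2 `^ d <= 3 / 4 * \sum_(x <- L) x.2 `^ d].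
  exists L'; split=> //; last by rewrite (le_trans L'S)// ler_pM2l// divr_gt0.
  move=> _ /Kphi[z Kz <-]; have [w wL zw] := Lcov z Kz; exact: (L'cov z w).
elim: L LK {Lcov LS} => [|[y r] L IH] LK.
  by exists [::]; rewrite !big_nil mulr0; split.
have [|L' [L'K L'cov L'S]] := IH.
  by move=> x xL; apply: LK; rewrite inE xL orbT.
have [Ky r0 re] : [/\ K y, 0 < r & r <= eta] by apply: (LK (y, r)); rewrite inE eqxx.
have [th [s [/andP[th0 thT] sth sK scov]]] := H y r Ky r0 (le_lt_trans re etadl).
exists ([seq (c, th * r) | c <- s] ++ L'); split.
- move=> x; rewrite mem_cat => /orP[/mapP[c cs ->]|/L'K//] /=.
  by split; [exact: sK|rewrite mulr_gt0|rewrite ler_pM// ltW].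
- move=> z w Kz; rewrite inE => /orP[/eqP-> /= zr|wL zw].
    have [c cs zc] := scov z Kz zr.
    by exists (c, th * r) => //; rewrite mem_cat map_f.
  by have [x xL zx] := L'cov z w Kz wL zw; exists x => //; rewrite mem_cat xL orbT.
- rewrite big_cat big_cons big_map /= mulrDr lerD//.
  rewrite big_const_seq iter_addr_0 count_predT powRM ?(ltW th0) ?(ltW r0)//.
  by rewrite -[leLHS]mulr_natl mulrA ler_wpM2r// powR_ge0.
Qed.

Lemma ball_cover_init n (K : set 'rV[R]_n) (d eta : R) : compact K -> 0 < eta ->
  exists S, ball_cover K d eta S.
Proof.
move=> cK eta0; have [s sK scov] := compact_finite_balls cK (fun=> fun=> eta0).
exists (\sum_(x <- [seq (c, eta) | c <- s]) x.2 `^ d), [seq (c, eta) | c <- s]; split=> //.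
  by move=> x /mapP[c /sK Kc ->].
move=> z /scov[c cs zc]; exists (c, eta); first exact: map_f.
exact: ltW.
Qed.

(** Radii and sums of powers both decrease geometrically along the iteration, so every premeasure
    vanishes. *)
Lemma hausdorff_measure_eq0 n (K : set 'rV[R]_n) (d Th dl : R) :
  compact K -> 0 <= d -> 0 <= Th -> Th < 1 -> 0 < dl ->
  (forall eta S, eta < dl -> ball_cover K d eta S ->
    ball_cover K d (Th * eta) (3 / 4 * S)) ->
  hausdorff_measure d K = 0%E.
Proof.
move=> cK d0 Th0 Th1 dl0 H; have dl20 : 0 < dl / 2 by rewrite divr_gt0.
have [S0 cov0] := ball_cover_init d cK dl20.
have covm m : ball_cover K d (Th ^+ m * (dl / 2)) ((3 / 4) ^+ m * S0).
  elim: m => [|m IH]; first by rewrite !expr0 !mul1r.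
  rewrite (exprS Th) (exprS (3 / 4)) -(mulrA Th) -(mulrA (3 / 4)); apply: H => //.
  rewrite (le_lt_trans (y := dl / 2))//; last lra.
  by rewrite ler_piMl ?(ltW dl20)// exprn_ile1// ltW.
have pre0 delta : 0 < delta -> hausdorff_premeasure d delta K = 0%E.
  move=> delta0; apply/eqP; rewrite eq_le; apply/andP; split; last first.
    apply: le_ereal_inf_tmp => _ [U _ <-]; apply: nneseries_ge0 => i _ _.
    by rewrite /diam_pow; case: ifP => // _; exact: poweR_ge0.
  apply/lee_addgt0Pr => e e0; rewrite add0e.
  have q1 : `|3 / 4 : R| < 1 by rewrite ger0_norm; lra.
  have q2 : `|Th| < 1 by rewrite ger0_norm.
  have [m1 h1] := cvg_expr_mull ((2 * n%:R) `^ d * S0) q1 e0.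
  have [m2 h2] := cvg_expr_mull (2 * n%:R * (dl / 2)) q2 delta0.
  pose m := maxn m1 m2.
  apply: (le_trans (hausdorff_premeasure_ball_cover d0 (covm m) _ (ltW delta0))).
    have := h2 m (leq_maxr _ _); move=> /(le_trans (ler_norm _)).
    by rewrite mulrCA.
  have := h1 m (leq_maxl _ _); move=> /(le_trans (ler_norm _)).
  by rewrite lee_fin mulrCA.
apply/eqP; rewrite eq_le; apply/andP; split.
  by apply: ge_ereal_sup => _ [delta delta0 <-]; rewrite pre0.
by apply: ereal_sup_ubound; exists 1 => //=; rewrite pre0.
Qed.

Lemma hausdorff_dim_lt_of_contracting_cover n (K : set 'rV[R]_n)
    (phi : 'rV[R]_n -> 'rV[R]_n) (alpha : R) :
  compact K -> K `<=` phi @` K -> 0 < alpha ->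
  (forall x, K x -> exists (dl th N : R),
    [/\ 0 < dl, 0 < th, 1 <= N, N * th `^ alpha <= 1 / 2 &
      forall y r, K y -> `|y - x| < dl -> 0 < r -> r < dl ->
        exists s : seq 'rV[R]_n, [/\ (size s)%:R <= N, forall c, c \in s -> K c &
          forall z, K z -> `|z - y| <= r ->
            exists2 c, c \in s & `|phi z - c| <= th * r]]) ->
  (hausdorff_dim K < alpha%:E)%E.
Proof.
move=> cK Kphi al0 H.
have /choice[F HF] : forall x, exists F : R * R * R, K x ->
    [/\ 0 < F.1.1, 0 < F.1.2, 1 <= F.2, F.2 * F.1.2 `^ alpha <= 1 / 2 &
      forall y r, K y -> `|y - x| < F.1.1 -> 0 < r -> r < F.1.1 ->
        exists s : seq 'rV[R]_n, [/\ (size s)%:R <= F.2, forall c, c \in s -> K c &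
          forall z, K z -> `|z - y| <= r ->
            exists2 c, c \in s & `|phi z - c| <= F.1.2 * r]].
  move=> x; case: (pselect (K x)) => Kx; last by exists (0, 0, 0).
  by have [dl [th [N ?]]] := H x Kx; exists (dl, th, N).
have [|xs xsK xscov] := compact_finite_balls (dl := fun x => (F x).1.1) cK.
  by move=> x /HF[].
have [|dl dl0 dlb] := @seq_pos_lower_bound _ xs (fun x => (F x).1.1).
  by move=> x /xsK/HF[].
have [|b b0 bb] := @seq_pos_lower_bound _ xs (fun x => (F x).1.2).
  by move=> x /xsK/HF[].
(* A lower bound, kept below 1, for the ratios of the finitely many points [xs]. *)
pose b' := Num.min b (1 / 2).
have b'0 : 0 < b' by rewrite lt_min b0 divr_gt0.
have b'1 : b' < 1 by rewrite gt_min; apply/orP; right; lra.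
have lnb : ln b' < 0 by rewrite ln_lt0// b'0.
have ln23 : ln (2 / 3 : R) < 0 by rewrite ln_lt0//; lra.
(* Passing from [alpha] to [alpha - e] costs a factor [th ^ (- e)] of at most 3/2, which turns 1/2
   into 3/4. The bound [alpha / 2] keeps the new exponent nonnegative. *)
pose e := Num.min (alpha / 2) (ln (2 / 3) / ln b').
have e0 : 0 < e by rewrite lt_min divr_gt0//= nmulr_rgt0// invr_lt0.
have ea : e <= alpha / 2 by rewrite ge_min lexx.
have be : 2 / 3 <= b' `^ e.
  have h23 : 2 / 3 \is @Num.pos R by rewrite posrE; lra.
  rewrite /powR (gt_eqF b'0) -[leLHS](lnK h23).
  rewrite ler_expR -ler_ndivlMr//.
  by rewrite ge_min lexx orbT.
(* Since [N >= 1], each ratio satisfies [th ^ alpha <= 1 / 2], which bounds all of them by one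
   number below 1. *)
pose Th : R := (1 / 2) `^ alpha^-1.
have th_le x : x \in xs -> (F x).1.2 <= Th.
  move=> /xsK/HF[_ th0 N1 Nth _].
  have h : (F x).1.2 `^ alpha <= 1 / 2.
    by apply: le_trans Nth; rewrite ler_peMl// powR_ge0.
  have -> : (F x).1.2 = ((F x).1.2 `^ alpha) `^ alpha^-1.
    by rewrite -powRrM divff ?gt_eqF// powRr1// ltW.
  by rewrite ge0_ler_powR// ?nnegrE ?powR_ge0 ?invr_ge0 ?(ltW al0)//; lra.
have Th1 : Th < 1.
  rewrite /Th /powR gt_eqF; last lra.
  rewrite -[ltRHS]expR0 ltr_expR pmulr_rlt0 ?invr_gt0// ln_lt0//; lra.
have d0 : 0 <= alpha - e by lra.
apply: (@le_lt_trans _ _ (alpha - e)%:E); last by rewrite lte_fin; lra.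
apply: ereal_inf_lbound; exists (alpha - e) => //; split => //.
apply: (@hausdorff_measure_eq0 n K (alpha - e) Th dl) => //; first exact: powR_ge0.
apply: (ball_cover_image Kphi) => y r Ky r0 rdl.
have [x xxs yx] := xscov y Ky.
have [Fx0 th0 N1 Nth Hx] := HF x (xsK x xxs).
have [s [sN sK scov]] := Hx y r Ky yx r0 (lt_le_trans rdl (dlb x xxs)).
exists (F x).1.2, s; split=> //; first by rewrite th0 th_le.
apply: (@le_trans _ _ ((F x).2 * (F x).1.2 `^ (alpha - e))).
  by rewrite ler_wpM2r// powR_ge0.
have b'th : b' `^ e <= (F x).1.2 `^ e.
  rewrite ge0_ler_powR ?(ltW e0) ?nnegrE ?(ltW b'0) ?(ltW th0)//.
  by rewrite ge_min bb.
have the : 2 / 3 <= (F x).1.2 `^ e by exact: le_trans b'th.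
have : (F x).1.2 `^ alpha = (F x).1.2 `^ (alpha - e) * (F x).1.2 `^ e.
  by rewrite -powRD ?subrK// (gt_eqF th0) implybT.
have := powR_ge0 (F x).1.2 (alpha - e).
move: Nth the N1; move: (_ `^ (alpha - e)) (_ `^ alpha) (_ `^ e) (F x).2.
move=> P Q E N NQ E23 N1 P0 QPE.
have : N * P * (2 / 3) <= 1 / 2.
  by apply: le_trans NQ; rewrite QPE -mulrA ler_wpM2l ?(le_trans _ N1)// ler_wpM2l.
lra.
Qed.

End Hausdorff.

(** * Small compounds give contracting coverings *)

Section SmallLinearization.
Variable R : realType.

Lemma prod_addr_le k (a : 'I_k -> R) (b e : R) : (forall q, 0 <= a q <= b) ->
  0 <= b -> 0 <= e -> e <= 1 ->
  \prod_q (a q + e) <= \prod_q a q + e * (k%:R * (b + 1) ^+ k).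
Proof.
move=> ab b0 e0 e1; elim: k a ab => [|k IH] a ab.
  by rewrite !big_ord0 mul0r mulr0 addr0.
rewrite !big_ord_recl; set P := \prod_(i < k) (_ + e); set Q := \prod_(i < k) _.
have h : P <= Q + e * (k%:R * (b + 1) ^+ k) by apply: IH => q; exact: ab.
have /andP[a0 a0b] := ab ord0.
have b1 : 0 <= b + 1 by rewrite addr_ge0.
have Pb : P <= (b + 1) ^+ k.
  rewrite -[k in leRHS]card_ord -prodr_const; apply: ler_prod => q _.
  by have /andP[? ?] := ab (lift ord0 q); rewrite addr_ge0//= lerD.
have bk : 0 <= (b + 1) ^+ k by rewrite exprn_ge0.
rewrite mulrDl -natr1 exprS.
have h1 : a ord0 * P <= a ord0 * Q + b * (e * (k%:R * (b + 1) ^+ k)).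
  rewrite (le_trans (ler_wpM2l a0 h))// mulrDr lerD2l ler_wpM2r//.
  by rewrite !mulr_ge0.
have h2 : e * P <= e * (b + 1) ^+ k by rewrite ler_wpM2l.
apply: (le_trans (lerD h1 h2)); rewrite -addrA lerD2l.
have -> : b * (e * (k%:R * (b + 1) ^+ k)) + e * (b + 1) ^+ k =
  e * ((b * k%:R + 1) * (b + 1) ^+ k) by ring.
rewrite ler_wpM2l// mulrA ler_wpM2r//.
have : 0 <= k%:R :> R by []. 
move=> ?; lra.
Qed.

(** The covering number times the power of the ratio is [ca] times the product of the
    [2 n d q + rho] times [rho ^ s]. The scale [rho] is the residual of the pivoting, but at least
    [eps], an accuracy that must be fixed before [W] is known and so depends on the entry bound [A]
    only. *)
Lemma small_covering_number n k (s : R) : (0 < n)%N -> 0 <= s -> s < 1 ->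
  exists2 kappa : R, 0 < kappa & forall A : R, 0 <= A ->
  exists2 eps : R, 0 < eps & forall W : 'M[R]_n, (forall i j, `|W i j| <= A) ->
    mnorm (mcompound k W) `^ (1 - s) * mnorm (mcompound k.+1 W) `^ s <= kappa ->
  exists (d : 'I_k -> R) (l u : 'I_k -> 'I_n -> R) (E : 'M[R]_n) (rho : R),
  [/\ forall q, 0 <= d q, forall q i, `|l q i| <= 1 /\ `|u q i| <= 1,
    forall i j, W i j = \sum_q d q * l q i * u q j + E i j,
    (forall i j, `|E i j| <= rho) /\ eps <= rho &
    \prod_q (2 * n%:R * d q / rho + 1) *
      ((k + 2 * n + 2)%:R * rho) `^ (k%:R + s) <= 1 / 2].
Proof.
move=> n0 s0 s1.
set c : R := (k + 2 * n + 2)%:R.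
have c0 : 0 < c by rewrite ltr0n !addn_gt0 orbT.
set ca : R := c `^ (k%:R + s); have ca0 : 0 < ca by rewrite powR_gt0.
pose c1 : R := 2 * n%:R + 2 ^+ k.
have tn0 : 0 <= 2 * n%:R :> R by [].
have c10 : 0 < c1 by rewrite ltr_wpDl// exprn_gt0.
have cc0 : 0 < ca * c1 ^+ k by rewrite mulr_gt0// exprn_gt0.
exists (4^-1 / (ca * c1 ^+ k)); first by rewrite divr_gt0.
move=> A A0.
pose b : R := 2 * n%:R * (2 ^+ k * A).
have b0 : 0 <= b by rewrite !mulr_ge0// exprn_ge0.
pose c2 : R := ca * (k.+1%:R * (b + 1) ^+ k).
have b1 : 0 < b + 1 by rewrite ltr_wpDl.
have c20 : 0 < c2 by rewrite !mulr_gt0// exprn_gt0.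
(* [eps `^ s], or [eps] if [s = 0], has to beat the bound [c2] of the covering number. *)
pose t : R := Num.min 1 (4^-1 / c2).
have t0 : 0 < t by rewrite lt_min ltr01 divr_gt0// invr_gt0.
have t1 : t <= 1 by rewrite ge_min lexx.
have tc2 : t * c2 <= 4^-1.
  by rewrite (le_trans (ler_wpM2r (ltW c20) (_ : t <= 4^-1 / c2)))// ?divfK ?gt_eqF// ge_min lexx orbT.
pose eps : R := if s == 0 then t else t `^ s^-1.
have eps0 : 0 < eps by rewrite /eps; case: ifP => _ //; rewrite powR_gt0.
have eps1 : eps <= 1.
  rewrite /eps; case: ifP => _ //.
  have -> : 1 = 1 `^ s^-1 :> R by rewrite powR1.
  by rewrite ge0_ler_powR ?invr_ge0 ?nnegrE ?(ltW t0).
exists eps => // W WA.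
set qk := mnorm _; set qk1 := mnorm _ => small.
have [d [l [u [E [e [d0 lu WE Ee [ed em [f [g dfg]] [f' [g' dfg']]]]]]]]] :=
  complete_pivoting k W n0.
have {em}[eA dA] := em A WA.
have P0 : 0 <= \prod_q d q by rewrite prodr_ge0.
have e0 : 0 <= e := le_trans (normr_ge0 _) (Ee (Ordinal n0) (Ordinal n0)).
have Pk : \prod_q d q <= qk := le_trans dfg (det_minor_le _ _ _).
have Pk1 : \prod_q d q * e <= qk1 := le_trans dfg' (det_minor_le _ _ _).
(* The floor [eps] keeps the scale positive, and above the linearization error, when the residual
   [e] is tiny or zero. *)
exists d, l, u, E, (Num.max e eps); split=> //.
  by split=> [i j|]; rewrite le_max ?Ee// lexx orbT.
set rho := Num.max e eps.
have rho0 : 0 < rho by rewrite lt_max eps0 orbT.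
have -> : \prod_q (2 * n%:R * d q / rho + 1) * (c * rho) `^ (k%:R + s) =
    ca * (\prod_q (2 * n%:R * d q + rho) * rho `^ s).
  have rk : \prod_(q < k) rho = rho ^+ k by rewrite prodr_const card_ord.
  rewrite powRM ?(ltW c0) ?(ltW rho0)// -/ca powRD; last by rewrite (gt_eqF rho0) implybT.
  rewrite powR_mulrn ?(ltW rho0)// -rk mulrCA; congr (_ * _).
  rewrite mulrA -big_split /=; congr (_ * _); apply: eq_bigr => q _.
  by rewrite mulrDl divfK ?mul1r// gt_eqF.
(* With [P] the product of the pivots, [P e ^ s] equals [P ^ (1 - s) (P e) ^ s]; the two factors are
   controlled by the compounds of order [k] and [k.+1]. *)
have step2 : \prod_q d q * e `^ s <= 4^-1 / (ca * c1 ^+ k).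
  apply: le_trans small.
  have -> : \prod_q d q * e `^ s = (\prod_q d q) `^ (1 - s) * (\prod_q d q * e) `^ s.
    rewrite powRM// mulrA -powRD ?subrK ?powRr1//.
    by rewrite oner_eq0.
  by rewrite ler_pM ?powR_ge0// ge0_ler_powR ?nnegrE ?mulr_ge0 ?mnorm_ge0 ?subr_ge0 ?(ltW s1).
(* If the residual dominates, each pivot absorbs it up to [2 ^+ k], whence [c1]. Otherwise the
   smallness of [eps] does the work. *)
have [re|er] := leP eps e.
  have -> : rho = e by rewrite /rho; apply/max_idPl.
  apply: (@le_trans _ _ (ca * (c1 ^+ k * (\prod_q d q * e `^ s)))).
    rewrite ler_wpM2l ?(ltW ca0)// mulrA ler_wpM2r ?powR_ge0//.
    rewrite -[k in _ ^+ k]card_ord -prodr_const -big_split /=.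
    apply: ler_prod => q _; rewrite addr_ge0 ?mulr_ge0//=.
    by rewrite /c1 [leRHS]mulrDl lerD.
  rewrite mulrA mulrC -ler_pdivlMr// (le_trans step2)// ler_wpM2r ?invr_ge0 ?(ltW cc0)//; lra.
have -> : rho = eps by rewrite /rho; apply/max_idPr; exact: ltW.
have dB q : 0 <= 2 * n%:R * d q <= b by rewrite mulr_ge0//= ler_wpM2l.
(* For [s = 0] the factor [eps ^ s] is 1 and gains nothing: instead the product is compared with its
   value without [eps], and the two terms contribute 1/4 each. *)
have [sE|sE] := eqVneq s 0.
  have epsE : eps = t by rewrite /eps sE eqxx.
  rewrite sE powRr0 mulr1.
  have h := prod_addr_le dB b0 (ltW eps0) eps1.
  have h2 : \prod_q (2 * n%:R * d q) <= c1 ^+ k * (4^-1 / (ca * c1 ^+ k)).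
    rewrite sE powRr0 mulr1 in step2.
    rewrite (le_trans _ (ler_wpM2l _ step2)) ?exprn_ge0 ?(ltW c10)//.
    rewrite -[k in _ ^+ k]card_ord -prodr_const -big_split /=.
    apply: ler_prod => q _; rewrite mulr_ge0//= ler_wpM2r//.
    by rewrite lerDl exprn_ge0.
  have h3 : ca * (eps * (k%:R * (b + 1) ^+ k)) <= 4^-1.
    rewrite mulrCA epsE (le_trans _ tc2)// ler_wpM2l ?(ltW t0)// ler_wpM2l ?(ltW ca0)//.
    by rewrite ler_wpM2r ?exprn_ge0 ?(ltW b1)// ler_nat.
  have h4 : ca * (c1 ^+ k * (4^-1 / (ca * c1 ^+ k))) = 4^-1.
    by field; rewrite ?gt_eqF ?exprn_gt0.
  apply: (le_trans (ler_wpM2l (ltW ca0) h)); rewrite mulrDr.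
  have := ler_wpM2l (ltW ca0) h2; rewrite h4 => h5; lra.
have epsE : eps `^ s = t.
  by rewrite /eps (negbTE sE) -powRrM mulVf// powRr1// ltW.
rewrite epsE.
have h : \prod_q (2 * n%:R * d q + eps) <= (b + 1) ^+ k.
  rewrite -[k in leRHS]card_ord -prodr_const; apply: ler_prod => q _.
  by have /andP[? ?] := dB q; rewrite addr_ge0 ?(ltW eps0)//= lerD.
rewrite mulrA mulrC (@le_trans _ _ (t * c2))//; last by rewrite (le_trans tc2)//; lra.
rewrite ler_wpM2l ?(ltW t0)// ler_wpM2l ?(ltW ca0)// (le_trans h)//.
by rewrite ler_peMl ?exprn_ge0 ?(ltW b1)// ler1n.
Qed.

(* As [W] may depend on [eps], [phi] need not have a derivative at [x]. *)
Definition linearized_at n (K : set 'rV[R]_n) (phi : 'rV[R]_n -> 'rV[R]_n)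
    (x : 'rV[R]_n) (eps : R) (W : 'M[R]_n) : Prop :=
  exists2 dl : R, 0 < dl & forall y z, K y -> K z -> `|y - x| < dl -> `|z - x| < dl ->
    `|phi z - phi y - (z - y) *m W^T| <= eps * `|z - y|.

Lemma hausdorff_dim_lt_of_small_compounds n k (s : R) : (0 < k < n)%N ->
  0 <= s -> s < 1 ->
  exists2 kappa : R, 0 < kappa & forall (K : set 'rV[R]_n) (phi : 'rV[R]_n -> 'rV[R]_n),
    compact K -> K = phi @` K ->
    (forall x, K x -> exists A : R, forall eps, 0 < eps -> exists W : 'M[R]_n,
      [/\ forall i j, `|W i j| <= A, linearized_at K phi x eps W &
       mnorm (mcompound k W) `^ (1 - s) * mnorm (mcompound k.+1 W) `^ s <= kappa]) ->
    (hausdorff_dim K < (k%:R + s)%:E)%E.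
Proof.
move=> /andP[k0 kn] s0 s1; have n0 : (0 < n)%N by exact: leq_ltn_trans kn.
have [kappa kappa0 H] := @small_covering_number n k s n0 s0 s1.
exists kappa => // K phi cK Kphi HK.
apply: (@hausdorff_dim_lt_of_contracting_cover R n K phi) => //.
- by rewrite -Kphi.
- by rewrite ltr_wpDr// ltr0n.
move=> x Kx; have [A HA] := HK x Kx.
have A0 : 0 <= A.
  have [W [WA _ _]] := HA 1 ltr01.
  exact: le_trans (normr_ge0 _) (WA (Ordinal n0) (Ordinal n0)).
have [eps eps0 Heps] := H A A0.
have [W [WA [dl dl0 Wlin] Wk]] := HA eps eps0.
have [d [l [u [E [rho [d0 lu WE [Erho er] small]]]]]] := Heps W WA Wk.
have rho0 : 0 < rho := lt_le_trans eps0 er.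
exists (dl / 2), ((k + 2 * n + 2)%:R * rho), (\prod_q (2 * n%:R * d q / rho + 1)).
split=> //; first by rewrite divr_gt0.
- by rewrite mulr_gt0// ltr0n !addn_gt0 orbT.
- rewrite -[leLHS](expr1n _ k) -[k in leLHS]card_ord -prodr_const.
  by apply: ler_prod => q _; rewrite ler01/= lerDr divr_ge0 ?mulr_ge0// ltW.
move=> y r Ky yx r0 rdl.
have [z Kz zr|S [SK sS Scov]] := linear_image_cover (phi := phi) (K := K) (y := y) d0 lu WE Erho rho0 r0.
  have zx : `|z - x| < dl.
    have -> : z - x = (z - y) + (y - x) by rewrite addrA subrK.
    by rewrite (le_lt_trans (ler_normD _ _))//; lra.
  rewrite (le_trans (Wlin y z Ky Kz _ zx))//; first lra.
  by rewrite ler_pM// ltW.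
exists S; split=> // c /SK[z Kz <-].
by rewrite Kphi; exists z.
Qed.

End SmallLinearization.

(** * Differential calculus and limits of matrices *)

Section MatrixCalculus.
Variable R : realType.

Lemma mnorm_le_mx_norm m n (A : 'M[R]_(m, n)) : mnorm A <= (m * n)%:R * `|A|.
Proof. by apply: mnorm_le_card => i j; exact: mx_norm_coord. Qed.

(** The norm is the largest modulus of an entry, so the scalar mean value theorem applies entry by
    entry without loss. *)
Lemma mean_value_mx m n (g dg : R -> 'M[R]_(m, n)) (a b c : R) : a <= b -> 0 <= c ->
  {within `[a, b], continuous g} ->
  (forall t, a < t < b -> is_derive t 1 g (dg t)) ->
  (forall t, a < t < b -> `|dg t| <= c) ->
  `|g b - g a| <= c * (b - a).
Proof.
move=> ab c0 gc gd dgc.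
apply: mx_norm_le => [|i j]; first by rewrite mulr_ge0// subr_ge0.
have [eab|] := eqVneq a b.
  by rewrite eab !mxE !subrr normr0 mulr0.
move=> /negbTE anb; have {}ab : a < b by rewrite lt_neqAle anb.
have [|t|t ab' e] := @MVT R (fun t => g t i j) (fun t => dg t i j) a b ab.
- move=> t; rewrite in_itv /= => tab.
  have [gt <-] := gd t tab; have /derivable_mxP/(_ i j) gij := gt.
  by rewrite derive_mx// mxE; exact: derivableP.
- apply: (@continuous_comp _ _ _ (from_subspace `[a, b] g)
    (fun M : 'M[R]_(m, n) => M i j) t (gc t)).
  exact: coord_continuous.
rewrite in_itv /= in ab'.
rewrite !mxE e normrM (ger0_norm (_ : 0 <= b - a)) ?subr_ge0 ?(ltW ab)//.
rewrite ler_wpM2r ?subr_ge0 ?(ltW ab)// (le_trans _ (dgc t ab'))//.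
exact: mx_norm_coord.
Qed.

Lemma is_derive_line (V W : normedModType R) (g : V -> W) (y u : V) (s : R) :
  differentiable g (y + s *: u) ->
  is_derive s 1 (fun s => g (y + s *: u)) ('d g (y + s *: u) u).
Proof.
move=> dg; pose l (s : R) := y + s *: u.
have dl : is_diff s l (fun h : R => h *: u).
  have -> : l = cst y + ( *:%R ^~ u) by [].
  by apply: is_diff_eq; rewrite /cst; apply/funext => h /=; rewrite add0r.
have dgl : differentiable (g \o l) s by apply: differentiable_comp.
have dgl' : derivable (g \o l) s 1 by apply: diff_derivable.
apply: is_derive_eq (derivableP dgl') _.
have dlE : 'd l s = ( *:%R^~ u) :> (R -> V) by exact: diff_val.
by rewrite deriveE// diff_comp//= dlE scale1r.
Qed.

Lemma is_derive_scalel (V : normedModType R) (u : V) (s : R) :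
  is_derive s 1 (fun s => s *: u) u.
Proof.
pose l (h : R) : V := h *: u.
have ds : is_diff s l l by exact: is_diff_scalel.
have dl : differentiable l s by exact: ex_diff.
have dl' : derivable l s 1 by apply: diff_derivable.
apply: is_derive_eq (derivableP dl') _.
have dE : 'd l s = l :> (R -> V) by exact: diff_val.
by rewrite deriveE// dE /l scale1r.
Qed.

Lemma mean_value_drift_mx m n (g dg : R -> 'M[R]_(m, n)) (d : 'M[R]_(m, n)) (a b c : R) :
  a <= b -> 0 <= c -> {within `[a, b], continuous g} ->
  (forall t, a < t < b -> is_derive t 1 g (dg t)) ->
  (forall t, a < t < b -> `|dg t - d| <= c) ->
  `|g b - g a - (b - a) *: d| <= c * (b - a).
Proof.
move=> ab c0 gc gd dgc; pose l (t : R) := t *: d; pose h := g - l.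
have -> : g b - g a - (b - a) *: d = h b - h a.
  by rewrite /h /l !fctE scalerBl; apply/matrixP => i j; rewrite !mxE; ring.
apply: (@mean_value_mx _ _ h (fun t => dg t - d)) => //.
- move=> t; apply: (@continuousB _ _ (subspace `[a, b]) g l t (gc t)).
  by apply: continuous_subspaceT => s; exact: scalel_continuous.
- by move=> t tab; apply: is_deriveB; [exact: gd|exact: is_derive_scalel].
Qed.

(** Strict differentiability, with both endpoints moving. As [C1_on] gives continuity of the
    derivative one direction at a time, increments are combinations of finitely many vectors [e];
    for the vector field these are the spatial directions. *)
Lemma C1_strong_differential n m q (V : normedModType R) (U : set V)
    (g : V -> 'M[R]_(m, q)) (e : 'I_n -> V) (x : V) (eps : R) :
  C1_on U g -> U x -> 0 < eps ->
  exists2 dl : R, 0 < dl & forall (y : V) (w : 'rV[R]_n), `|y - x| < dl -> `|w| < dl ->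
    `|g (y + \sum_l w 0 l *: e l) - g y - 'd g x (\sum_l w 0 l *: e l)|
      <= eps * `|w|.
Proof.
move=> [oU dU cU] Ux eps0.
pose eps' := eps / (n%:R + 1).
have n10 : 0 < n%:R + 1 :> R by rewrite ltr_wpDl.
have eps'0 : 0 < eps' by rewrite divr_gt0.
have : \forall y \near x, U y /\ forall l, `|'d g y (e l) - 'd g x (e l)| < eps'.
  apply: filterI; first by apply: open_nbhs_nbhs.
  apply: filter_forall => l; have := cU (e l) x Ux.
  by move=> /cvgr_dist_lt/(_ _ eps'0); apply: filterS => y; rewrite distrC.
rewrite -nbhs_nearE => /nbhs_ballP[r /= r0 br].
have Ur y : `|y - x| < r -> U y /\ forall l, `|'d g y (e l) - 'd g x (e l)| < eps'.
  by move=> yx; apply: br; rewrite -ball_normE /ball_ /= distrC.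
pose c := \sum_l `|e l|; have c0 : 0 <= c by rewrite sumr_ge0.
(* Keeps the whole segment from [y] to [y + u] within distance [r] of [x]. *)
pose dl := r / (c + 1) / 2.
have c10 : 0 < c + 1 by rewrite ltr_wpDl.
have dl0 : 0 < dl by rewrite !divr_gt0.
exists dl => // y w yx wd; set u := \sum_l _.
have uc : `|u| <= c * `|w|.
  rewrite (le_trans (ler_norm_sum _ _ _))// mulr_suml ler_sum// => l _.
  by rewrite normrZ mulrC ler_wpM2l// mx_norm_coord.
have seg (s : R) : 0 <= s <= 1 -> `|y + s *: u - x| < r.
  move=> /andP[s0 s1]; rewrite addrAC (le_lt_trans (ler_normD _ _))//.
  rewrite normrZ ger0_norm//.
  have h1 : s * `|u| <= c * dl.
    apply: (@le_trans _ _ `|u|); first by rewrite ler_piMl.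
    by rewrite (le_trans uc)// ler_wpM2l// ltW.
  have h2 : dl * (c + 1) = r / 2 by rewrite /dl mulrAC divfK ?gt_eqF.
  have h3 : 0 <= c * dl by rewrite mulr_ge0// ltW.
  by rewrite mulrDr mulr1 in h2; nra.
have := @mean_value_mx m q (fun s => g (y + s *: u) - s *: 'd g x u)
  (fun s => 'd g (y + s *: u) u - 'd g x u) 0 1 (eps * `|w|) ler01 _ _ _ _.
rewrite scale1r scale0r addr0 scale1r scale0r !subr0 mulr1.
rewrite addrAC; apply.
- by rewrite mulr_ge0// ltW.
- apply: derivable_within_continuous => s; rewrite in_itv /= => s01.
  apply: derivableB; last by apply: diff_derivable.
  by apply: (@ex_derive _ _ _ _ _ _ _ (is_derive_line (dU _ _))); apply: (Ur _ _).1; exact: seg.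
- move=> s s01; apply: is_deriveB; last exact: is_derive_scalel.
  by apply: is_derive_line; apply: dU; apply: (Ur _ _).1; apply: seg; move: s01; lra.
- move=> s s01; have [|_ H] := Ur (y + s *: u); first by apply: seg; move: s01; lra.
  have dE p : 'd g p u = \sum_l w 0 l *: 'd g p (e l).
    by rewrite linear_sum; apply: eq_bigr => l _; rewrite linearZ.
  rewrite !dE -sumrB (le_trans (ler_norm_sum _ _ _))//.
  apply: (@le_trans _ _ (\sum_(l < n) eps' * `|w|)).
    apply: ler_sum => l _; rewrite -scalerBr normrZ mulrC.
    by rewrite ler_pM ?mx_norm_coord// ltW// H.
  rewrite sumr_const card_ord -mulr_natl mulrA ler_wpM2r// /eps' mulrCA ler_piMr ?(ltW eps0)//.
  by rewrite ler_pdivrMr// mul1r lerDl.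
Qed.

End MatrixCalculus.

Section MatrixLimits.
Variables (R : realType) (T : Type) (F : set_system T).
Context {FF : Filter F}.

Lemma cvg_mx m n (A : T -> 'M[R]_(m, n)) (L : 'M[R]_(m, n)) :
  (forall i j, A t i j @[t --> F] --> L i j) -> A @ F --> L.
Proof.
move=> AL; apply/cvgrPdist_le => /= e e0.
have : \forall t \near F, forall ij : 'I_m * 'I_n, `|L ij.1 ij.2 - A t ij.1 ij.2| <= e.
  by apply: filter_forall => -[i j] /=; move/cvgrPdist_le: (AL i j); exact.
apply: filterS => t H; apply: mx_norm_le => [|i j]; first exact: ltW.
by have := H (i, j); rewrite !mxE.
Qed.

Lemma cvg_mx_coord m n (A : T -> 'M[R]_(m, n)) (L : 'M[R]_(m, n)) i j :
  A @ F --> L -> A t i j @[t --> F] --> L i j.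
Proof.
move=> AL; exact: (@cvg_comp _ _ _ A (fun M : 'M[R]_(m, n) => M i j) _ _ _ AL
  (@coord_continuous _ _ _ i j L)).
Qed.

Lemma cvg_sumr (V : normedModType R) (I : Type) (r : seq I) (f : I -> T -> V) (l : I -> V) :
  (forall i, f i @ F --> l i) -> \sum_(i <- r) f i t @[t --> F] --> \sum_(i <- r) l i.
Proof.
move=> fl; elim: r => [|i r IH].
  by rewrite big_nil; under eq_fun do rewrite big_nil; exact: cvg_cst.
by rewrite big_cons; under eq_fun do rewrite big_cons; exact: cvgD.
Qed.

Lemma cvg_mulmx m n q (A : T -> 'M[R]_(m, n)) (B : T -> 'M[R]_(n, q))
    (L : 'M[R]_(m, n)) (M : 'M[R]_(n, q)) :
  A @ F --> L -> B @ F --> M -> A t *m B t @[t --> F] --> L *m M.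
Proof.
move=> AL BM; apply: cvg_mx => i j.
rewrite mxE; under eq_fun do rewrite mxE.
apply: cvg_sumr => k; apply: cvgM; exact: cvg_mx_coord.
Qed.

Lemma cvg_prodr (I : Type) (r : seq I) (f : I -> T -> R) (l : I -> R) :
  (forall i, f i @ F --> l i) -> \prod_(i <- r) f i t @[t --> F] --> \prod_(i <- r) l i.
Proof.
move=> fl; elim: r => [|i r IH].
  by rewrite big_nil; under eq_fun do rewrite big_nil; exact: cvg_cst.
by rewrite big_cons; under eq_fun do rewrite big_cons; exact: cvgM.
Qed.

Lemma cvg_det n (A : T -> 'M[R]_n) (L : 'M[R]_n) : A @ F --> L -> \det (A t) @[t --> F] --> \det L.
Proof.
move=> AL; apply: cvg_sumr => s; apply: cvgM; first exact: cvg_cst.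
apply: cvg_prodr => i.
exact: cvg_mx_coord.
Qed.

Lemma cvg_invmx n (A : T -> 'M[R]_n) (L : 'M[R]_n) : \det L != 0 -> A @ F --> L ->
  invmx (A t) @[t --> F] --> invmx L.
Proof.
move=> L0 AL; have dA := cvg_det AL.
have invE (B : 'M[R]_n) : \det B != 0 -> invmx B = (\det B)^-1 *: \adj B.
  by move=> B0; rewrite /invmx unitmxE unitfE B0.
rewrite invE//.
have /near_eq_cvg/cvg_trans : {near F, (fun t => (\det (A t))^-1 *: \adj (A t)) =1
    (fun t => invmx (A t))}.
  have : \forall t \near F, \det (A t) != 0 by exact: (cvgr_neq0 _ dA).
  by apply: filterS => t At; rewrite invE.
apply; apply: cvgZ; first exact: cvgV.
apply: cvg_mx => i j; rewrite mxE /cofactor.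
under eq_fun do rewrite mxE /cofactor.
apply: cvgM; first exact: cvg_cst.
apply: cvg_det; apply: cvg_mx => a b.
by rewrite !mxE; under eq_fun do rewrite !mxE; exact: cvg_mx_coord.
Qed.

End MatrixLimits.

Section CompactAndIntervals.
Variable R : realType.

Lemma compact_locally_bounded (V : normedModType R) (K : set V) (h : V -> R) :
  compact K ->
  (forall x, K x -> exists2 dl : R, 0 < dl & exists B : R,
    forall z, K z -> `|z - x| < dl -> h z <= B) ->
  exists B : R, forall z, K z -> h z <= B.
Proof.
move=> cK H.
have /choice[G HG] : forall x, exists G : R * R, K x -> 0 < G.1 /\
    forall z, K z -> `|z - x| < G.1 -> h z <= G.2.
  move=> x; case: (pselect (K x)) => [/H[dl dl0 [B HB]]|nK]; first by exists (dl, B).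
  by exists (0, 0).
have [|s sK scov] := compact_finite_balls (dl := fun x => (G x).1) cK.
  by move=> x /HG[].
exists (\sum_(x <- s) `|(G x).2|) => z Kz.
have [x xs zx] := scov z Kz.
have [_ /(_ z Kz zx) hz] := HG x (sK x xs).
rewrite (le_trans hz)// (big_rem x xs) /= (le_trans (ler_norm _))// lerDl.
by rewrite sumr_ge0.
Qed.

(** Real induction: the supremum of the [b] with [P 0 b] cannot stay below [tau]. The local
    hypothesis concerns only intervals that contain [t], where the estimates are centred. *)
Lemma interval_induction (P : R -> R -> Prop) (tau : R) : 0 < tau ->
  (forall a b c, 0 <= a -> a < b -> b < c -> c <= tau -> P a b -> P b c -> P a c) ->
  (forall t, 0 <= t <= tau -> exists2 dl : R, 0 < dl & forall u v,
    0 <= u -> u <= t -> t <= v -> u < v -> v <= tau -> v - u < dl -> P u v) ->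
  P 0 tau.
Proof.
move=> tau0 Padd Ploc.
pose S := [set b : R | 0 <= b <= tau /\ (b = 0 \/ P 0 b)].
have S0 : S 0 by split; [rewrite lexx ltW|left].
have hS : has_sup S.
  by split; [exists 0|exists tau => b [/andP[]]].
set c := sup S.
have c0 : 0 <= c by apply: sup_upper_bound.
have ct : c <= tau by apply: ge_sup; [exists 0|move=> b [/andP[]]].
have [|dl dl0 Hc] := Ploc c; first by rewrite c0.
have dl20 : 0 < dl / 2 by rewrite divr_gt0.
have [b Sb bc] := sup_adherent dl20 hS; rewrite -/c in bc.
have bc' : b <= c by apply: sup_upper_bound.
have [/andP[b0 bt] Pb] := Sb.
pose v := Num.min tau (c + dl / 2).
have vt : v <= tau by rewrite ge_min lexx.
have vc : v <= c + dl / 2 by rewrite ge_min lexx orbT.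
have cv : c <= v by rewrite le_min ct lerDl ltW.
have Sv : S v.
  split; first by rewrite vt (le_trans c0).
  have [bv|] := ltP b v; last first.
    by move=> vb; have <- : b = v by apply/eqP; rewrite eq_le vb (le_trans bc').
  right; have Pbv : P b v by apply: Hc => //; lra.
  case: Pb => [b00|Pb]; first by rewrite -b00.
  have [b00|bn0] := eqVneq b 0; first by rewrite -b00.
  by apply: (Padd 0 b v) => //; rewrite lt_neqAle eq_sym bn0.
have vc' : v <= c by apply: sup_upper_bound.
have vtau : v = tau.
  by move: vc' ; rewrite /v; case: (leP tau (c + dl / 2)) => //; lra.
move: Sv => [_]; rewrite vtau => -[t0|//].
by move: tau0; rewrite t0 ltxx.
Qed.

End CompactAndIntervals.

(** * Linearization along trajectories *)

Section Trajectories.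
Variables (R : realType) (n : nat).
Variables (f x : R -> 'rV[R]_n -> 'rV[R]_n) (D K : set 'rV[R]_n).
Variable Omega : set (R * 'rV[R]_n).
Hypothesis f_C1 : C1_on Omega (fun z : R * 'rV[R]_n => f z.1 z.2).
Hypothesis Omega_dom : forall t z, 0 <= t -> D z -> Omega (t, z).
Hypothesis x_sol : forall x0, D x0 -> is_solution f x0 (x ^~ x0).
Hypothesis K_sub : K `<=` D.
Hypothesis K_compact : compact K.
Hypothesis K_inv : strongly_invariant x K.

Implicit Types (t s u v tau : R) (y w : 'rV[R]_n).

Let F (z : R * 'rV[R]_n) := f z.1 z.2.
Local Notation J t z := (state_jacobian f t z).

Lemma flow_stays t y : 0 <= t -> K y -> K (x t y).
Proof. by move=> t0 Ky; rewrite (K_inv t0); exists y. Qed.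

Lemma flow_differentiable t y : 0 <= t -> K y -> differentiable F (t, y).
Proof. by move=> t0 Ky; have [_ H _] := f_C1; apply/H/Omega_dom => //; exact: K_sub. Qed.

Lemma diff_state t y w : 0 <= t -> K y -> 'd F (t, y) (0, w) = w *m (J t y)^T.
Proof.
move=> t0 Ky; rewrite /state_jacobian trmxK /jacobian mul_rV_lin1.
have dF := flow_differentiable t0 Ky.
pose l (z : 'rV[R]_n) := (t, z).
have dl : is_diff y l (fun w => (0, w)).
  by apply: is_diff_pair.
have dl' : differentiable l y by exact: ex_diff.
have dE : 'd l y = (fun w => (0, w)) :> ('rV[R]_n -> R * 'rV[R]_n) by exact: diff_val.
have -> : f t = F \o l by [].
by rewrite diff_comp//= dE.
Qed.

Lemma vector_field_bounded tau : exists2 M : R, 0 <= M &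
  forall t y, 0 <= t <= tau -> K y -> `|f t y| <= M.
Proof.
have cI : compact (`[0, tau]%classic `*` K : set (R * 'rV[R]_n)).
  by apply: compact_setX => //; exact: segment_compact.
have [[t y] [/= tI Ky]|B HB] := compact_locally_bounded (h := fun z => `|F z|) cI.
  have t0 : 0 <= t by move: tI; rewrite in_itv /= => /andP[].
  have /differentiable_continuous/cvgr_dist_lt/(_ 1 ltr01) := flow_differentiable t0 Ky.
  move=> /nbhs_ballP[r /= r0 br]; exists r => //; exists (`|F (t, y)| + 1) => z _ zr.
  have /ltW : `|F (t, y) - F z| < 1.
    by apply: br; rewrite -ball_normE /ball_ /= distrC.
  have := ler_normD (F (t, y)) (F z - F (t, y)).
  by rewrite addrC subrK [`|F z - _|]distrC => h1 h2; rewrite (le_trans h1)// lerD2l.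
exists `|B| => // t y tI Ky; apply: le_trans (ler_norm _).
by apply: (HB (t, y)); split=> //=; rewrite in_itv.
Qed.

Lemma flow_continuous y u v : 0 <= u -> K y -> {within `[u, v], continuous (x ^~ y)}.
Proof.
move=> u0 /K_sub/x_sol[_ yc _]; apply: continuous_subspaceW yc.
by move=> s /=; rewrite !in_itv /= andbT => /andP[us _]; exact: le_trans us.
Qed.

Lemma flow_derive y s : 0 < s -> K y -> is_derive s 1 (x ^~ y) (f s (x s y)).
Proof. by move=> s0 /K_sub/x_sol[_ _ H]; exact: H. Qed.

Lemma flow_lipschitz tau M y u v :
  0 <= M -> (forall t y, 0 <= t <= tau -> K y -> `|f t y| <= M) ->
  K y -> 0 <= u -> u <= v -> v <= tau -> `|x v y - x u y| <= M * (v - u).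
Proof.
move=> M0 HM Ky u0 uv vt.
apply: (@mean_value_mx _ _ _ (x ^~ y) (fun s => f s (x s y))) => //.
- exact: flow_continuous.
- by move=> s /andP[us _]; apply: flow_derive => //; exact: le_lt_trans us.
- move=> s /andP[us sv]; have s0 : 0 <= s by rewrite (le_trans u0)// ltW.
  by apply: HM; [rewrite s0 (le_trans _ vt)// ltW|exact: flow_stays].
Qed.

Lemma prod_norm_lt (a : R) (b : 'rV[R]_n) (r : R) : `|a| < r -> `|b| < r ->
  `|(a, b) : R * 'rV[R]_n| < r.
Proof. by move=> ar br; rewrite [ltLHS]/Num.norm /= gt_max ar. Qed.

(** The estimates are uniform in the pair of trajectories because they come from strict
    differentiability of the field at the single point [(t, x t x0)]. *)
Lemma local_linearization tau x0 t L eps : K x0 -> 0 <= t <= tau -> 0 < eps ->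
  mnorm (J t (x t x0)) <= L ->
  exists2 dl : R, 0 < dl & forall u v, 0 <= u -> u <= t -> t <= v -> u < v ->
    v <= tau -> v - u < dl -> forall y z, K y -> K z ->
    `|x u y - x u x0| < dl -> `|x u z - x u x0| < dl ->
    let w := x u y - x u z in
    `|x v y - x v z| <= (1 + 2 * (L + 1) * (v - u)) * `|w| /\
    `|x v y - x v z - w - (v - u) *: (w *m (J t (x t x0))^T)|
      <= eps * (v - u) * `|w|.
Proof.
move=> Kx0 /andP[t0 tt] eps0 AL; set A := J t (x t x0) in AL *.
have L0 : 0 <= L := le_trans (mnorm_ge0 _) AL.
have L10 : 0 < L + 1 by rewrite ltr_wpDl.
have [M M0 HM] := vector_field_bounded tau.
pose eps1 := Num.min 1 (eps / 4).
have eps10 : 0 < eps1 by rewrite lt_min ltr01 divr_gt0.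
have eps11 : eps1 <= 1 by rewrite ge_min lexx.
have eps14 : eps1 <= eps / 4 by rewrite ge_min lexx orbT.
have Otx : Omega (t, x t x0).
  by apply: Omega_dom => //; apply/K_sub/flow_stays.
pose e (l : 'I_n) : R * 'rV[R]_n := (0, delta_mx 0 l).
have [d1 d10 Hd1] := C1_strong_differential e f_C1 Otx eps10.
have M10 : 0 < M + 1 by rewrite ltr_wpDl.
(* In this order, the four bounds keep the drift in time and the initial distances within [d1 / 4],
   the growth [(L + 1) h] below 1/2, and the second-order term below [eps / 2]. *)
pose dl := Num.min (Num.min (d1 / 4 / (M + 1)) (d1 / 4))
  (Num.min (1 / 2 / (L + 1)) (eps / 4 / (L + 1) ^+ 2)).
have dl0 : 0 < dl by rewrite !lt_min !divr_gt0// exprn_gt0.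
exists dl => // u v u0 ut tv uv vt; set h := v - u => hdl y z Ky Kz yu zu w.
have h0 : 0 < h by rewrite subr_gt0.
have [hM hd1 hL heps] : [/\ M * h < d1 / 4, dl <= d1 / 4, (L + 1) * h <= 1 / 2 &
    2 * L * (L + 1) * h <= eps / 2].
  move: hdl; rewrite /dl !lt_min => /andP[/andP[h1 h2] /andP[h3 h4]]; split.
  - rewrite ltr_pdivlMr// in h1; rewrite (le_lt_trans _ h1)// mulrC.
    by rewrite ler_wpM2l ?(ltW h0)// lerDl.
  - by rewrite !ge_min lexx orbT.
  - by rewrite ltr_pdivlMr// in h3; rewrite mulrC ltW.
  - rewrite ltr_pdivlMr ?exprn_gt0// in h4.
    have : L * (L + 1) * h <= h * (L + 1) ^+ 2.
      by rewrite mulrC ler_wpM2l ?(ltW h0)// expr2 ler_wpM2r ?(ltW L10)// lerDl.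
    by move=> h5; rewrite -!mulrA mulrA in h5 *; lra.
pose W s := x s y - x s z.
have Wu : W u = w by [].
have pos q s : K q -> `|x u q - x u x0| < dl -> u <= s -> s <= v ->
    `|x s q - x t x0| < d1.
  move=> Kq qu us sv.
  have h1 : `|x s q - x u q| <= M * h.
    rewrite (le_trans (flow_lipschitz M0 HM Kq u0 us (le_trans sv vt)))//.
    by rewrite ler_wpM2l// /h lerD2r.
  have h2 : `|x u x0 - x t x0| <= M * h.
    rewrite distrC (le_trans (flow_lipschitz M0 HM Kx0 u0 ut tt))//.
    by rewrite ler_wpM2l// /h lerD2r.
  have -> : x s q - x t x0 = (x s q - x u q) + (x u q - x u x0) + (x u x0 - x t x0).
    by apply/matrixP => i j; rewrite !mxE; ring.
  rewrite (le_lt_trans (ler_normD _ _))// (le_lt_trans (lerD (ler_normD _ _) (lexx _)))//.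
  lra.
have Wd1 s : u <= s -> s <= v -> `|W s| < d1.
  move=> us sv.
  have lip q : K q -> `|x s q - x u q| <= M * h.
    move=> Kq; rewrite (le_trans (flow_lipschitz M0 HM Kq u0 us (le_trans sv vt)))//.
    by rewrite ler_wpM2l// /h lerD2r.
  have -> : W s = (x s y - x u y) - (x s z - x u z) + ((x u y - x u x0) - (x u z - x u x0)).
    by rewrite /W; apply/matrixP => i j; rewrite !mxE; ring.
  rewrite (le_lt_trans (ler_normD _ _))//.
  rewrite (le_lt_trans (lerD (ler_normB _ _) (ler_normB _ _)))//.
  have := lip y Ky; have := lip z Kz; lra.
have eE (v' : 'rV[R]_n) : \sum_l v' 0 l *: e l = (0, v').
  rewrite [in RHS](row_sum_delta v'); elim: (index_enum _) => [|l r IH].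
    by rewrite !big_nil.
  by rewrite !big_cons IH; congr (_, _); rewrite /= scaler0 addr0.
have fW s : u <= s -> s <= v ->
    `|f s (x s y) - f s (x s z) - W s *m A^T| <= eps1 * `|W s|.
  move=> us sv; have := Hd1 (s, x s z) (W s) _ (Wd1 s us sv).
  rewrite eE (diff_state (W s) t0 (flow_stays t0 Kx0)) -/A /=.
  rewrite addr0 (addrC (x s z)) subrK; apply.
  apply: prod_norm_lt; last exact: pos.
  change (`|s - t| < d1); have : h < d1 by rewrite (lt_trans hdl)// (le_lt_trans hd1)//; lra.
  by rewrite /h => hd; rewrite ltr_norml; apply/andP; split; lra.
have WA (v' : 'rV[R]_n) : `|v' *m A^T| <= L * `|v'|.
  by rewrite (le_trans (mulmx_rv_norm _ _))// mnorm_tr mulrC ler_wpM2r.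
have fWL s : u <= s -> s <= v -> `|f s (x s y) - f s (x s z)| <= (L + 1) * `|W s|.
  move=> us sv; rewrite -(subrK (W s *m A^T) (f s (x s y) - f s (x s z))).
  rewrite (le_trans (ler_normD _ _))// mulrDl addrC lerD ?WA//.
  by rewrite (le_trans (fW s us sv))// ler_wpM2r.
have Wc s : {within `[u, s], continuous W}.
  by move=> r; apply: continuousB; exact: flow_continuous.
have Wd s : u < s -> is_derive s 1 W (f s (x s y) - f s (x s z)).
  by move=> us; apply: is_deriveB; apply: flow_derive => //; exact: le_lt_trans us.
(* The maximum of the distance over the interval takes the place of Gronwall's inequality. *)
have [c cuv cmax] : exists2 c, u <= c <= v & forall s, u <= s <= v -> `|W s| <= `|W c|.
  have [r|c cI cmax] := @EVT_max R (fun s => `|W s|) u v (ltW uv).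
    apply: (@continuous_comp _ _ _ (from_subspace `[u, v] W) (fun w => `|w|) r (Wc v r)).
    exact: norm_continuous.
  by exists c => [|s sI]; [move: cI|apply: cmax]; rewrite in_itv.
set m := `|W c| in cmax.
have Wm s : u <= s -> s <= v -> `|W s| <= m by move=> us sv; rewrite cmax// us.
have m0 : 0 <= m := normr_ge0 _.
have Wlip s : u <= s -> s <= v -> `|W s - W u| <= (L + 1) * m * h.
  move=> us sv; apply: (@le_trans _ _ ((L + 1) * m * (s - u))); last first.
    by rewrite ler_wpM2l ?mulr_ge0 ?(ltW L10)// lerD2r.
  apply: (@mean_value_mx _ _ _ W (fun s => f s (x s y) - f s (x s z))) => //.
  - by rewrite mulr_ge0// ltW.
  - by move=> r /andP[ur _]; exact: Wd.
  - move=> r /andP[ur rs]; have rv : r <= v by rewrite (le_trans (ltW rs)).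
    by rewrite (le_trans (fWL r (ltW ur) rv))// ler_wpM2l ?(ltW L10)// Wm// ltW.
have mw : m <= (1 + 2 * (L + 1) * h) * `|w|.
  have /andP[uc cv] := cuv; have := Wlip c uc cv.
  have := ler_normD (W c - W u) (W u); rewrite subrK -/m Wu => h1 h2.
  have {h1 h2} : m <= (L + 1) * h * m + `|w|.
    by rewrite (le_trans h1)// lerD2r mulrAC.
  have : 0 <= (L + 1) * h by rewrite mulr_ge0 ?ltW.
  have : 0 <= `|w| by [].
  (* That is, [b / (1 - a) <= (1 + 2 a) b] for [a <= 1 / 2]. *)
  have key (a b q : R) : 0 <= q -> 0 <= b -> a <= 1 / 2 -> 0 <= a ->
      q <= a * q + b -> q <= (1 + 2 * a) * b.
    move=> q0 b0 a12 a0 qab.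
    have : 0 <= a * (1 - 2 * a) * q by rewrite !mulr_ge0//; lra.
    have : 0 <= (1 + 2 * a) * (b - (1 - a) * q) by rewrite mulr_ge0//; lra.
    lra.
  by move=> w0 a0; rewrite -(mulrA 2); exact: key.
have m2 : m <= 2 * `|w|.
  rewrite (le_trans mw)// ler_wpM2r// -mulrA; lra.
split.
  by rewrite (le_trans _ mw)// Wm// ltW.
have <- : W u = w by []; rewrite mulrAC Wu.
apply: (@mean_value_drift_mx _ _ _ W (fun s => f s (x s y) - f s (x s z)));
  [exact: ltW|by rewrite mulr_ge0// ltW|exact: Wc|by move=> s /andP[us _]; exact: Wd|].
move=> s /andP[/ltW us /ltW sv].
have -> : f s (x s y) - f s (x s z) - w *m A^T =
    (f s (x s y) - f s (x s z) - W s *m A^T) + (W s - W u) *m A^T.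
  rewrite (mulmxBl (W s) (W u) A^T) Wu.
  by move: (W s *m _) (w *m _) => a b; rewrite addrA subrK.
rewrite (le_trans (ler_normD _ _))//.
have h1 : eps1 * `|W s| <= eps / 4 * (2 * `|w|).
  by rewrite ler_pM ?(ltW eps10)// (le_trans (Wm s us sv)).
have h2 : L * `|W s - W u| <= (2 * L * (L + 1) * h) * `|w|.
  rewrite (le_trans (ler_wpM2l L0 (Wlip s us sv)))//.
  have : L * ((L + 1) * m * h) = L * (L + 1) * h * m by ring.
  move=> ->; rewrite (le_trans (ler_wpM2l _ m2)) ?mulr_ge0 ?(ltW L10) ?(ltW h0)//.
  by rewrite le_eqVlt; apply/orP; left; apply/eqP; ring.
have h3 : (2 * L * (L + 1) * h) * `|w| <= eps / 2 * `|w| by rewrite ler_wpM2r.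
have := fW s us sv; have := WA (W s - W u); lra.
Qed.

End Trajectories.

(** * Growth of the compounds over one step *)

Section CompoundNorm.
Variables (R : realType) (n k : nat) (s : R) (p : \bar R).
Hypothesis p1 : (1 <= p)%E.
Hypotheses (s0 : 0 <= s) (s1 : s < 1).

Definition compound_norm (M : 'M[R]_n) : R :=
  lp_mxnorm p (mcompound k M) `^ (1 - s) * lp_mxnorm p (mcompound k.+1 M) `^ s.

Lemma compound_norm_ge0 M : 0 <= compound_norm M.
Proof. by rewrite mulr_ge0 ?powR_ge0. Qed.

Lemma compound_normM M M' :
  compound_norm (M *m M') <= compound_norm M * compound_norm M'.
Proof.
have key (r a b c : R) : 0 <= r -> 0 <= a -> 0 <= b -> 0 <= c -> c <= a * b ->
    c `^ r <= a `^ r * b `^ r.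
  by move=> r0 a0 b0 c0 cab; rewrite -powRM// ge0_ler_powR// nnegrE mulr_ge0.
have s1' : 0 <= 1 - s by rewrite subr_ge0 ltW.
rewrite /compound_norm mulrACA; apply: ler_pM; [exact: powR_ge0|exact: powR_ge0| |];
  apply: key; rewrite ?mcompoundM; first [exact: s0|exact: s1'|exact: lp_mxnorm_ge0|exact: lp_mxnormM].
Qed.

(** The perturbation [E] is there because a scaled step is [1 + h A] only up to [h] times a small
    matrix. *)
Lemma lp_mxnorm_compound_step j (A : 'M[R]_n) (eps : R) : (j <= n)%N -> 0 < eps ->
  exists2 dl : R, 0 < dl & forall (h : R) (E : 'M[R]_n), 0 < h -> h < dl ->
    mnorm E <= dl ->
    lp_mxnorm p (mcompound j (1%:M + h *: (A + E)))
      <= 1 + h * (lp_measure p (acompound j A) + eps).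
Proof.
move=> jn eps0.
have [C C0 HC] := @mcompound_linearization R n j.
have [C' C'0 HC'] := @acompound_bounded R n j.
have bin0 : (0 < 'C(n, j))%N by rewrite bin_gt0.
have e2 : 0 < eps / 2 by rewrite divr_gt0.
have [h0 h00 Hh] := lp_measure_upper p1 (acompound j A) bin0 e2.
pose m := mnorm A + 1.
have m0 : 0 < m by rewrite ltr_wpDl// mnorm_ge0.
pose dl := Num.min (Num.min h0 (1 / m)) (Num.min (Num.min 1 (eps / 4 / (C' + 1)))
  (eps / 4 / (C * m ^+ 2 + 1))).
have C1 : 0 < C' + 1 by rewrite ltr_wpDl.
have C2 : 0 < C * m ^+ 2 + 1 by rewrite ltr_wpDl// mulr_ge0// exprn_ge0// ltW.
have dl0 : 0 < dl by rewrite !lt_min ltr01 h00 !divr_gt0.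
exists dl => // h E hp hdl Edl.
have [hh0 hm E1 EC hC] : [/\ h <= h0, h * m <= 1, mnorm E <= 1,
    C' * mnorm E <= eps / 4 & h * (C * m ^+ 2) <= eps / 4].
  move: hdl Edl; rewrite /dl !lt_min !le_min.
  move=> /andP[/andP[a1 a2] /andP[_ a4]] /andP[_ /andP[/andP[b1 b2] _]]; split => //.
  - exact: ltW.
  - by rewrite ltW// -ltr_pdivlMr.
  - rewrite ler_pdivlMr// in b2; rewrite (le_trans _ b2)// mulrC ler_wpM2l ?mnorm_ge0//.
    by rewrite lerDl.
  - rewrite ltr_pdivlMr// in a4; rewrite (le_trans _ (ltW a4))// ler_wpM2l ?(ltW hp)//.
    by rewrite lerDl.
have AE : mnorm (A + E) <= m by rewrite (le_trans (mnormD _ _))// lerD2l.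
have hAE : mnorm (h *: (A + E)) <= h * m.
  by rewrite mnormZ gtr0_norm// ler_wpM2l// ltW.
have HR := HC (h *: (A + E)) (le_trans hAE hm).
set Rem := mcompound j _ - _ - _ in HR.
have -> : mcompound j (1%:M + h *: (A + E)) =
    (1%:M + h *: acompound j A) + (h *: acompound j E + Rem).
  rewrite /Rem; move: (mcompound j _) => d.
  rewrite acompoundZ acompoundD scalerDr; move: (_ *: _) (_ *: _) (1%:M) => a b c.
  by apply/matrixP => i i'; rewrite !mxE; ring.
rewrite (le_trans (lp_mxnormD p1 _ _))//.
have b1 := Hh h hp hh0.
have b2 : lp_mxnorm p (h *: acompound j E + Rem) <= h * (eps / 4) + h * (eps / 4).
  rewrite (le_trans (lp_mxnorm_mnorm p1 _))// (le_trans (mnormD _ _))// lerD//.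
    rewrite mnormZ gtr0_norm// ler_wpM2l ?(ltW hp)//; exact: le_trans (HC' E) EC.
  rewrite (le_trans HR)// (@le_trans _ _ (C * (h * m) ^+ 2))//.
    by rewrite ler_wpM2l// lerXn2r ?nnegrE ?mnorm_ge0 ?mulr_ge0 ?(ltW hp) ?(ltW m0).
  by rewrite exprMn mulrCA expr2 -mulrA ler_wpM2l ?(ltW hp).
have : h * (eps / 4) + h * (eps / 4) = h * (eps / 2) by field.
lra.
Qed.

(** By [1 + b <= expR b] the exponents of the two factors add up with weights [1 - s] and [s], and
    [lp_measure_alpha_ge] bounds the weighted sum. *)
Lemma compound_norm_step (A : 'M[R]_n) (eps : R) : (k < n)%N -> 0 < eps ->
  exists2 dl : R, 0 < dl & forall (h : R) (E : 'M[R]_n), 0 < h -> h < dl ->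
    mnorm E <= dl -> compound_norm (1%:M + h *: (A + E))
      <= expR (h * (lp_measure p (alpha_acompound k s A) + eps)).
Proof.
move=> kn eps0.
have [d1 d10 H1] := lp_mxnorm_compound_step A (ltnW kn) eps0.
have [d2 d20 H2] := lp_mxnorm_compound_step A kn eps0.
exists (Num.min d1 d2) => [|h E h0]; first by rewrite lt_min d10.
rewrite lt_min le_min => /andP[hd1 hd2] /andP[E1 E2].
have exp_le (c b r : R) : 0 <= r -> 0 <= c -> c <= 1 + b -> c `^ r <= expR (b * r).
  move=> r0 c0 cb; rewrite expRM ge0_ler_powR ?nnegrE ?expR_ge0//.
  by rewrite (le_trans cb)// expR_ge1Dx.
have s1' : 0 <= 1 - s by rewrite subr_ge0 ltW.
have b1 := exp_le _ _ _ s1' (lp_mxnorm_ge0 p1 _) (H1 h E h0 hd1 E1).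
have b2 := exp_le _ _ _ s0 (lp_mxnorm_ge0 p1 _) (H2 h E h0 hd2 E2).
rewrite /compound_norm (le_trans (ler_pM _ _ b1 b2)) ?powR_ge0//.
rewrite -expRD ler_expR.
have := lp_measure_alpha_ge A p1 s0 s1 kn.
set a := lp_measure p (alpha_acompound k s A).
set b := lp_measure p (acompound k A); set c := lp_measure p (acompound k.+1 A).
move=> H; rewrite (_ : _ + _ = h * ((1 - s) * b + s * c + eps)); last by ring.
by rewrite ler_wpM2l ?(ltW h0)// lerD2r.
Qed.

End CompoundNorm.

Section SegmentIntegral.
Variable R : realType.
Implicit Types (g : R -> R) (a b c m tau : R).
Local Notation mu := (@lebesgue_measure R).

Lemma segment_integrable g a b : {within `[a, b], continuous g} ->
  mu.-integrable `[a, b] (EFin \o g).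
Proof. by apply: continuous_compact_integrable; exact: segment_compact. Qed.

Lemma Rintegral_segment_add g a b c : a <= b -> b <= c ->
  {within `[a, c], continuous g} ->
  \int[mu]_(t in `[a, b]) g t + \int[mu]_(t in `[b, c]) g t = \int[mu]_(t in `[a, c]) g t.
Proof.
move=> ab bc /segment_integrable gi.
rewrite -(@Rintegral_itv_obnd_cbnd _ b (BRight c)); last first.
  by apply: integrableS gi => // t /=; rewrite !in_itv /= => /andP[bt ->]; rewrite (le_trans ab)// ltW.
by rewrite -(@Rintegral_itvB _ g (BLeft a) (BRight c) b gi) ?bnd_simp// addrC subrK.
Qed.

Lemma Rintegral_segment_ge g a b m : a <= b -> {within `[a, b], continuous g} ->
  (forall t, a <= t <= b -> m <= g t) -> m * (b - a) <= \int[mu]_(t in `[a, b]) g t.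
Proof.
move=> ab /segment_integrable gi gm.
apply: (@le_trans _ _ (\int[mu]_(t in `[a, b]) cst m t)).
  rewrite Rintegral_cst//= lebesgue_measure_itv /= lte_fin.
  by case: ltgtP ab => //= ->; rewrite subrr.
apply: le_Rintegral => //; first by apply: segment_integrable => ?; exact: cvg_cst.
Qed.

End SegmentIntegral.

Section ScaledFlow.
Variables (R : realType) (n : nat).
Variables (f x : R -> 'rV[R]_n -> 'rV[R]_n) (D K : set 'rV[R]_n).
Variables (Omega : set (R * 'rV[R]_n)) (U : set 'rV[R]_n) (Theta : 'rV[R]_n -> 'M[R]_n).
Hypothesis f_C1 : C1_on Omega (fun z : R * 'rV[R]_n => f z.1 z.2).
Hypothesis Omega_dom : forall t z, 0 <= t -> D z -> Omega (t, z).
Hypothesis x_sol : forall x0, D x0 -> is_solution f x0 (x ^~ x0).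
Hypothesis K_sub : K `<=` D.
Hypothesis K_compact : compact K.
Hypothesis K_inv : strongly_invariant x K.
Hypothesis K_U : K `<=` U.
Hypothesis Theta_C1 : C1_on U Theta.
Hypothesis Theta_det : forall z, K z -> \det (Theta z) != 0.
Implicit Types (t s u v tau : R) (y w : 'rV[R]_n).

Local Notation J t z := (state_jacobian f t z).
Local Notation within_time tau t := (within `[0, tau]%classic (nbhs (t : R))).

Lemma Theta_differentiable z : K z -> differentiable Theta z.
Proof. by move=> Kz; have [_ H _] := Theta_C1; apply/H/K_U. Qed.

Lemma scaling_derivativeE t z : K z -> scaling_derivative f Theta t z = 'd Theta z (f t z).
Proof.
move=> /Theta_differentiable dT; apply/matrixP => i j; rewrite mxE.
rewrite [in RHS](row_sum_delta (f t z)) linear_sum summxE.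
apply: eq_bigr => l _; rewrite linearZ !mxE mulrC; congr (_ * _).
by rewrite -deriveE// derive_mx ?mxE//; exact: diff_derivable.
Qed.

(** Limits are taken within the interval [[0, tau]], as the flow is only controlled for nonnegative
    times. *)
Lemma flow_cvg tau x0 t : K x0 -> 0 <= t <= tau ->
  x s x0 @[s --> within_time tau t] --> x t x0.
Proof.
move=> Kx0 /andP[t0 tt].
have [M M0 HM] := vector_field_bounded f_C1 Omega_dom K_sub K_compact tau.
apply/cvgrPdist_le => /= e e0.
have M10 : 0 < M + 1 by rewrite ltr_wpDl.
have : \forall s \near t, `|t - s| < e / (M + 1).
  apply/nbhs_ballP; exists (e / (M + 1)) => [|s] /=; first by rewrite divr_gt0.
  by rewrite -ball_normE.
apply: filterS => s; rewrite ltr_pdivlMr// => ts; rewrite /= in_itv /= => /andP[s0 st].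
have lip := flow_lipschitz x_sol K_sub K_inv M0 HM Kx0.
have key : `|x t x0 - x s x0| <= M * `|t - s|.
  have [ts'|st'] := leP s t; first by rewrite (le_trans (lip _ _ s0 ts' tt))// ler_wpM2l// ler_norm.
  by rewrite distrC (le_trans (lip _ _ t0 (ltW st') st))// ler_wpM2l// distrC ler_norm.
rewrite (le_trans key)// (le_trans _ (ltW ts))// mulrC ler_wpM2l// lerDl ler01//.
Qed.

Lemma path_cvg tau x0 t : K x0 -> 0 <= t <= tau ->
  (s, x s x0) @[s --> within_time tau t] --> (t, x t x0).
Proof.
move=> Kx0 tI.
have ht : s @[s --> within_time tau t] --> t by exact: cvg_within.
exact: (cvg_pair ht (flow_cvg Kx0 tI)).
Qed.

Lemma Omega_path x0 t : K x0 -> 0 <= t -> Omega (t, x t x0).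
Proof. by move=> Kx0 t0; apply: Omega_dom => //; apply/K_sub/(flow_stays K_inv). Qed.

Lemma vector_field_cvg tau x0 t : K x0 -> 0 <= t <= tau ->
  f s (x s x0) @[s --> within_time tau t] --> f t (x t x0).
Proof.
move=> Kx0 tI; have /andP[t0 _] := tI.
have [_ dF _] := f_C1; have cF := differentiable_continuous (dF _ (Omega_path Kx0 t0)).
exact: (@cvg_comp _ _ _ (fun s => (s, x s x0)) (fun z : R * 'rV[R]_n => f z.1 z.2)
  _ _ _ (path_cvg Kx0 tI) cF).
Qed.

Lemma within_time_domain tau t : \forall s \near within_time tau t, 0 <= s <= tau.
Proof. by apply: (filterS _ (withinT _ _)) => s; rewrite /= in_itv. Qed.

(** The derivative is continuous in each fixed direction, and the directions [(0, delta_mx 0 j)]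
    recover the Jacobian entry by entry. *)
Lemma jacobian_cvg tau x0 t : K x0 -> 0 <= t <= tau ->
  J s (x s x0) @[s --> within_time tau t] --> J t (x t x0).
Proof.
move=> Kx0 tI; have /andP[t0 _] := tI.
have [_ _ cF] := f_C1.
pose dF j z := 'd (fun z : R * 'rV[R]_n => f z.1 z.2) z (0, delta_mx 0 j).
have JE s i j : 0 <= s -> J s (x s x0) i j = dF j (s, x s x0) 0 i.
  move=> s0; rewrite /dF.
  rewrite (diff_state f_C1 Omega_dom K_sub (delta_mx 0 j) s0 (flow_stays K_inv s0 Kx0)).
  by rewrite -rowE !mxE.
suff key (G : R -> 'M[R]_n) :
    (forall s i j, 0 <= s -> G s i j = dF j (s, x s x0) 0 i) ->
    G s @[s --> within_time tau t] --> G t.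
  exact: (key (fun s => J s (x s x0)) JE).
move=> GE; apply: cvg_mx => i j; rewrite (GE t)//.
have /near_eq_cvg/cvg_trans : {near within_time tau t,
    (fun s => dF j (s, x s x0) 0 i) =1 (fun s => G s i j)}.
  by apply: filterS (within_time_domain tau t) => s /andP[s0 _]; rewrite GE.
apply; apply: (@cvg_mx_coord _ _ _ _ _ (fun s => dF j (s, x s x0))).
exact: (@cvg_comp _ _ _ (fun s => (s, x s x0)) (dF j)
  _ _ _ (path_cvg Kx0 tI) (cF _ _ (Omega_path Kx0 t0))).
Qed.

Lemma Theta_cvg tau x0 t : K x0 -> 0 <= t <= tau ->
  Theta (x s x0) @[s --> within_time tau t] --> Theta (x t x0).
Proof.
move=> Kx0 tI; have /andP[t0 _] := tI.
have cT := differentiable_continuous (Theta_differentiable (flow_stays K_inv t0 Kx0)).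
exact: (@cvg_comp _ _ _ (x ^~ x0) Theta _ _ _ (flow_cvg Kx0 tI) cT).
Qed.

Lemma invTheta_cvg tau x0 t : K x0 -> 0 <= t <= tau ->
  invmx (Theta (x s x0)) @[s --> within_time tau t] --> invmx (Theta (x t x0)).
Proof.
move=> Kx0 tI; have /andP[t0 _] := tI.
by apply: cvg_invmx; [exact/Theta_det/(flow_stays K_inv)|exact: Theta_cvg].
Qed.

Lemma generalized_jacobian_cvg tau x0 t : K x0 -> 0 <= t <= tau ->
  generalized_jacobian f Theta s (x s x0) @[s --> within_time tau t]
    --> generalized_jacobian f Theta t (x t x0).
Proof.
move=> Kx0 tI; have /andP[t0 _] := tI.
rewrite /generalized_jacobian; apply: cvgD; apply: cvg_mulmx; try exact: invTheta_cvg; last first.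
  by apply: cvg_mulmx; [exact: Theta_cvg|exact: jacobian_cvg].
have [_ _ cT] := Theta_C1.
have SE s : 0 <= s -> scaling_derivative f Theta s (x s x0) =
    \sum_l f s (x s x0) 0 l *: 'd Theta (x s x0) (delta_mx 0 l).
  move=> s0; rewrite (scaling_derivativeE s (flow_stays K_inv s0 Kx0)).
  rewrite [in LHS](row_sum_delta (f s (x s x0))) linear_sum.
  by apply: eq_bigr => l _; rewrite linearZ.
rewrite (SE t t0).
have /near_eq_cvg/cvg_trans : {near within_time tau t,
    (fun s => \sum_l f s (x s x0) 0 l *: 'd Theta (x s x0) (delta_mx 0 l)) =1
    (fun s => scaling_derivative f Theta s (x s x0))}.
  by apply: filterS (within_time_domain tau t) => s /andP[s0 _]; rewrite SE.
apply; apply: cvg_sumr => l; apply: cvgZ.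
  by apply: cvg_mx_coord; exact: vector_field_cvg.
exact: (@cvg_comp _ _ _ (x ^~ x0) (fun z => 'd Theta z (delta_mx 0 l)) _ _ _
  (flow_cvg Kx0 tI) (cT _ _ (K_U (flow_stays K_inv t0 Kx0)))).
Qed.


Lemma near_time tau t (P : R -> Prop) : (\forall s \near within_time tau t, P s) ->
  exists2 dl : R, 0 < dl & forall s, 0 <= s <= tau -> `|s - t| < dl -> P s.
Proof.
move=> /nbhs_ballP[dl /= dl0 H]; exists dl => // s sI st.
by apply: H; rewrite /= ?in_itv//= -ball_normE /ball_ /= distrC.
Qed.

Lemma cvg_time (V : normedModType R) tau t (h : R -> V) (l : V) (e : R) :
  h s @[s --> within_time tau t] --> l -> 0 < e ->
  exists2 dl : R, 0 < dl & forall s, 0 <= s <= tau -> `|s - t| < dl -> `|h s - l| <= e.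
Proof.
move=> /cvgrPdist_le H e0; have /near_time[dl dl0 Hdl] := H e e0.
by exists dl => // s sI st; rewrite distrC; exact: Hdl.
Qed.

(** Accounts for the first term of the generalized Jacobian: along a trajectory [Theta] moves with
    velocity [scaling_derivative]. *)
Lemma Theta_increment tau x0 t (eta : R) : K x0 -> 0 <= t <= tau -> 0 < eta ->
  exists2 dl : R, 0 < dl & forall u v, 0 <= u -> u <= t -> t <= v -> u < v ->
    v <= tau -> v - u < dl ->
    `|Theta (x v x0) - Theta (x u x0) -
        (v - u) *: scaling_derivative f Theta t (x t x0)| <= (v - u) * eta.
Proof.
move=> Kx0 tI eta0; have /andP[t0 tt] := tI.
have KX s : 0 <= s -> K (x s x0) by move=> s0; exact: (flow_stays K_inv s0 Kx0).
rewrite scaling_derivativeE; last exact: KX.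
have [M M0 HM] := vector_field_bounded f_C1 Omega_dom K_sub K_compact tau.
have lip := flow_lipschitz x_sol K_sub K_inv M0 HM Kx0.
set X := x t x0; set ft := f t X.
pose c := \sum_(l < n) `|'d Theta X (delta_mx 0 l)|.
have c0 : 0 <= c by rewrite sumr_ge0.
have dB (w : 'rV[R]_n) : `|'d Theta X w| <= c * `|w|.
  rewrite [in leLHS](row_sum_delta w) linear_sum (le_trans (ler_norm_sum _ _ _))//.
  rewrite mulr_suml ler_sum// => l _; rewrite linearZ normrZ mulrC ler_wpM2l//.
  exact: mx_norm_coord.
have M10 : 0 < M + 1 by rewrite ltr_wpDl.
have c10 : 0 < c + 1 by rewrite ltr_wpDl.
pose e1 := eta / 2 / (M + 1); pose e2 := eta / 2 / (c + 1).
have e10 : 0 < e1 by rewrite !divr_gt0.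
have e20 : 0 < e2 by rewrite !divr_gt0.
have [d1 d10 H1] := C1_strong_differential (fun l => delta_mx 0 l) Theta_C1
  (K_U (KX t t0)) e10.
have [d2 d20 H2] := cvg_time (vector_field_cvg Kx0 tI) e20.
have d1M : 0 < d1 / (M + 1) by rewrite divr_gt0.
exists (Num.min d2 (d1 / (M + 1))) => [|u v u0 ut tv uv vt]; first by rewrite lt_min d20.
set h := v - u; rewrite lt_min => /andP[hd2 hd1].
have h0 : 0 < h by rewrite subr_gt0.
have v0 : 0 <= v := le_trans u0 (ltW uv).
have Mh : M * h < d1.
  rewrite ltr_pdivlMr// in hd1; rewrite (le_lt_trans _ hd1)// mulrC.
  by rewrite ler_wpM2l ?(ltW h0)// lerDl.
have near s : u <= s -> s <= v -> `|s - t| < d2.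
  move=> us sv; rewrite (le_lt_trans _ hd2)// /h ler_norml; apply/andP; split; lra.
have b1 : `|x v x0 - x u x0| <= M * h by exact: (lip u v u0 (ltW uv) vt).
have b2 : `|x u x0 - X| < d1.
  rewrite distrC (le_lt_trans (lip u t u0 ut tt))// (le_lt_trans _ Mh)//.
  by rewrite ler_wpM2l// lerD2r.
have := H1 (x u x0) (x v x0 - x u x0) b2 (le_lt_trans b1 Mh).
rewrite -(row_sum_delta (x v x0 - x u x0)) [x u x0 + _]addrC subrK => b3.
have b4 : `|x v x0 - x u x0 - h *: ft| <= e2 * h.
  apply: (@mean_value_drift_mx _ _ _ (x ^~ x0) (fun s => f s (x s x0)));
    [exact: ltW|exact: ltW|exact: (flow_continuous x_sol K_sub)| |].
  - move=> s /andP[us _]; apply: (flow_derive x_sol K_sub) => //; exact: le_lt_trans us.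
  - move=> s /andP[/ltW us /ltW sv]; apply: H2; last exact: near.
    by rewrite (le_trans u0)// (le_trans sv).
have -> : Theta (x v x0) - Theta (x u x0) - h *: 'd Theta X ft =
    (Theta (x v x0) - Theta (x u x0) - 'd Theta X (x v x0 - x u x0)) +
    'd Theta X (x v x0 - x u x0 - h *: ft).
  have dE (a : 'rV[R]_n) : 'd Theta X (a - h *: ft) = 'd Theta X a - h *: 'd Theta X ft.
    by rewrite linearB linearZ.
  by rewrite dE addrA subrK.
rewrite (le_trans (ler_normD _ _))//.
have b5 : e1 * `|x v x0 - x u x0| <= h * (eta / 2).
  rewrite (le_trans (ler_wpM2l (ltW e10) b1))//.
  rewrite [leLHS](_ : _ = h * (M * e1)); last by ring.
  rewrite ler_wpM2l ?(ltW h0)// /e1 mulrCA ler_piMr ?divr_ge0 ?(ltW eta0)//.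
  by rewrite ler_pdivrMr// mul1r lerDl.
have b6 : c * (e2 * h) <= h * (eta / 2).
  rewrite [leLHS](_ : _ = h * (c * e2)); last by ring.
  rewrite ler_wpM2l ?(ltW h0)// /e2 mulrCA ler_piMr ?divr_ge0 ?(ltW eta0)//.
  by rewrite ler_pdivrMr// mul1r lerDl.
have b7 := le_trans (dB _) (ler_wpM2l c0 b4).
have : h * (eta / 2) + h * (eta / 2) = h * eta by field.
lra.
Qed.

Section Rate.
Variables (k : nat) (sg : R) (p : \bar R).
Hypothesis p1 : (1 <= p)%E.
Hypotheses (sg0 : 0 <= sg) (sg1 : sg < 1) (kn : (k < n)%N).

Definition rate t z := lp_measure p (alpha_acompound k sg (generalized_jacobian f Theta t z)).

Lemma rate_cvg tau x0 t : K x0 -> 0 <= t <= tau ->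
  rate s (x s x0) @[s --> within_time tau t] --> rate t (x t x0).
Proof.
move=> Kx0 tI; have /cvgrPdist_le Jcvg := generalized_jacobian_cvg Kx0 tI.
have [C C0 HC] := @lp_measure_alpha_lip R n k sg p p1 sg0 sg1 kn.
pose B := C * (n * n)%:R + 1; have B0 : 0 < B by rewrite ltr_wpDl// mulr_ge0.
apply/cvgrPdist_le => /= e e0.
have eB0 : 0 < e / B by rewrite divr_gt0.
have key (A A' : 'M[R]_n) : `|A - A'| <= e / B -> C * mnorm (A - A') <= e.
  rewrite ler_pdivlMr// => h; rewrite (le_trans _ h)//.
  rewrite (le_trans (ler_wpM2l C0 (mnorm_le_mx_norm _)))// mulrA mulrC ler_wpM2l//.
  by rewrite /B lerDl.
have close (a b c : R) : a <= b + c -> b <= a + c -> c <= e -> `|a - b| <= e.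
  by move=> *; rewrite ler_norml; apply/andP; split; lra.
apply: filterS (Jcvg _ eB0) => s /key; rewrite /rate => Hs.
have h1 := HC (generalized_jacobian f Theta t (x t x0)) (generalized_jacobian f Theta s (x s x0)).
have h2 := HC (generalized_jacobian f Theta s (x s x0)) (generalized_jacobian f Theta t (x t x0)).
rewrite -mnormN opprB in h2.
exact: close h1 h2 Hs.
Qed.

Lemma rate_continuous tau x0 : K x0 -> {within `[0, tau], continuous (fun t => rate t (x t x0))}.
Proof.
move=> Kx0; apply/subspace_continuousP => t /=; rewrite in_itv /= => tI.
exact: rate_cvg.
Qed.

Lemma local_scaled_step tau x0 t (eps : R) : K x0 -> 0 <= t <= tau -> 0 < eps ->
  exists2 dl : R, 0 < dl & forall u v, 0 <= u -> u <= t -> t <= v -> u < v ->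
    v <= tau -> v - u < dl ->
    compound_norm k sg p (Theta (x v x0) *m (1%:M + (v - u) *: J t (x t x0))
        *m invmx (Theta (x u x0)))
      <= expR ((v - u) * (rate t (x t x0) + eps)).
Proof.
move=> Kx0 tI eps0; have /andP[t0 tt] := tI.
have [d0 d00 H0] := compound_norm_step p1 sg0 sg1
  (generalized_jacobian f Theta t (x t x0)) kn eps0.
set A := J t (x t x0); set S := scaling_derivative f Theta t (x t x0).
set T := Theta (x t x0); set Ti := invmx T.
pose N : R := (n * n)%:R; have N0 : 0 <= N by [].
pose b := mnorm Ti + 1; have b0 : 0 <= b by rewrite addr_ge0 ?mnorm_ge0.
(* One summand for each term of the error [E] below, so that [mnorm E <= eta * B]. *)
pose B := mnorm S + b + mnorm A * b + mnorm T * mnorm A.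
have B0 : 0 <= B by rewrite !addr_ge0 ?mulr_ge0 ?mnorm_ge0.
have B10 : 0 < B + 1 by rewrite ltr_wpDl.
have N10 : 0 < N + 1 by rewrite ltr_wpDl.
pose eta := Num.min 1 (d0 / (B + 1)).
have eta0 : 0 < eta by rewrite lt_min ltr01 divr_gt0.
have eta1 : eta <= 1 by rewrite ge_min lexx.
have etaB : eta * B <= d0.
  apply: (@le_trans _ _ (d0 / (B + 1) * (B + 1))); last by rewrite divfK// gt_eqF.
  by apply: ler_pM => //; [exact: ltW|rewrite ge_min lexx orbT|rewrite lerDl].
have eN0 : 0 < eta / (N + 1) by rewrite divr_gt0.
have toN (m : 'M[R]_n) (r : R) : 0 <= r -> `|m| <= r * (eta / (N + 1)) -> mnorm m <= r * eta.
  move=> r0 h; rewrite (le_trans (mnorm_le_mx_norm m))// -/N (le_trans (ler_wpM2l N0 h))//.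
  rewrite mulrCA ler_wpM2l// mulrCA ler_piMr ?(ltW eta0)//.
  by rewrite ler_pdivrMr// mul1r lerDl.
have [d1 d10 H1] := Theta_increment Kx0 tI eN0.
have [d2 d20 H2] := cvg_time (Theta_cvg Kx0 tI) eN0.
have [d3 d30 H3] := cvg_time (invTheta_cvg Kx0 tI) eN0.
exists (Num.min (Num.min d0 d1) (Num.min d2 d3)) => [|u v u0 ut tv uv vt].
  by rewrite !lt_min d00 d10 d20.
set h := v - u; rewrite !lt_min => /andP[/andP[hd0 hd1] /andP[hd2 hd3]].
have h0 : 0 < h by rewrite subr_gt0.
have v0 : 0 <= v := le_trans u0 (ltW uv).
have ut' : u <= tau := le_trans (ltW uv) vt.
have b1 := H1 u v u0 ut tv uv vt hd1; rewrite -/S in b1.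
have b2 : `|Theta (x v x0) - T| <= eta / (N + 1).
  apply: H2; first by rewrite v0.
  by rewrite (le_lt_trans _ hd2)// /h ler_norml; apply/andP; split; lra.
have b3 : `|invmx (Theta (x u x0)) - Ti| <= eta / (N + 1).
  apply: H3; first by rewrite u0.
  by rewrite (le_lt_trans _ hd3)// /h ler_norml; apply/andP; split; lra.
set Tv := Theta (x v x0) in b1 b2 *; set Tu := Theta (x u x0) in b1 b3 *.
set Tui := invmx Tu in b3 *.
have TuV : Tu *m Tui = 1%:M.
  by apply: mulmxV; rewrite unitmxE unitfE; apply/Theta_det/(flow_stays K_inv).
pose r := h^-1 *: (Tv - Tu - h *: S).
(* The exact error when the scaled step is written as [1 + h] times the generalized Jacobian plus
   [E]. Each term has a factor that is small near [t]: a variation of [Theta] or of its inverse, or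
   the remainder [r]. *)
pose E := S *m (Tui - Ti) + r *m Tui + (Tv - T) *m A *m Tui + T *m A *m (Tui - Ti).
have -> : Tv *m (1%:M + h *: A) *m Tui =
    1%:M + h *: (generalized_jacobian f Theta t (x t x0) + E).
  rewrite /generalized_jacobian -/S -/T -/Ti -/A.
  have -> : S *m Ti + T *m A *m Ti + E = S *m Tui + r *m Tui + Tv *m A *m Tui.
    rewrite /E !mulmxBr !mulmxBl.
    move: (S *m Ti) (T *m A *m Ti) (S *m Tui) (r *m Tui) (Tv *m A *m Tui) (T *m A *m Tui).
    by move=> a1 a2 a3 a4 a5 a6; apply/matrixP => i j; rewrite !mxE; ring.
  rewrite -!mulmxDl scalemxAl -[X in _ = X + _]TuV -mulmxDl; congr (_ *m _).
  rewrite !scalerDr /r scalerA divff ?gt_eqF// scale1r mulmxDr mulmx1 -scalemxAr.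
  move: (h *: S) (h *: (Tv *m A)) => a1 a2.
  by apply/matrixP => i j; rewrite !mxE; ring.
apply: H0 => //; rewrite (le_trans _ etaB)//.
have rB : mnorm r <= eta.
  rewrite /r mnormZ gtr0_norm ?invr_gt0// ler_pdivrMl//.
  by apply: toN => //; exact: ltW.
have TvB : mnorm (Tv - T) <= eta by rewrite -[eta]mul1r; apply: toN; rewrite ?mul1r.
have TuB : mnorm (Tui - Ti) <= eta by rewrite -[eta]mul1r; apply: toN; rewrite ?mul1r.
have Tuib : mnorm Tui <= b.
  by rewrite -[Tui](subrK Ti) (le_trans (mnormD _ _))// addrC lerD2l (le_trans TuB).
have e0 := ltW eta0.
have p2 : mnorm (S *m (Tui - Ti)) <= mnorm S * eta.
  by rewrite (le_trans (mnormM _ _))// ler_wpM2l ?mnorm_ge0.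
have p3 : mnorm (r *m Tui) <= eta * b.
  by rewrite (le_trans (mnormM _ _))// ler_pM ?mnorm_ge0.
have p4 : mnorm ((Tv - T) *m A *m Tui) <= eta * mnorm A * b.
  rewrite (le_trans (mnormM _ _))// ler_pM ?mnorm_ge0//.
  by rewrite (le_trans (mnormM _ _))// ler_wpM2r ?mnorm_ge0.
have p5 : mnorm (T *m A *m (Tui - Ti)) <= mnorm T * mnorm A * eta.
  rewrite (le_trans (mnormM _ _))// ler_pM ?mnorm_ge0//; exact: mnormM.
have -> : eta * B = mnorm S * eta + eta * b + eta * mnorm A * b + mnorm T * mnorm A * eta.
  by rewrite /B; ring.
rewrite (le_trans (mnormD _ _))// lerD// (le_trans (mnormD _ _))// lerD//.
by rewrite (le_trans (mnormD _ _))// lerD.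
Qed.


Lemma flow0 y : K y -> x 0 y = y.
Proof. by move=> /K_sub/x_sol[]. Qed.

Lemma jacobian_bounded tau x0 : K x0 ->
  exists2 L : R, 0 <= L & forall t, 0 <= t <= tau -> mnorm (J t (x t x0)) <= L.
Proof.
move=> Kx0; have [|B HB] := @compact_locally_bounded R R `[0, tau]%classic
    (fun t => mnorm (J t (x t x0))) (@segment_compact _ 0 tau).
  move=> t /=; rewrite in_itv /= => tI.
  have [dl dl0 H] := cvg_time (jacobian_cvg Kx0 tI) ltr01.
  exists dl => //; exists ((n * n)%:R * (1 + `|J t (x t x0)|)) => s.
  rewrite /= in_itv /= => sI st; rewrite (le_trans (mnorm_le_mx_norm _))// ler_wpM2l//.
  rewrite -[X in `|X| <= _](subrK (J t (x t x0))) (le_trans (ler_normD _ _))// lerD2r.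
  exact: H.
exists `|B| => // t tI; apply: le_trans (ler_norm _); apply: HB.
by rewrite /= in_itv.
Qed.

(* [W] plays the role of the derivative, relative to [K], of the flow from time
   [u] to time [v] along the trajectory of [x0]. *)
Definition propagated x0 (L eps : R) u v := exists (W : 'M[R]_n) (dl : R), [/\ 0 < dl,
  forall w, `|w *m W^T| <= expR (L * (v - u)) * `|w|,
  forall y z, K y -> K z -> `|x u y - x u x0| < dl -> `|x u z - x u x0| < dl ->
    `|x v y - x v z| <= expR (L * (v - u)) * `|x u y - x u z| /\
    `|x v y - x v z - (x u y - x u z) *m W^T|
      <= eps * (v - u) * expR (L * (v - u)) * `|x u y - x u z| &
  compound_norm k sg p (Theta (x v x0) *m W *m invmx (Theta (x u x0)))
    <= expR (\int[lebesgue_measure]_(t in `[u, v]) rate t (x t x0) + eps * (v - u))].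

(** The error bound [eps (v - u) expR (L (v - u))] has the form that adds up under composition: the
    exponentials multiply and the lengths add. The inner factors of [Theta] cancel and the integrals
    add. *)
Lemma propagated_trans tau x0 (L eps u v w : R) : K x0 -> 0 <= L -> 0 <= eps ->
  0 <= u -> u < v -> v < w -> w <= tau ->
  propagated x0 L eps u v -> propagated x0 L eps v w -> propagated x0 L eps u w.
Proof.
move=> Kx0 L0 eps0 u0 uv vw wt [W1 [d1 [d10 B1 H1 N1]]] [W2 [d2 [d20 B2 H2 N2]]].
pose e1 := expR (L * (v - u)); pose e2 := expR (L * (w - v)).
have e10 : 0 < e1 := expR_gt0 _.
have e20 : 0 < e2 := expR_gt0 _.
have eE : expR (L * (w - u)) = e2 * e1 by rewrite -expRD; congr expR; ring.
exists (W2 *m W1), (Num.min d1 (d2 / e1)); rewrite eE; split.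
- by rewrite lt_min d10 divr_gt0.
- move=> z; rewrite trmx_mul mulmxA (le_trans (B2 _))// -mulrA ler_wpM2l ?(ltW e20)//.
- move=> y z Ky Kz; rewrite !lt_min => /andP[y1 y2] /andP[z1 z2].
  have close q : K q -> `|x u q - x u x0| < d1 -> `|x u q - x u x0| < d2 / e1 ->
      `|x v q - x v x0| < d2.
    move=> Kq q1; rewrite ltr_pdivlMr// mulrC; apply: le_lt_trans.
    by apply: (H1 q x0 Kq Kx0 q1 _).1; rewrite subrr normr0.
  have [h1 h2] := H1 y z Ky Kz y1 z1.
  have [h3 h4] := H2 y z Ky Kz (close y Ky y1 y2) (close z Kz z1 z2).
  rewrite -/e1 in h1 h2; rewrite -/e2 in h3 h4.
  split; first by rewrite (le_trans h3)// -mulrA ler_wpM2l// ltW.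
  set a := x v y - x v z in h1 h2 h3 h4; set b := x u y - x u z in h1 h2 *.
  set c := x w y - x w z in h3 h4 *.
  have -> : c - b *m (W2 *m W1)^T = (c - a *m W2^T) + (a - b *m W1^T) *m W2^T.
    rewrite trmx_mul mulmxA (mulmxBl a (b *m W1^T) W2^T).
    by move: (a *m _) (_ *m _) => q q'; rewrite addrA subrK.
  rewrite (le_trans (ler_normD _ _))//.
  have h5 : `|c - a *m W2^T| <= eps * (w - v) * e2 * (e1 * `|b|).
    rewrite (le_trans h4)// ler_wpM2l// !mulr_ge0 ?(ltW e20)// subr_ge0 ltW//.
  have h6 : `|(a - b *m W1^T) *m W2^T| <= e2 * (eps * (v - u) * e1 * `|b|).
    by rewrite (le_trans (B2 _))// -/e2 ler_wpM2l// ltW.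
  apply: (le_trans (lerD h5 h6)); rewrite le_eqVlt; apply/orP; left; apply/eqP; ring.
- have v0 : 0 <= v := le_trans u0 (ltW uv).
  set T2 := Theta _ in N2 *; set T1 := Theta (x v x0) in N1 N2; set T0 := Theta (x u x0) in N1 *.
  have T1V : invmx T1 *m T1 = 1%:M.
    by apply: mulVmx; rewrite unitmxE unitfE; apply/Theta_det/(flow_stays K_inv).
  have -> : T2 *m (W2 *m W1) *m invmx T0 =
      (T2 *m W2 *m invmx T1) *m (T1 *m W1 *m invmx T0).
    by rewrite !mulmxA -[T2 *m W2 *m invmx T1 *m T1]mulmxA T1V mulmx1.
  apply: (le_trans (compound_normM k p1 sg0 sg1 _ _)).
  apply: (le_trans (ler_pM _ _ N2 N1)); [exact: compound_norm_ge0|exact: compound_norm_ge0|].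
  rewrite -expRD ler_expR -(@Rintegral_segment_add _ _ u v w (ltW uv) (ltW vw)); last first.
    apply: continuous_subspaceW (@rate_continuous tau x0 Kx0) => t /=.
    by rewrite !in_itv /= => /andP[ut tw]; rewrite (le_trans u0 ut) (le_trans tw wt).
  rewrite le_eqVlt; apply/orP; left; apply/eqP; ring.
Qed.

Lemma propagated_local tau x0 (L eps : R) t : K x0 -> 0 < eps -> 0 <= t <= tau ->
  (forall t, 0 <= t <= tau -> mnorm (J t (x t x0)) <= L) ->
  exists2 dl : R, 0 < dl & forall u v, 0 <= u -> u <= t -> t <= v -> u < v ->
    v <= tau -> v - u < dl -> propagated x0 (2 * (L + 1)) eps u v.
Proof.
move=> Kx0 eps0 tI HL; have AL := HL t tI.
have L0 : 0 <= L := le_trans (mnorm_ge0 _) AL.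
have e2 : 0 < eps / 2 by rewrite divr_gt0.
have [d1 d10 H1] := local_linearization f_C1 Omega_dom x_sol K_sub K_compact K_inv Kx0 tI eps0 AL.
have [d2 d20 H2] := local_scaled_step Kx0 tI e2.
have [d3 d30 H3] := cvg_time (rate_cvg Kx0 tI) e2.
exists (Num.min d1 (Num.min d2 d3)) => [|u v u0 ut tv uv vt]; first by rewrite !lt_min d10 d20.
rewrite !lt_min => /andP[hd1 /andP[hd2 hd3]].
have h0 : 0 < v - u by rewrite subr_gt0.
set A := J t (x t x0) in AL.
have b1 : 1 + 2 * (L + 1) * (v - u) <= expR (2 * (L + 1) * (v - u)) by exact: expR_ge1Dx.
have trE (w : 'rV[R]_n) : w *m (1%:M + (v - u) *: A)^T = w + (v - u) *: (w *m A^T).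
  by rewrite linearD linearZ /= trmx1 mulmxDr mulmx1 -scalemxAr.
exists (1%:M + (v - u) *: A), d1; split => //.
- move=> w; rewrite trE (le_trans _ (ler_wpM2r (normr_ge0 w) b1))// mulrDl mul1r.
  rewrite (le_trans (ler_normD _ _))// lerD2l normrZ gtr0_norm//.
  rewrite [leRHS](_ : _ = (v - u) * (2 * (L + 1) * `|w|)); last by ring.
  rewrite ler_wpM2l ?(ltW h0)// (le_trans (mulmx_rv_norm _ _))// mnorm_tr mulrC.
  by rewrite ler_wpM2r// (le_trans AL)//; lra.
- move=> y z Ky Kz yu zu.
  have [h1 h2] := H1 u v u0 ut tv uv vt hd1 y z Ky Kz yu zu; split.
    by rewrite (le_trans h1)// ler_wpM2r.
  rewrite trE opprD addrA (le_trans h2)// ler_wpM2r// ler_peMr//.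
    by rewrite mulr_ge0// ltW.
  by rewrite (le_trans _ b1)// lerDl mulr_ge0 ?(ltW h0)// mulr_ge0// addr_ge0.
- apply: (le_trans (H2 u v u0 ut tv uv vt hd2)); rewrite ler_expR.
  have rc : {within `[u, v], continuous (fun t => rate t (x t x0))}.
    apply: continuous_subspaceW (@rate_continuous tau x0 Kx0) => s /=.
    by rewrite !in_itv /= => /andP[us sv]; rewrite (le_trans u0 us) (le_trans sv vt).
  have /(Rintegral_segment_ge (ltW uv) rc) :
      forall s, u <= s <= v -> rate t (x t x0) - eps / 2 <= rate s (x s x0).
    move=> s /andP[us sv].
    have : `|rate s (x s x0) - rate t (x t x0)| <= eps / 2.
      apply: H3; first by rewrite (le_trans u0 us) (le_trans sv vt).
      by rewrite (le_lt_trans _ hd3)// ler_norml; apply/andP; split; lra.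
    move: (rate _ _) (rate _ _) => a b; rewrite ler_norml => /andP[? _]; lra.
  move: (rate _ _) (Rintegral _ _ _) => a b.
  move=> ab; rewrite [leLHS](_ : _ = (a - eps / 2) * (v - u) + eps * (v - u)).
    by rewrite lerD2r.
  by field.
Qed.

Lemma flow_linearized tau x0 : K x0 -> 0 < tau ->
  exists A : R, forall eps : R, 0 < eps -> exists W : 'M[R]_n,
    [/\ forall i j, `|W i j| <= A, linearized_at K (x tau) x0 eps W &
     compound_norm k sg p (Theta (x tau x0) *m W *m invmx (Theta x0))
      <= expR (\int[lebesgue_measure]_(t in `[0, tau]) rate t (x t x0) + eps)].
Proof.
move=> Kx0 tau0; have [L L0 HL] := jacobian_bounded tau Kx0.
pose L' := 2 * (L + 1); have L'0 : 0 <= L' by rewrite mulr_ge0 ?addr_ge0.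
pose A := expR (L' * tau); have A0 : 0 < A := expR_gt0 _.
exists A => eps eps0.
(* Over the whole interval the linearization error is [eps1 * tau * A] and the exponent is off by
   [eps1 * tau]. *)
pose eps1 := Num.min (eps / tau) (eps / tau / A).
have e10 : 0 < eps1 by rewrite lt_min !divr_gt0.
have e1t : eps1 * tau <= eps by rewrite -ler_pdivlMr// ge_min lexx.
have e1A : eps1 * tau * A <= eps.
  by rewrite -ler_pdivlMr// -ler_pdivlMr// mulrAC ge_min lexx orbT.
have := @interval_induction R (propagated x0 L' eps1) tau tau0 _ _.
move=> [u v w u0 uv vw wt|t tI|W [dl [dl0 BW HW NW]]].
- exact: (@propagated_trans tau x0 L' eps1 u v w Kx0 L'0 (ltW e10)).
- exact: propagated_local.
rewrite subr0 -/A in BW HW NW; rewrite (flow0 Kx0) in NW.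
exists W; split.
(* An entry of [W] is a coordinate of the image of a unit vector, hence at most the growth factor
   [A], which does not involve [eps]. *)
- move=> i j; apply: (@le_trans _ _ `|delta_mx 0 j *m W^T : 'rV[R]_n|).
    have -> : W i j = (delta_mx 0 j *m W^T : 'rV[R]_n) 0 i by rewrite -rowE !mxE.
    exact: mx_norm_coord.
  rewrite (le_trans (BW _))// ler_piMr ?(ltW A0)//.
  apply: mx_norm_le => // i' j'; rewrite mxE.
  by case: (_ && _); rewrite ?normr1 ?normr0.
- exists dl => // y z Ky Kz yx zx.
  have := HW z y Kz Ky; rewrite (flow0 Ky) (flow0 Kz) (flow0 Kx0) => /(_ zx yx)[_ h].
  by rewrite (le_trans h)// ler_wpM2r.
- by rewrite (le_trans NW)// ler_expR lerD2l.
Qed.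

End Rate.
End ScaledFlow.

(** * Iterates of the time-tau map *)

Section Iteration.
Variables (R : realType) (n k : nat) (sg : R) (p : \bar R).
Hypothesis p1 : (1 <= p)%E.
Hypotheses (sg0 : 0 <= sg) (sg1 : sg < 1) (kn : (k < n)%N).
Implicit Types (K U : set 'rV[R]_n) (phi : 'rV[R]_n -> 'rV[R]_n) (M : 'M[R]_n).

Local Notation N := (compound_norm k sg p).

Lemma compound_norm1 : N (1%:M : 'M[R]_n) = 1.
Proof.
have bin0 j : (j <= n)%N -> (0 < 'C(n, j))%N by rewrite bin_gt0.
rewrite /compound_norm !mcompound1 (lp_mxnorm1 p1 (bin0 _ (ltnW kn))).
by rewrite (lp_mxnorm1 p1 (bin0 _ kn)) !powR1 mulr1.
Qed.

(** The matrices multiply as in the chain rule, the inner factors of [Theta] cancel, and the entry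
    bound stays independent of [eps]. *)
Lemma iter_linearized K phi (Theta : 'rV[R]_n -> 'M[R]_n) (q : R) :
  (forall z, K z -> K (phi z)) -> (forall z, K z -> \det (Theta z) != 0) -> 0 <= q ->
  (forall x, K x -> exists A : R, forall eps, 0 < eps -> exists W : 'M[R]_n,
    [/\ forall i j, `|W i j| <= A, linearized_at K phi x eps W &
     N (Theta (phi x) *m W *m invmx (Theta x)) <= q]) ->
  forall m x, K x -> exists A : R, forall eps, 0 < eps -> exists W : 'M[R]_n,
    [/\ forall i j, `|W i j| <= A, linearized_at K (iter m phi) x eps W &
     N (Theta (iter m phi x) *m W *m invmx (Theta x)) <= q ^+ m].
Proof.
move=> Kphi Theta_det q0 H; elim=> [|m IH] x Kx.
  exists 1 => eps eps0; exists 1%:M; split.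
  - by move=> i j; rewrite mxE; case: (_ == _); rewrite ?normr1 ?normr0.
  - exists 1 => // y z _ _ _ _; rewrite trmx1 mulmx1 subrr normr0.
    by rewrite mulr_ge0// ltW.
  - rewrite mulmx1 mulmxV ?unitmxE ?unitfE ?Theta_det//.
    by rewrite compound_norm1 expr0.
have Km z : K z -> K (iter m phi z).
  by move=> Kz; elim: (m) => //= m' ?; exact: Kphi.
have [A1 H1] := IH x Kx; have [A2 H2] := H _ (Km x Kx).
pose c1 := (n * n)%:R * `|A1|; pose c2 := (n * n)%:R * `|A2|.
have c10 : 0 <= c1 by rewrite mulr_ge0.
have c20 : 0 <= c2 by rewrite mulr_ge0.
have WB (A : R) (W : 'M[R]_n) : (forall i j, `|W i j| <= A) -> mnorm W <= (n * n)%:R * `|A|.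
  by move=> WA; apply: mnorm_le_card => i j; rewrite (le_trans (WA i j))// ler_norm.
exists (c2 * c1) => eps eps0.
have c110 : 0 < c1 + 1 by rewrite ltr_wpDl.
have c210 : 0 < c2 + 1 by rewrite ltr_wpDl.
pose e1 := Num.min 1 (eps / 2 / (c2 + 1)).
have e10 : 0 < e1 by rewrite lt_min ltr01 !divr_gt0.
have e11 : e1 <= 1 by rewrite ge_min lexx.
have e1c : e1 * c2 <= eps / 2.
  apply: (@le_trans _ _ (eps / 2 / (c2 + 1) * (c2 + 1))); last by rewrite divfK// gt_eqF.
  by apply: ler_pM => //; [exact: ltW|rewrite ge_min lexx orbT|rewrite lerDl].
have e20 : 0 < eps / 2 / (c1 + 1) by rewrite !divr_gt0.
have [W1 [W1A [d1 d10 L1] N1]] := H1 e1 e10.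
have [W2 [W2A [d2 d20 L2] N2]] := H2 _ e20.
have B1 := WB _ _ W1A; have B2 := WB _ _ W2A; rewrite -/c1 in B1; rewrite -/c2 in B2.
exists (W2 *m W1); split.
- move=> i j; rewrite (le_trans (mnorm_coord _ i j))// (le_trans (mnormM _ _))//.
  by rewrite ler_pM ?mnorm_ge0.
- have lip y z : K y -> K z -> `|y - x| < d1 -> `|z - x| < d1 ->
      `|iter m phi z - iter m phi y| <= (c1 + 1) * `|z - y|.
    move=> Ky Kz yx zx; have := L1 y z Ky Kz yx zx.
    move=> h; rewrite -[X in `|X| <= _](subrK ((z - y) *m W1^T)).
    rewrite (le_trans (ler_normD _ _))// addrC mulrDl mul1r lerD//.
      rewrite (le_trans (mulmx_rv_norm _ _))// mnorm_tr mulrC.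
      by rewrite ler_wpM2r.
    by rewrite (le_trans h)// ler_piMl.
  exists (Num.min d1 (d2 / (c1 + 1))) => [|y z Ky Kz]; first by rewrite lt_min d10 divr_gt0.
  rewrite !lt_min => /andP[y1 y2] /andP[z1 z2].
  have near w : K w -> `|w - x| < d1 -> `|w - x| < d2 / (c1 + 1) ->
      `|iter m phi w - iter m phi x| < d2.
    move=> Kw w1; rewrite ltr_pdivlMr// mulrC; apply: le_lt_trans.
    by apply: lip => //; rewrite subrr normr0.
  have h1 := L1 y z Ky Kz y1 z1.
  have h2 := L2 _ _ (Km y Ky) (Km z Kz) (near y Ky y1 y2) (near z Kz z1 z2).
  have h3 := lip y z Ky Kz y1 z1.
  rewrite !iterS; move: h1 h2 h3; set a := iter m phi z - iter m phi y.
  set b := z - y; set c := phi _ - phi _ => h1 h2 h3.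
  have -> : c - b *m (W2 *m W1)^T = (c - a *m W2^T) + (a - b *m W1^T) *m W2^T.
    rewrite trmx_mul mulmxA (mulmxBl a (b *m W1^T) W2^T).
    by move: (a *m _) (_ *m _) => r r'; rewrite addrA subrK.
  rewrite (le_trans (ler_normD _ _))//.
  have h4 : `|c - a *m W2^T| <= eps / 2 * `|b|.
    rewrite (le_trans h2)// (le_trans (ler_wpM2l (ltW e20) h3))// mulrA.
    by rewrite divfK// gt_eqF.
  have h5 : `|(a - b *m W1^T) *m W2^T| <= eps / 2 * `|b|.
    rewrite (le_trans (mulmx_rv_norm _ _))// mnorm_tr.
    rewrite (le_trans (ler_pM _ (mnorm_ge0 _) h1 B2))// mulrAC.
    by rewrite ler_wpM2r.
  by rewrite (le_trans (lerD h4 h5))// -mulrDl -splitr.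
- have TV : invmx (Theta (iter m phi x)) *m Theta (iter m phi x) = 1%:M.
    by rewrite mulVmx// unitmxE unitfE; apply/Theta_det/Km.
  rewrite iterS exprS.
  have -> : Theta (phi (iter m phi x)) *m (W2 *m W1) *m invmx (Theta x) =
      (Theta (phi (iter m phi x)) *m W2 *m invmx (Theta (iter m phi x))) *m
      (Theta (iter m phi x) *m W1 *m invmx (Theta x)).
    rewrite !mulmxA; congr (_ *m _ *m _).
    by rewrite -[_ *m invmx _ *m _]mulmxA TV mulmx1.
  apply: (le_trans (compound_normM k p1 sg0 sg1 _ _)).
  by apply: ler_pM => //; exact: compound_norm_ge0.
Qed.

Lemma mcompound_bound j M (r : R) : `|M| <= r ->
  mnorm (mcompound j M) <= ('C(n, j) * 'C(n, j))%:R * (#|{perm 'I_j}|%:R * r ^+ j).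
Proof.
move=> Mr; apply: mnorm_le_card => a b; rewrite mxE /determinant.
rewrite (le_trans (ler_norm_sum _ _ _))//.
rewrite mulr_natl -sumr_const ler_sum// => s _.
rewrite normrM normr_sign mul1r normr_prod -[j in _ ^+ j]card_ord -prodr_const.
by apply: ler_prod => i _; rewrite normr_ge0 mxE (le_trans (mx_norm_coord _ _ _)).
Qed.

Lemma compound_norm_bound (r : R) : exists B : R, forall M, `|M| <= r -> N M <= B.
Proof.
pose b j := ('C(n, j) * 'C(n, j))%:R * (#|{perm 'I_j}|%:R * r ^+ j).
exists (b k `^ (1 - sg) * b k.+1 `^ sg) => M Mr.
have s1 : 0 <= 1 - sg by rewrite subr_ge0 ltW.
have r0 : 0 <= r := le_trans (normr_ge0 _) Mr.
have le j (t : R) : 0 <= t -> lp_mxnorm p (mcompound j M) `^ t <= b j `^ t.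
  move=> t0; apply: ge0_ler_powR => //.
  - by rewrite nnegrE; exact: lp_mxnorm_ge0.
  - by rewrite nnegrE /b !mulr_ge0// exprn_ge0.
  - by apply: (le_trans (lp_mxnorm_mnorm p1 _)); exact: mcompound_bound.
by apply: ler_pM; [exact: powR_ge0|exact: powR_ge0|exact: le|exact: le].
Qed.

Lemma mnorm_lp_mxnorm m (A : 'M[R]_m) : mnorm A <= (m * m)%:R * lp_mxnorm p A.
Proof. by apply: mnorm_le_card => i j; exact: lp_mxnorm_coord. Qed.

(** Links the L_p quantity that the flow controls to the entry sums used by the covering
    estimate. *)
Lemma mnorm_compound_norm : exists2 C : R, 0 <= C & forall M,
  mnorm (mcompound k M) `^ (1 - sg) * mnorm (mcompound k.+1 M) `^ sg <= C * N M.
Proof.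
pose c j : R := ('C(n, j) * 'C(n, j))%:R.
exists (c k `^ (1 - sg) * c k.+1 `^ sg) => [|M]; first by rewrite mulr_ge0 ?powR_ge0.
have s1 : 0 <= 1 - sg by rewrite subr_ge0 ltW.
have le j (t : R) : 0 <= t ->
    mnorm (mcompound j M) `^ t <= c j `^ t * lp_mxnorm p (mcompound j M) `^ t.
  move=> t0; rewrite -powRM; [|by []|exact: lp_mxnorm_ge0].
  apply: ge0_ler_powR => //; rewrite ?nnegrE; first exact: mnorm_ge0.
    by apply: mulr_ge0 => //; exact: lp_mxnorm_ge0.
  exact: mnorm_lp_mxnorm.
rewrite /compound_norm mulrACA.
by apply: ler_pM; [exact: powR_ge0|exact: powR_ge0|exact: le|exact: le].
Qed.

Lemma scaling_compound_bound K (T : 'rV[R]_n -> 'M[R]_n) : compact K ->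
  (forall z, K z -> T w @[w --> z] --> T z) ->
  exists2 B : R, 0 < B & forall z, K z -> N (T z) <= B.
Proof.
move=> cK cT.
have [|r Hr] := compact_locally_bounded (h := fun z => `|T z|) cK.
  move=> z Kz; have /cvgr_dist_lt/(_ 1 ltr01)/nbhs_ballP[dl /= dl0 Hdl] := cT z Kz.
  exists dl => //; exists (`|T z| + 1) => w _ wz.
  have /ltW : `|T z - T w| < 1 by apply: Hdl; rewrite -ball_normE /ball_ /= distrC.
  have := ler_normD (T z) (T w - T z); rewrite addrC subrK [`|T w - _|]distrC.
  by move=> h1 h2; rewrite (le_trans h1)// lerD2l.
have [B HB] := compound_norm_bound r.
exists (`|B| + 1) => [|z Kz]; first by rewrite ltr_wpDl.
apply: (le_trans (HB _ (Hr z Kz))); rewrite (le_trans (ler_norm _))// lerDl ler01//.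
Qed.

Lemma hausdorff_dim_lt_of_scaled_contraction K U phi (Theta : 'rV[R]_n -> 'M[R]_n) (q : R) :
  (0 < k)%N -> compact K -> K = phi @` K -> K `<=` U -> C1_on U Theta ->
  (forall z, K z -> \det (Theta z) != 0) -> 0 <= q -> q < 1 ->
  (forall x, K x -> exists A : R, forall eps, 0 < eps -> exists W : 'M[R]_n,
    [/\ forall i j, `|W i j| <= A, linearized_at K phi x eps W &
     N (Theta (phi x) *m W *m invmx (Theta x)) <= q]) ->
  (hausdorff_dim K < (k%:R + sg)%:E)%E.
Proof.
move=> k0 cK Kphi KU [_ dT _] Theta_det q0 q1 H.
have phiK z : K z -> K (phi z) by move=> Kz; rewrite Kphi; exists z.
have cT z : K z -> Theta w @[w --> z] --> Theta z.
  by move=> Kz; apply: differentiable_continuous; exact/dT/KU.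
have cTi z : K z -> invmx (Theta w) @[w --> z] --> invmx (Theta z).
  by move=> Kz; exact: (cvg_invmx (Theta_det z Kz) (cT z Kz)).
have [B1 B10 HB1] := scaling_compound_bound cK cT.
have [B2 B20 HB2] := scaling_compound_bound cK cTi.
have [C C0 HC] := mnorm_compound_norm.
have kkn : (0 < k < n)%N by rewrite k0.
have [kappa kappa0 main] := @hausdorff_dim_lt_of_small_compounds R n k sg kkn sg0 sg1.
have q1' : `|q| < 1 by rewrite ger0_norm.
(* Enough iterates for [q ^+ m] to beat the change of norm [C] and the removal of [Theta] at both
   ends, [B1] and [B2]. *)
have [m Hm] := cvg_expr_mull (C * (B2 * B1)) q1' kappa0.
have {}Hm : q ^+ m * (C * (B2 * B1)) <= kappa.
  by rewrite (le_trans (ler_norm _))// Hm.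
apply: (main K (iter m phi) cK).
  rewrite eqEsubset; split.
    elim: (m) => [|m' IH] z Kz; first by exists z.
    have [y Ky <-] : (phi @` K) z by rewrite -Kphi.
    have [w Kw <-] := IH y Ky; by exists w.
  move=> _ [z Kz <-]; elim: (m) => //= m' ?; exact: phiK.
move=> x Kx; have [A HA] := iter_linearized phiK Theta_det q0 H m Kx.
exists A => eps eps0; have [W [WA Wlin WN]] := HA eps eps0.
exists W; split => //; apply: le_trans (HC W) _.
have Kmx : K (iter m phi x) by elim: (m) => //= m' ?; exact: phiK.
set T1 := Theta x in WN; set T2 := Theta (iter m phi x) in WN.
have T1V : invmx T1 *m T1 = 1%:M by rewrite mulVmx// unitmxE unitfE; exact: Theta_det.
have T2V : invmx T2 *m T2 = 1%:M by rewrite mulVmx// unitmxE unitfE; exact: Theta_det.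
have -> : W = invmx T2 *m (T2 *m W *m invmx T1) *m T1.
  by rewrite !mulmxA T2V mul1mx -mulmxA T1V mulmx1.
apply: le_trans Hm; rewrite [leRHS](_ : _ = C * (B2 * q ^+ m * B1)); last by ring.
apply: ler_wpM2l => //; apply: (le_trans (compound_normM k p1 sg0 sg1 _ _)).
apply: ler_pM; [exact: compound_norm_ge0|exact: compound_norm_ge0| |exact: HB1].
apply: (le_trans (compound_normM k p1 sg0 sg1 _ _)).
by apply: ler_pM; [exact: compound_norm_ge0|exact: compound_norm_ge0|exact: HB2|].
Qed.

End Iteration.

Theorem theorem8 (R : realType) (n : nat)
    (f x : R -> 'rV[R]_n -> 'rV[R]_n)
    (D K : set 'rV[R]_n) (Omega : set (R * 'rV[R]_n)) (U : set 'rV[R]_n)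
    (Theta : 'rV[R]_n -> 'M[R]_n)
    (alpha s : R) (k : nat) (p : \bar R) (tau : R)
    (f_C1 : C1_on Omega (fun z : R * 'rV[R]_n => f z.1 z.2))
    (Omega_dom : forall t z, 0 <= t -> D z -> Omega (t, z))
    (x_sol : forall x0, D x0 -> is_solution f x0 (x ^~ x0))
    (D_inv : invariant_set x D)
    (K_sub : K `<=` D)
    (K_compact : compact K)
    (K_inv : strongly_invariant x K)
    (alpha_ge1 : 1 <= alpha) (alpha_ltn : alpha < n%:R)
    (alphaE : alpha = k%:R + s) (s_ge0 : 0 <= s) (s_lt1 : s < 1)
    (K_U : K `<=` U)
    (Theta_C1 : C1_on U Theta)
    (Theta_det : forall z, K z -> \det (Theta z) != 0)
    (p_ge1 : (1 <= p)%E) (tau_gt0 : 0 < tau)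
    (gamma_lt0 :
      (contraction_rate k s p (generalized_jacobian f Theta) x K tau < 0)%E) :
  (hausdorff_dim K < alpha%:E)%E.
Proof.
have k0 : (0 < k)%N.
  rewrite lt0n; apply/eqP => k00.
  by move: alpha_ge1; rewrite alphaE k00 add0r leNgt s_lt1.
have kn : (k < n)%N.
  by rewrite -(ltr_nat R) (le_lt_trans _ alpha_ltn)// alphaE lerDl.
(* Twice [eta], because one [eta] will be spent on the accuracy of the linearization. *)
have [eta eta0 Heta] : exists2 eta : R, 0 < eta & forall x0, K x0 ->
    \int[lebesgue_measure]_(t in `[0, tau])
      rate f Theta k s p t (x t x0) <= - (2 * eta).
  move: gamma_lt0; rewrite /contraction_rate; set S := [set _ | _ in K].
  have ub := @ereal_sup_ubound R S.
  (* The supremum is [-oo] only if [K] is empty, and then any [eta] will do. *)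
  case: (ereal_sup S) ub => [r|//|] ub.
    rewrite lte_fin => r0; exists (- r / 2) => [|x0 Kx0]; first lra.
    have := ub _ (ex_intro2 _ _ x0 Kx0 erefl); rewrite lee_fin => h.
    by rewrite mulrC divfK// opprK.
  move=> _; exists 1 => // x0 Kx0.
  by have := ub _ (ex_intro2 _ _ x0 Kx0 erefl).
have q1 : expR (- eta) < 1 by rewrite expR_lt1 oppr_lt0.
rewrite alphaE.
apply: (@hausdorff_dim_lt_of_scaled_contraction R n k s p p_ge1 s_ge0 s_lt1 kn K U (x tau)
  Theta (expR (- eta)) k0 K_compact (K_inv tau (ltW tau_gt0)) K_U Theta_C1 Theta_det (expR_ge0 _) q1).
move=> x0 Kx0.
have [A HA] := flow_linearized f_C1 Omega_dom x_sol K_sub K_compact K_inv K_U Theta_C1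
  Theta_det p_ge1 s_ge0 s_lt1 kn Kx0 tau_gt0.
exists A => eps eps0.
have [|W [WA Wlin WN]] := HA (Num.min eps eta); first by rewrite lt_min eps0.
exists W; split => //.
  have [dl dl0 Hdl] := Wlin; exists dl => // y z Ky Kz yx zx.
  by rewrite (le_trans (Hdl y z Ky Kz yx zx))// ler_wpM2r// ge_min lexx.
apply: (le_trans WN); rewrite ler_expR.
have : Num.min eps eta <= eta by rewrite ge_min lexx orbT.
have := Heta x0 Kx0; lra.
Qed.
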